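(* For any words $w_1,w_2$ in the letters $\{\mathbf{2},\mathbf{3},\mathbf{4},\ldots\}$ (i.e. $w_i=\mathbf{n}_1\cdots\mathbf{n}_r$ with all $n_j\ge2$), one has \[ \big(\mathfrak{z}^{\mathrm{sh}}\otimes\mathfrak{g}^{\mathrm{sh}}\big)\circ\Delta\big(\mathrm{har}(I(w_1),I(w_2))-I(w_1)I(w_2)\big)=0, \] where $I(w_1)I(w_2)$ is the product (shuffle product) in $\mathcal{I}^1_\bullet$ and $(\mathfrak{z}^{\mathrm{sh}}\otimes\mathfrak{g}^{\mathrm{sh}})(a\otimes b)=\mathfrak{z}^{\mathrm{sh}}(a)\mathfrak{g}^{\mathrm{sh}}(b)$.
   Context: Hopf algebra. Let $\mathcal{I}_\bullet$ be the $\mathbb{Q}$-vector space spanned by symbols $\mathbb{I}(a_0;a_1,\ldots,a_N;a_{N+1})$ ($N\ge 0$, $a_i\in\{0,1\}$) subject to: (I1) $\mathbb{I}(a;\emptyset;b)=1$; (I2) the product is the shuffle product: $\mathbb{I}(a_0;a_1,\ldots,a_N;a_{N+N'+1})\,\mathbb{I}(a_0;a_{N+1},\ldots,a_{N+N'};a_{N+N'+1})=\sum_{\sigma\in\Sigma(N,N')}\mathbb{I}(a_0;a_{\sigma^{-1}(1)},\ldots,a_{\sigma^{-1}(N+N')};a_{N+N'+1})$, $\Sigma(N,N')$ being the $\sigma\in\mathfrak{S}_{N+N'}$ with $\sigma(1)<\cdots<\sigma(N)$, $\sigma(N+1)<\cdots<\sigma(N+N')$; (I3) for $x\in\{0,1\}$,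 $\mathbb{I}(a_0;a_1,\ldots,a_N;a_{N+1})=\sum_{k=0}^N\mathbb{I}(a_0;a_1,\ldots,a_k;x)\mathbb{I}(x;a_{k+1},\ldots,a_N;a_{N+1})$; (I4) $\mathbb{I}(a;a_1,\ldots,a_N;a)=0$ for $N\ge1$. It is a commutative graded Hopf algebra with Goncharov coproduct $\Delta\,\mathbb{I}(a_0;a_1,\ldots,a_N;a_{N+1})=\sum_{k=0}^{N}\sum_{0=i_0<i_1<\cdots<i_k<i_{k+1}=N+1}\prod_{p=0}^k\mathbb{I}(a_{i_p};a_{i_p+1},\ldots,a_{i_{p+1}-1};a_{i_{p+1}})\otimes\mathbb{I}(a_0;a_{i_1},\ldots,a_{i_k};a_{N+1})$. Let $\mathcal{I}^1_\bullet=\mathcal{I}_\bullet/\mathbb{I}(0;0;1)\mathcal{I}_\bullet$ (a quotient Hopf algebra), $I(\cdots)$ the images, $\Delta$ the induced coproduct. Put $I(n_1,\ldots,n_r)=I(0;1,0^{n_1-1},\ldots,1,0^{n_r-1};1)$ ($n_i\ge1$), $I()=1$; these form a $\mathbb{Q}$-basis of $\mathcal{I}^1_\bullet$. For a word $w=\mathbf{n}_1\cdots\mathbf{n}_r$ write $I(w)=I(n_1,\ldots,n_r)$. Regularised MZVs. $\zeta(n_1,\ldots,n_r)=\sum_{0<m_1<\cdots<m_r}m_1^{-n_1}\cdots m_r^{-n_r}$ ($n_r\ge2$). In $\mathfrak{H}=\mathbb{Q}\langle\mathbf{0},\mathbf{1}\rangle$ with shuffle product, $\mathfrak{H}^1=\mathbb{Q}+\mathbf{1}\mathfrak{H}$,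 $\mathfrak{H}^0=\mathbb{Q}+\mathbf{1}\mathfrak{H}\mathbf{0}$, $\mathbf{n}=\mathbf{1}\mathbf{0}^{n-1}$; $Z:\mathfrak{H}^0\to\mathbb{R}$, $\mathbf{n}_1\cdots\mathbf{n}_r\mapsto\zeta(n_1,\ldots,n_r)$, is a shuffle-algebra homomorphism and $Z^{\mathrm{sh}}:\mathfrak{H}^1\to\mathbb{R}[T]$ the unique shuffle-algebra homomorphism extending $Z$ with $\mathbf{1}\mapsto T$; $\zeta^{\mathrm{sh}}(n_1,\ldots,n_r)$ is the constant term of $Z^{\mathrm{sh}}(\mathbf{n}_1\cdots\mathbf{n}_r)$, and $\mathfrak{z}^{\mathrm{sh}}:\mathcal{I}^1_\bullet\to\mathbb{R}$ the $\mathbb{Q}$-linear map $I(n_1,\ldots,n_r)\mapsto\zeta^{\mathrm{sh}}(n_1,\ldots,n_r)$, $1\mapsto1$. The map $\mathfrak{g}^{\mathrm{sh}}$. $H\binom{n_1,\ldots,n_r}{x_1,\ldots,x_r}=\sum_{0<u_1<\cdots<u_r}\prod_{j}e^{u_jx_j}\big(\frac{q^{u_j}}{1-q^{u_j}}\big)^{n_j}\in\mathbb{Q}[[q]][[x_1,\ldots,x_r]]$; $h(x_1,\ldots,x_r)=\sum_{(i_1,\ldots,i_m)}\frac{1}{i_1!\cdots i_m!}H\binom{i_1,\ldots,i_m}{y_1,\ldots,y_m}$ over compositions $i_1+\cdots+i_m=r$, with $y_1=x_1+\cdots+x_{i_1}$, ..., $y_m=x_{i_1+\cdots+i_{m-1}+1}+\cdots+x_r$;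 $g_{\mathrm{sh}}(x_1,\ldots,x_r)=h(x_r-x_{r-1},\ldots,x_2-x_1,x_1)$; $g^{\mathrm{sh}}_{n_1,\ldots,n_r}(q)$ is the coefficient of $x_1^{n_1-1}\cdots x_r^{n_r-1}$ in $g_{\mathrm{sh}}(-2\pi\sqrt{-1}x_1,\ldots,-2\pi\sqrt{-1}x_r)$; $\mathfrak{g}^{\mathrm{sh}}:\mathcal{I}^1_\bullet\to\mathbb{C}[[q]]$ is the $\mathbb{Q}$-linear map $I(n_1,\ldots,n_r)\mapsto g^{\mathrm{sh}}_{n_1,\ldots,n_r}(q)$, $1\mapsto1$. Harmonic product. On $\mathfrak{H}^1$ (freely generated as an algebra by $\mathbf{1},\mathbf{2},\mathbf{3},\ldots$) define $*$ bilinearly and inductively by $\mathbf{n}_1w*\mathbf{n}_2w'=\mathbf{n}_1(w*\mathbf{n}_2w')+\mathbf{n}_2(\mathbf{n}_1w*w')+\mathbf{1}\mathbf{0}^{n_1+n_2-1}(w*w')$, $w*1=1*w=w$. For a word $w$ in $\{\mathbf{1},\mathbf{2},\ldots\}$ let $c_w$ be the coefficient functional of $w$. The $\mathbb{Q}$-bilinear map $\mathrm{har}:\mathcal{I}^1_\bullet\times\mathcal{I}^1_\bullet\to\mathcal{I}^1_\bullet$ is given on basis elements by $\mathrm{har}(I(w_1),I(w_2))=\sum_{w}c_w(w_1*w_2)I(w)$.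
   Formalization: Here g^sh_{n_1,…,n_r} is the coefficient of x_1^{n_1-1}⋯x_r^{n_r-1} in (−2π√−1)^r g_sh(−2π√−1 x_1,…,−2π√−1 x_r); without the factor (−2π√−1)^r the claim fails for w_1=w_2=2 at q^2. *)

(* Defs.v *)
From HB Require Import structures.
From mathcomp Require Import all_boot all_order all_algebra all_fingroup.
From mathcomp Require Import generic_quotient ring_quotient sesquilinear.
From mathcomp Require Import all_classical all_reals all_analysis.
From mathcomp Require Import finmap complex.
From mathcomp Require monalg mpoly.
(* The notations of monalg and mpoly clash with those of the other libraries. *)
Import -(notations) monalg.
Import -(notations) mpoly.

Set Implicit Arguments.
Unset Strict Implicit.
Unset Printing Implicit Defensive.

Import Order.TTheory GRing.Theory Num.Theory numFieldNormedType.Exports.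
Local Open Scope ring_scope.
Local Open Scope quotient_scope.

(** * Quotients of commutative algebras *)

Section IdealGen.
Variables (A : comNzRingType) (S : A -> Prop).

Definition ideal_gen (x : A) : bool :=
  `[< exists s : seq (A * A),
        (forall p, p \in s -> S p.2) /\ x = \sum_(p <- s) p.1 * p.2 >].

Lemma ideal_gen_in r : S r -> ideal_gen r.
Proof.
move=> Sr; apply/asboolP; exists [:: (1, r)]; split.
  by move=> p; rewrite inE => /eqP ->.
by rewrite big_seq1 mul1r.
Qed.

Lemma ideal_gen_closed : ~~ ideal_gen 1 -> idealr_closed ideal_gen.
Proof.
move=> h1; split.
- by apply/asboolP; exists [::]; split=> [p|]; rewrite ?big_nil.
- exact: h1.
move=> a x y /asboolP[s [hs ->]] /asboolP[t [ht ->]]; apply/asboolP.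
exists ([seq (a * p.1, p.2) | p <- s] ++ t); split.
  move=> p; rewrite mem_cat => /orP[/mapP[q qs ->]|]; [exact: (hs q) | exact: ht].
rewrite big_cat big_map mulr_sumr /=; congr (_ + _).
by apply: eq_bigr => p _; rewrite mulrA.
Qed.

End IdealGen.

Section QuotientAlgebra.
Variables (K : nzRingType) (A : comAlgType K) (J : idealr A).

Definition qalg := {ideal_quot J}.

HB.instance Definition _ := GRing.ComNzRing.on qalg.

Definition qproj (x : A) : qalg := \pi_({ideal_quot J}) x.

Lemma qproj_is_zmod_morphism : zmod_morphism qproj.
Proof. by move=> x y; rewrite /qproj [LHS]rmorphB. Qed.
Lemma qproj_is_monoid_morphism : monoid_morphism qproj.
Proof.
split; first exact: (rmorph1 (\pi_({ideal_quot J}))).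
by move=> x y; exact: (rmorphM (\pi_({ideal_quot J}))).
Qed.
HB.instance Definition _ := GRing.isZmodMorphism.Build A qalg qproj
  qproj_is_zmod_morphism.
HB.instance Definition _ := GRing.isMonoidMorphism.Build A qalg qproj
  qproj_is_monoid_morphism.

Lemma qproj_eq0 x : (qproj x == 0) = J x.
Proof.
by rewrite -[X in _ == X](rmorph0 qproj) /qproj -Quotient.idealrBE subr0.
Qed.

Definition qscale (c : K) (x : qalg) : qalg := qproj c%:A * x.

Lemma qscaleA a b v : qscale a (qscale b v) = qscale (a * b) v.
Proof. by rewrite /qscale mulrA -rmorphM /= -scalerAl mul1r scalerA. Qed.
Lemma qscale1 : left_id 1 qscale.
Proof. by move=> v; rewrite /qscale scale1r rmorph1 mul1r. Qed.
Lemma qscaleDr : right_distributive qscale +%R.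
Proof. by move=> c u v; rewrite /qscale mulrDr. Qed.
Lemma qscaleDl v : {morph qscale^~ v : a b / a + b}.
Proof. by move=> a b; rewrite /qscale scalerDl rmorphD mulrDl. Qed.

HB.instance Definition _ := GRing.Zmodule_isLmodule.Build K qalg
  qscaleA qscale1 qscaleDr qscaleDl.

Lemma qprojZ (c : K) (x : A) : qproj (c *: x) = c *: qproj x.
Proof. by rewrite /GRing.scale /= /qscale -rmorphM /= -scalerAl mul1r. Qed.
HB.instance Definition _ := GRing.isScalable.Build K A qalg *:%R qproj qprojZ.

Lemma qscaleAl (a : K) (u v : qalg) : a *: (u * v) = (a *: u) * v.
Proof. exact: mulrA. Qed.

HB.instance Definition _ := GRing.Lmodule_isLalgebra.Build K qalg qscaleAl.
HB.instance Definition _ := GRing.Lalgebra_isComAlgebra.Build K qalg.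

End QuotientAlgebra.

(** * Tensor products over the rational numbers *)

Section Tensor.
Variables A B : lmodType rat.

Definition tens_free := malg (A * B)%type rat.
Definition pair_free (a : A) (b : B) : tens_free := mkmalgU (a, b) 1.

Inductive tens_rel : tens_free -> Prop :=
| TensDl a a' b : tens_rel (pair_free (a + a') b - pair_free a b - pair_free a' b)
| TensDr a b b' : tens_rel (pair_free a (b + b') - pair_free a b - pair_free a b')
| TensZl c a b : tens_rel (pair_free (c *: a) b - c *: pair_free a b)
| TensZr c a b : tens_rel (pair_free a (c *: b) - c *: pair_free a b).

Definition tens_null (x : tens_free) : bool :=
  `[< exists s : seq (rat * tens_free),
        (forall p, p \in s -> tens_rel p.2) /\ x = \sum_(p <- s) p.1 *: p.2 >].

Lemma tens_nullZ c x : tens_null x -> tens_null (c *: x).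
Proof.
move=> /asboolP[s [hs ->]]; apply/asboolP.
exists [seq (c * p.1, p.2) | p <- s]; split.
  by move=> p /mapP[q qs ->]; exact: (hs q).
rewrite big_map scaler_sumr; apply: eq_bigr => p _.
by rewrite scalerA.
Qed.

Lemma tens_null_zmod : zmod_closed (tens_null : {pred tens_free}).
Proof.
split; first by apply/asboolP; exists [::]; split=> [p|]; rewrite ?big_nil.
move=> x y hx /(tens_nullZ (-1)); rewrite scaleN1r.
move: hx => /asboolP[s [hs ->]] /asboolP[t [ht ->]]; apply/asboolP.
exists (s ++ t); split; last by rewrite big_cat.
by move=> p; rewrite mem_cat => /orP[]; [exact: hs | exact: ht].
Qed.

HB.instance Definition _ := GRing.isZmodClosed.Build tens_free tens_null
  tens_null_zmod.

Definition tens_nullC := GRing.ZmodClosed.clone tens_free tens_null _.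

Definition tensor := Quotient.quot tens_nullC.
HB.instance Definition _ := GRing.Zmodule.on tensor.

Definition tproj (x : tens_free) : tensor :=
  \pi_(Quotient.quot tens_nullC) x.

Lemma tproj_is_zmod_morphism : zmod_morphism tproj.
Proof. by move=> x y; rewrite /tproj [LHS]raddfB. Qed.
HB.instance Definition _ := GRing.isZmodMorphism.Build tens_free tensor tproj
  tproj_is_zmod_morphism.

Lemma tproj_eq0 x : (tproj x == 0) = tens_null x.
Proof.
by rewrite -[X in _ == X](raddf0 tproj) /tproj -Quotient.idealrBE subr0.
Qed.

Lemma tproj_repr (t : tensor) : tproj (repr t) = t.
Proof. exact: reprK. Qed.

Definition tscale (c : rat) (t : tensor) : tensor := tproj (c *: repr t).

Lemma tprojZ c x : tproj (c *: x) = tscale c (tproj x).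
Proof.
apply/eqP; rewrite -subr_eq0 /tscale -raddfB tproj_eq0 -scalerBr.
by apply: tens_nullZ; rewrite -tproj_eq0 raddfB /= tproj_repr subrr.
Qed.

Lemma tscaleA a b v : tscale a (tscale b v) = tscale (a * b) v.
Proof. by rewrite -[v]tproj_repr -!tprojZ scalerA. Qed.
Lemma tscale1 : left_id 1 tscale.
Proof. by move=> v; rewrite -[v in LHS]tproj_repr -tprojZ scale1r tproj_repr. Qed.
Lemma tscaleDr : right_distributive tscale +%R.
Proof.
move=> c u v; rewrite -[u]tproj_repr -[v]tproj_repr -raddfD -!tprojZ.
by rewrite scalerDr raddfD.
Qed.
Lemma tscaleDl v : {morph tscale^~ v : a b / a + b}.
Proof. by move=> a b; rewrite -[v]tproj_repr -!tprojZ scalerDl raddfD. Qed.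

HB.instance Definition _ := GRing.Zmodule_isLmodule.Build rat tensor
  tscaleA tscale1 tscaleDr tscaleDl.
HB.instance Definition _ := GRing.isScalable.Build rat tens_free tensor *:%R
  tproj tprojZ.

Definition tens (a : A) (b : B) : tensor := tproj (pair_free a b).

Lemma tens_rel0 r : tens_rel r -> tproj r = 0.
Proof.
move=> hr; apply/eqP; rewrite tproj_eq0; apply/asboolP; exists [:: (1, r)].
by split=> [p|]; [rewrite inE => /eqP -> | rewrite big_seq1 scale1r].
Qed.

Lemma tensDl a a' b : tens (a + a') b = tens a b + tens a' b.
Proof.
by apply/eqP; rewrite -subr_eq0 opprD addrA -!raddfB; apply/eqP/tens_rel0/TensDl.
Qed.
Lemma tensDr a b b' : tens a (b + b') = tens a b + tens a b'.
Proof.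
by apply/eqP; rewrite -subr_eq0 opprD addrA -!raddfB; apply/eqP/tens_rel0/TensDr.
Qed.
Lemma tensZl c a b : tens (c *: a) b = c *: tens a b.
Proof.
by apply/eqP; rewrite -subr_eq0 -linearZ -raddfB; apply/eqP/tens_rel0/TensZl.
Qed.
Lemma tensZr c a b : tens a (c *: b) = c *: tens a b.
Proof.
by apply/eqP; rewrite -subr_eq0 -linearZ -raddfB; apply/eqP/tens_rel0/TensZr.
Qed.

End Tensor.

(** The map [z (x) g], with values in power series in [q] given by their
    coefficients; [z] and [g] are meant to be [Q]-linear. *)
Section TensorMap.
Variables (R : realType) (A B : lmodType rat).

Definition tens_map (z : A -> R) (g : B -> nat -> R[i]) (t : tensor A B)
    (m : nat) : R[i] :=
  \sum_(p <- monalg.msupp (repr t))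
    ratr (monalg.mcoeff p (repr t)) * ((z p.1)%:C%C * g p.2 m).

Variables (z : {linear A -> R | ratr \; *%R}).
Variables (g : {linear B -> (nat -> R[i]^o) | ratr \; *:%R}).

Let F m (x : tens_free A B) : R[i] :=
  monalg.mmap ratr (fun p => (z p.1)%:C%C * g p.2 m) x.

Let F_proj m x : tens_map z g (tproj x) m = F m x.
Proof.
have FB y y' : F m (y - y') = F m y - F m y' by rewrite /F raddfB.
have FZ c y : F m (c *: y) = ratr c * F m y.
  rewrite /F (monalg.mmapEw (monalg.msuppZ_le _ _)) monalg.mmapE mulr_sumr.
  by apply: eq_bigr => k _; rewrite monalg.mcoeffZ /= rmorphM /= -!mulrA.
have FU a b : F m (pair_free a b) = (z a)%:C%C * g b m.
  by rewrite /F monalg.mmapU /= rmorph1 mul1r.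
have rel0 y : tens_rel y -> F m y = 0.
  case=> [a a' b|a b b'|c a b|c a b].
  - by rewrite !FB !FU linearD rmorphD mulrDl /= addrAC addrK subrr.
  - rewrite !FB !FU linearD mulrDr /=.
    by rewrite addrAC addrK subrr.
  - rewrite FB FZ !FU linearZ_LR /= rmorphM /=.
    by rewrite fmorph_rat mulrA subrr.
  - by rewrite FB FZ !FU linearZ_LR /= mulrCA subrr.
have null0 y : tens_null y -> F m y = 0.
  move=> /asboolP[s [hs ->]].
  have -> : F m (\sum_(p <- s) p.1 *: p.2) = \sum_(p <- s) F m (p.1 *: p.2).
    by rewrite /F raddf_sum.
  by rewrite big_seq big1 // => p ps; rewrite FZ rel0 ?mulr0 //; exact: hs.
rewrite /tens_map; change (F m (repr (tproj x)) = F m x).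
apply/eqP; rewrite -subr_eq0 -FB null0 //.
by rewrite -tproj_eq0 raddfB /= tproj_repr subrr.
Qed.

Lemma tens_mapE a b m : tens_map z g (tens a b) m = (z a)%:C%C * g b m.
Proof. by rewrite F_proj /F monalg.mmapU /= rmorph1 mul1r. Qed.

Lemma tens_mapD t u m :
  tens_map z g (t + u) m = tens_map z g t m + tens_map z g u m.
Proof.
by rewrite -[t]tproj_repr -[u]tproj_repr -raddfD !F_proj /F raddfD.
Qed.

End TensorMap.

(** * Words and shuffles *)

(** The letters [0] and [1] are [false] and [true]. *)
Notation word := (seq bool).

(** [\Sigma(N, N')]: increasing on the first [N] and on the last [N'] indices. *)
Definition is_shuffle (N N' : nat) (s : 'S_(N + N')) : bool :=
  [forall i : 'I_(N + N'), forall j : 'I_(N + N'),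
    ((i < j < N) || (N <= i < j))%N ==> (s i < s j)%N].

Definition shuffle_word (u v : word) (s : 'S_(size u + size v)) : word :=
  [seq nth false (u ++ v) ((s^-1)%g i) | i : 'I_(size u + size v)].

(** Bounded strictly increasing sequences [0 < u_1 < ... < u_m < N]. *)
Definition incr (m N : nat) (u : {ffun 'I_m -> 'I_N}) : bool :=
  [forall j : 'I_m, 0 < u j]%N && [forall j : 'I_m, forall k : 'I_m, (j < k) ==> (u j < u k)]%N.

(** * The Hopf algebra of formal iterated integrals *)

(** [(a, w, b)] stands for the symbol [I(a; w; b)]. *)
Notation symbol := (bool * word * bool)%type.

Definition symalg : comAlgType rat := malg (cmonom symbol) rat.
HB.lock Definition sym (a : bool) (w : word) (b : bool) : symalg := mkmalgU (ucm (a, w, b)) 1.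

Inductive I_rel : symalg -> Prop :=
| I_unit a b : I_rel (sym a [::] b - 1)
| I_shuffle a u v b :
    I_rel (sym a u b * sym a v b
           - \sum_(s : 'S_(size u + size v) | is_shuffle s) sym a (shuffle_word s) b)
| I_path a w b x :
    I_rel (sym a w b - \sum_(k < (size w).+1) sym a (take k w) x * sym x (drop k w) b)
| I_loop a w : w != [::] -> I_rel (sym a w a).

Definition I_ideal : symalg -> bool := ideal_gen I_rel.

(** The augmentation shows that the ideals are proper. *)
Definition trivial_mon (m : cmonom symbol) : rat :=
  (all (fun t : symbol => t.1.2 == [::]) (finsupp m))%:R.

Lemma trivial_mon_morph : mmorphism trivial_mon.
Proof.
rewrite /trivial_mon; split.
- move=> m m'; rewrite -natrM mulnb; congr (_ %:R).
  congr nat_of_bool; apply/idP/idP.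
  + move=> /allP h; apply/andP; split; apply/allP => t;
      rewrite mem_finsupp => ht; apply: h; rewrite mem_finsupp mulcmE;
      by rewrite addn_eq0 negb_and ht ?orbT.
  + move=> /andP[/allP h /allP h']; apply/allP => t.
    rewrite mem_finsupp mulcmE addn_eq0 negb_and => /orP[] ht.
      by apply: h; rewrite mem_finsupp.
    by apply: h'; rewrite mem_finsupp.
- suff -> : all (fun t : symbol => t.1.2 == [::]) (finsupp (onecm symbol)) by [].
  by apply/allP => t; rewrite mem_finsupp onecmE.
Qed.
HB.instance Definition _ := isMultiplicative.Build (cmonom symbol) rat
  trivial_mon trivial_mon_morph.

Lemma augm_exists :
  {f : {rmorphism symalg -> rat} | forall a w b, f (sym a w b) = (w == [::])%:R}.
Proof.
exists (monalg.mmap idfun trivial_mon) => a w b.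
rewrite sym.unlock /= monalg.mmapU mul1r /= /trivial_mon; congr (_ %:R); congr nat_of_bool.
have fE t : (t \in finsupp (ucm (a, w, b))) = (t == (a, w, b)).
  by rewrite mem_finsupp ucmE (eq_sym t); case: (_ == t).
apply/allP/idP => [/(_ (a, w, b))|hw t]; first by rewrite fE eqxx => ->.
by rewrite fE => /eqP ->.
Qed.

Definition augm : {rmorphism symalg -> rat} := sval augm_exists.

Lemma augm_sym a w b : augm (sym a w b) = (w == [::])%:R.
Proof. exact: (svalP augm_exists). Qed.

Lemma augm_rel r : I_rel r -> augm r = 0.
Proof.
case=> [a b|a u v b|a w b x|a w].
- by rewrite rmorphB rmorph1 augm_sym subrr.
- rewrite rmorphB rmorphM !augm_sym rmorph_sum /=.
  rewrite (eq_bigr (fun=> ((size u + size v)%N == 0%N)%:R)); last first.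
    by move=> s _; rewrite augm_sym -size_eq0 size_map -cardE card_ord.
  rewrite -!size_eq0 addn_eq0 -natrM mulnb.
  case: (boolP (_ && _)) => [/andP[/eqP hu /eqP hv]|_]; last by rewrite big1 ?subrr.
  rewrite sumr_const.
  suff -> : #|[pred s : 'S_(size u + size v) | is_shuffle s]| = 1%N by rewrite subrr.
  have h0 : (size u + size v = 0)%N by rewrite hu hv.
  rewrite (eq_card (B := predT)); last first.
    move=> s; rewrite !inE; apply/forallP => i; exfalso.
    by move: (ltn_ord i); rewrite [X in (_ < X)%N]h0.
  by rewrite card_Sn h0.
- rewrite rmorphB augm_sym rmorph_sum /=; case: w => [|c w].
    by rewrite big_ord_recl big_ord0 rmorphM !augm_sym addr0 mulr1 subrr.
  rewrite sub0r big1 ?oppr0 // => k _; rewrite rmorphM !augm_sym.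
  by case: k => -[|k] hk; rewrite /= ?mulr0 ?mul0r.
- by rewrite augm_sym => /negPf ->.
Qed.

Lemma augm_ideal x : I_ideal x -> augm x = 0.
Proof.
move=> /asboolP[s [hs ->]]; rewrite rmorph_sum big_seq big1 // => p ps.
by rewrite rmorphM (augm_rel (hs p ps)) mulr0.
Qed.

Lemma I_ideal_closed : idealr_closed I_ideal.
Proof.
apply: ideal_gen_closed; apply/negP => /augm_ideal.
by rewrite rmorph1 => /eqP; rewrite oner_eq0.
Qed.
HB.instance Definition _ := isIdealr.Build symalg I_ideal I_ideal_closed.
Definition I_idealr : idealr symalg := Idealr.clone symalg I_ideal _.

(** The algebra [I_*] and the class of a symbol in it. *)
Definition IH : comAlgType rat := qalg I_idealr.
HB.lock Definition ih (a : bool) (w : word) (b : bool) : IH := qproj I_idealr (sym a w b).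

Definition I1_rel (x : IH) : Prop := x = ih false [:: false] true.

Definition I1_ideal : IH -> bool := ideal_gen I1_rel.

Lemma I1_ideal_closed : idealr_closed I1_ideal.
Proof.
apply: ideal_gen_closed; apply/negP => /asboolP[s [hs]].
have -> : \sum_(p <- s) p.1 * p.2 = (\sum_(p <- s) p.1) * ih false [:: false] true.
  by rewrite mulr_suml big_seq [RHS]big_seq; apply: eq_bigr => p /hs ->.
move: (\sum_(p <- s) _) => c; rewrite -[c](reprK) => /eqP.
rewrite -subr_eq0 -[1](rmorph1 (qproj _)) ih.unlock -(rmorphM (qproj _)) -rmorphB.
rewrite qproj_eq0 => /augm_ideal.
rewrite rmorphB rmorph1 rmorphM augm_sym mulr0 subr0 => /eqP.
by rewrite oner_eq0.
Qed.
HB.instance Definition _ := isIdealr.Build IH I1_ideal I1_ideal_closed.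
Definition I1_idealr : idealr IH := Idealr.clone IH I1_ideal _.

(** [I^1_* = I_* / I(0;0;1) I_*] and the images [I(a; w; b)] of the symbols. *)
Definition I1 : comAlgType rat := qalg I1_idealr.
HB.lock Definition Iint (a : bool) (w : word) (b : bool) : I1 := qproj I1_idealr (ih a w b).

Lemma I1_class_exists : {f : {rmorphism symalg -> I1} |
  (forall a w b, Iint a w b = f (sym a w b)) /\ (forall r, I_rel r -> f r = 0)}.
Proof.
exists (qproj I1_idealr \o qproj I_idealr); split=> [a w b|r hr] /=.
  by rewrite Iint.unlock ih.unlock.
suff /eqP -> : qproj I_idealr r == 0 by rewrite rmorph0.
by rewrite qproj_eq0; exact: ideal_gen_in.
Qed.

Lemma Iint_unit a b : Iint a [::] b = 1.
Proof.
have [f [fE f0]] := I1_class_exists; apply/eqP.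
rewrite fE -(rmorph1 f) -subr_eq0 -rmorphB f0 //; by constructor.
Qed.

Lemma Iint_shuffle a u v b :
  Iint a u b * Iint a v b
  = \sum_(s : 'S_(size u + size v) | is_shuffle s) Iint a (shuffle_word s) b.
Proof.
have [f [fE f0]] := I1_class_exists; apply/eqP.
have -> : \sum_(s : 'S_(size u + size v) | is_shuffle s) Iint a (shuffle_word s) b
    = f (\sum_(s : 'S_(size u + size v) | is_shuffle s) sym a (shuffle_word s) b).
  by rewrite rmorph_sum; apply: eq_bigr => s _; exact: fE.
by rewrite !fE -subr_eq0 -(rmorphM f) -(rmorphB f) (f0 _ (I_shuffle a u v b)).
Qed.

Lemma Iint_path a w b x :
  Iint a w b = \sum_(k < (size w).+1) Iint a (take k w) x * Iint x (drop k w) b.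
Proof.
have [f [fE f0]] := I1_class_exists; apply/eqP.
have -> : \sum_(k < (size w).+1) Iint a (take k w) x * Iint x (drop k w) b
    = f (\sum_(k < (size w).+1) sym a (take k w) x * sym x (drop k w) b).
  by rewrite rmorph_sum; apply: eq_bigr => k _; rewrite rmorphM !fE.
by rewrite fE -subr_eq0 -(rmorphB f) (f0 _ (I_path a w b x)).
Qed.

Lemma Iint_loop a w : w != [::] -> Iint a w a = 0.
Proof.
by move=> hw; have [f [-> f0]] := I1_class_exists; exact/f0/I_loop.
Qed.

Lemma Iint_001 : Iint false [:: false] true = 0.
Proof.
by rewrite Iint.unlock; apply/eqP; rewrite qproj_eq0; exact: ideal_gen_in.
Qed.

(** The right-hand side of Goncharov's formula for [I(a; w; b)], with
    [N = size w]; the positions [i_1 < ... < i_k] range over [1, ..., N]. *)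
Definition goncharov_positions (N k : nat) (i : {ffun 'I_k -> 'I_N.+1}) : seq nat :=
  0%N :: rcons [seq (i j : nat) | j : 'I_k] N.+1.

Definition goncharov_left (a : bool) (w : word) (b : bool) (k : nat)
    (i : {ffun 'I_k -> 'I_(size w).+1}) : I1 :=
  let A := nth false (a :: rcons w b) in
  let pos := nth 0%N (goncharov_positions i) in
  \prod_(p < k.+1)
    Iint (A (pos p)) [seq A j | j <- index_iota (pos p).+1 (pos p.+1)] (A (pos p.+1)).

Definition goncharov_right (a : bool) (w : word) (b : bool) (k : nat)
    (i : {ffun 'I_k -> 'I_(size w).+1}) : I1 :=
  Iint a [seq nth false (a :: rcons w b) (i j) | j : 'I_k] b.

Definition is_goncharov_coproduct (Delta : I1 -> tensor I1 I1) : Prop :=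
  forall a w b, Delta (Iint a w b) =
    \sum_(k < (size w).+1) \sum_(i : {ffun 'I_k -> 'I_(size w).+1} | incr i)
      tens (goncharov_left a b i) (goncharov_right a b i).

(** * Words in the letters [n = 1 0^(n-1)] *)

(** Sequences of positive integers [n_1, ..., n_r] encode the words
    [n_1 ... n_r], equivalently the monomials of [H^1]. *)
Definition is_index (n : seq nat) : bool := all (leq 1) n.

Definition nword (n : seq nat) : word :=
  flatten [seq true :: nseq k.-1 false | k <- n].

Definition Iw (n : seq nat) : I1 := Iint false (nword n) true.

(** The harmonic product of two words, as the list (with multiplicities) of the
    words occurring in it. *)
Fixpoint harmonic (u : seq nat) : seq nat -> seq (seq nat) :=
  if u is m :: u' then
    fix aux (v : seq nat) : seq (seq nat) :=
      if v is n :: v' then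
        [seq m :: w | w <- harmonic u' v] ++ [seq n :: w | w <- aux v']
        ++ [seq (m + n)%N :: w | w <- harmonic u' v']
      else [:: u]
  else fun v => [:: v].

Definition is_har (har : I1 -> I1 -> I1) : Prop :=
  forall u v, is_index u -> is_index v ->
    har (Iw u) (Iw v)
    = \sum_(w <- undup (harmonic u v)) (count_mem w (harmonic u v))%:R *: Iw w.

(** * Shuffle regularised multiple zeta values *)

(** [H = Q<0, 1>] as a vector space, with the shuffle product. *)
Definition HH : lmodType rat := malg word rat.
Definition mono (w : word) : HH := mkmalgU w 1.

Definition shuffle_prod (x y : HH) : HH :=
  \sum_(u <- monalg.msupp x) \sum_(v <- monalg.msupp y)
    (monalg.mcoeff u x * monalg.mcoeff v y) *:
      \sum_(s : 'S_(size u + size v) | is_shuffle s) mono (shuffle_word s).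

(** [H^1 = Q + 1 H] *)
Definition in_H1 (x : HH) : bool :=
  all (fun w => (w == [::]) || head false w) (monalg.msupp x).

(** [n_r >= 2], or the empty index *)
Definition admissible (n : seq nat) : bool := is_index n && (2 <= last 2 n)%N.

Section Zeta.
Variable R : realType.

Definition zeta_partial (n : seq nat) (N : nat) : R :=
  \sum_(m : {ffun 'I_(size n) -> 'I_N} | incr m)
    \prod_(j < size n) (m j)%:R ^- nth 0%N n j.

Definition zeta (n : seq nat) : R := limn (zeta_partial n).

(** [Zsh] is the regularisation map [Z^sh]; only its restriction to [H^1] is
    constrained and used. *)
Record is_shuffle_regularisation
    (Zsh : {linear HH -> {poly R} | ratr \; *:%R}) : Prop := {
  Zsh_shuffle : forall x y, in_H1 x -> in_H1 y ->
    Zsh (shuffle_prod x y) = Zsh x * Zsh y;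
  Zsh_zeta : forall n, admissible n -> Zsh (mono (nword n)) = (zeta n)%:P;
  Zsh_one : Zsh (mono [:: true]) = 'X
}.

Definition zeta_sh (Zsh : {linear HH -> {poly R} | ratr \; *:%R}) (n : seq nat) : R :=
  (Zsh (mono (nword n)))`_0.

End Zeta.

(** * The [q]-series [g^sh] *)

(** Elements of [Q[[q]][[x_1, ..., x_r]]]: [f k t] is the coefficient of
    [x^k q^t]. *)
Definition ser (r : nat) := multinom r -> nat -> rat.

(** Substitution of linear forms [L_1, ..., L_m] for the variables of [f]: only
    the part of [f] of degree at most [mdeg l] contributes to the coefficient of
    [x^l]. *)
Definition subst_lin (m r : nat) (f : ser m) (L : 'I_m -> mpoly r rat) : ser r :=
  fun l t => mpoly.mcoeff l (comp_mpoly [tuple L j | j < m]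
    (\sum_(k : bmultinom m (mpoly.mdeg l).+1) f k t *: mpolyX rat k)).

(** [q^u / (1 - q^u)] modulo [q^(t+1)] *)
Definition qgeom (t u : nat) : {poly rat} := \sum_(1 <= d < t.+1) 'X^(u * d).

(** [H(n_1, ..., n_r; x_1, ..., x_r)] for [n_j >= 1]: the terms with [u_r > t] do
    not contribute to the coefficient of [q^t]. *)
Definition Hser (r : nat) (n : 'I_r -> nat) : ser r :=
  fun k t => \sum_(u : {ffun 'I_r -> 'I_t.+1} | incr u)
    (\prod_(j < r) ((u j)%:R ^+ k j / (k j)`!%:R))
    * (\prod_(j < r) qgeom t (u j) ^+ n j)`_t.

(** The compositions [i_1 + ... + i_m = r] *)
Definition composition (r m : nat) (i : {ffun 'I_m -> 'I_r.+1}) : bool :=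
  [forall j, 0 < i j]%N && (\sum_(j < m) i j == r)%N.

(** [y_j = x_(i_1 + ... + i_(j-1) + 1) + ... + x_(i_1 + ... + i_j)] *)
Definition yform (r m : nat) (i : {ffun 'I_m -> 'I_r.+1}) (j : 'I_m) : mpoly r rat :=
  \sum_(a < r | (\sum_(l < m | l < j) i l <= a < \sum_(l < m | l <= j) i l)%N)
    mpolyX rat (mnm1 a).

Definition hser (r : nat) : ser r :=
  fun k t => \sum_(m < r.+1) \sum_(i : {ffun 'I_m -> 'I_r.+1} | composition i)
    (\prod_(j < m) (i j)`!%:R)^-1 * subst_lin (Hser (fun j => i j)) (yform i) k t.

(** With variables numbered from [0], the [a]-th argument of [h] in [g_sh] is
    [x_(r-1-a) - x_(r-2-a)], and [x_0] for [a = r-1]. *)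
Definition gform (r : nat) (a : 'I_r) : mpoly r rat :=
  \sum_(b < r | ((a + b).+1 == r)%N) mpolyX rat (mnm1 b)
  - \sum_(b < r | ((a + b).+2 == r)%N) mpolyX rat (mnm1 b).

Definition gser (r : nat) : ser r := subst_lin (@hser r) (@gform r).

(** The coefficients of the [q]-series [g^sh_(n_1, ..., n_r)]: the coefficient of
    [x_1^(n_1-1) ... x_r^(n_r-1)] in [c^r g_sh(c x_1, ..., c x_r)], where
    [c = -2 pi i]. The factor [c^r] gives [g^sh_(n_1, ..., n_r)] its weight
    normalisation [c^(n_1+...+n_r)], the one of the Fourier expansions of multiple
    Eisenstein series. It cannot be dropped: without it the harmonic and shuffle
    products already disagree for the words [2] and [2], at [q^2]. *)
Definition g_sh (R : realType) (n : seq nat) (t : nat) : R[i] :=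
  let c : R[i] := (0 +i* (- (2 * pi)))%C in
  c ^+ size n * (c ^+ (\sum_(k <- n) k.-1)%N
    * ratr (gser (Multinom [tuple (nth 0%N n j).-1 | j < size n]) t)).

(* Main.v *)
From HB Require Import structures.
From mathcomp Require Import all_boot all_order all_algebra all_fingroup.
From mathcomp Require Import sesquilinear qpoly.
From mathcomp Require Import all_classical all_reals all_analysis.
From mathcomp Require Import finmap complex ring lra zify.
From mathcomp Require monalg mpoly.
Import -(notations) monalg.
Import -(notations) mpoly.
Require Import Defs.

Set Implicit Arguments.
Unset Strict Implicit.
Unset Printing Implicit Defensive.

Import Order.TTheory GRing.Theory Num.Theory numFieldNormedType.Exports.
Local Open Scope ring_scope.

(** Fix [t] and work modulo [q^(t+1)]. The functionals [w |-> z (I(a; w; b))] are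
    grouplike noncommutative series in [e_0], [e_1]; let [Phi] be the one with
    [a = 0], [b = 1]. The values of [g] form the grouplike series
      [P = prod_(u = t .. 1) e^(- u c e_0) e^(lam_u e_1) e^(u c e_0)]
    with [c = -2 pi i] and [lam_u = c sum_l q^(u l)]. Goncharov's formula is the
    substitution [e_1 |-> Phi e_1 Phi^-1] followed by multiplication by [Phi], so
    [(z (x) g) o Delta] is again a grouplike series [S]: it turns shuffle products
    into products. Restricted to words in the letters [2], [3], ..., [S] factors as
    the restriction of [Phi] times [prod_(k >= 1) (1 + Psi_k)], where the
    coefficient of [1 + Psi_k] at [m] is [F_m (c (1/2 + sum_v q^(k v)))] for a
    polynomial [F_m] not depending on [k]. Each factor is multiplicative for the
    harmonic product: the first because its coefficients are multiple zeta values,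
    the others because expansion into partial fractions gives
      [F_(n_1, ..., n_r) (pi cot (pi x)) = sum_(m_1 < ... < m_r) prod_j (x + m_j)^(- n_j)],
    the sum being over integers, for real [x] in [(0, 1)]. *)

(** * Noncommutative series *)

(** The product over [k] reflects conjugation of partitions. Words in 2, 3, ... have no two
    consecutive ones, so each exponential of [e_1] counts only as [1 + lam_u e_1]. The terms of [S]
    then carry [q^(sum_j u_j l_j)] with [u_1 > ... > u_r], and the other factors depend only on the
    differences [v_j = u_j - u_(j+1)], where [u_(r+1) = 0]. With [k_j = l_1 + ... + l_j] the
    exponent is [sum_j k_j v_j], and the [k_j] increase strictly. The coefficients [kap m k] of
    [e_1 Phi^-1 e_0^k Phi] link the two sides: they are the coefficients of the conjugated
    exponentials inside [Psi_k], and also the limits of the coefficients of [(x + n)^-(k+1)] in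
    partial fractions of ordered sums. For a sum truncated to [|n| <= M], the coefficients at poles
    near the ends need not be close to these limits. This is why limits are recorded with a rate and
    the total error is estimated. The passage from real [x] to formal [q] goes through polynomials:
    an identity at all values of [pi cot (pi x)] is an identity of polynomials, and
    [c (1/2 + sum_v q^v)] is the expansion of [pi cot (pi x)] in [q = e^(2 pi i x)]. *)

Section Series.
Variables (X : Type) (A : nzRingType).

Definition ncs := seq X -> A.
HB.instance Definition _ := GRing.Zmodule.on ncs.

Definition de (a : X) (f : ncs) : ncs := fun w => f (a :: w).

(** Recursion on the word makes [deM] hold by definition; the sum over all cuts is recovered in
    [ncsME]. *)
Fixpoint conv (f g : seq X -> A) (w : seq X) : A :=
  if w is a :: w' then f [::] * g w + conv (fun v => f (a :: v)) g w'
  else f [::] * g [::].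

Definition ncs1 : ncs := fun w => if w is [::] then 1 else 0.

Lemma conv0l f g w : (forall v, f v = 0) -> conv f g w = 0.
Proof.
elim: w f => [|a w IH] f f0 /=; first by rewrite f0 mul0r.
by rewrite f0 mul0r add0r IH.
Qed.

Lemma convDl f1 f2 g w : conv (fun v => f1 v + f2 v) g w = conv f1 g w + conv f2 g w.
Proof.
elim: w f1 f2 => [|a w IH] f1 f2 /=; first by rewrite mulrDl.
by rewrite IH mulrDl addrACA.
Qed.

Lemma convDr f g1 g2 w : conv f (fun v => g1 v + g2 v) w = conv f g1 w + conv f g2 w.
Proof.
elim: w f => [|a w IH] f /=; first by rewrite mulrDr.
by rewrite IH mulrDr addrACA.
Qed.

Lemma convZl x f g w : conv (fun v => x * f v) g w = x * conv f g w.
Proof.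
elim: w f => [|a w IH] f /=; first by rewrite mulrA.
by rewrite IH mulrDr mulrA.
Qed.

Lemma convA f g h w : conv f (conv g h) w = conv (conv f g) h w.
Proof.
elim: w f g => [|a w IH] f g /=; first by rewrite mulrA.
by rewrite convDl convZl IH mulrDr !mulrA addrA.
Qed.

Lemma conv1l g w : conv ncs1 g w = g w.
Proof. by case: w => [|a w] /=; rewrite mul1r // conv0l // addr0. Qed.

Lemma conv1r f w : conv f ncs1 w = f w.
Proof. by elim: w f => [|a w IH] f /=; rewrite ?mulr1 // mulr0 add0r IH. Qed.

Let mulA : associative (conv : ncs -> ncs -> ncs).
Proof. by move=> f g h; apply/funext => w; exact: convA. Qed.
Let mul1l : left_id ncs1 (conv : ncs -> ncs -> ncs).
Proof. by move=> f; apply/funext => w; exact: conv1l. Qed.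
Let mul1r' : right_id ncs1 (conv : ncs -> ncs -> ncs).
Proof. by move=> f; apply/funext => w; exact: conv1r. Qed.
Let mulDl : left_distributive (conv : ncs -> ncs -> ncs) +%R.
Proof. by move=> f g h; apply/funext => w; exact: convDl. Qed.
Let mulDr : right_distributive (conv : ncs -> ncs -> ncs) +%R.
Proof. by move=> f g h; apply/funext => w; exact: convDr. Qed.
Let one_neq0 : ncs1 != 0 :> ncs.
Proof.
by apply/eqP => /(congr1 (fun f : ncs => f [::])) /eqP; rewrite oner_eq0.
Qed.
HB.instance Definition _ := GRing.Zmodule_isNzRing.Build ncs
  mulA mul1l mul1r' mulDl mulDr one_neq0.

Implicit Types (f g : ncs) (w : seq X).

Lemma ncsD f g w : (f + g) w = f w + g w. Proof. by []. Qed.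
Lemma ncsB f g w : (f - g) w = f w - g w. Proof. by []. Qed.
Lemma ncs_1 w : (1 : ncs) w = if w is [::] then 1 else 0. Proof. by []. Qed.
Lemma ncs_sum I (r : seq I) P (F : I -> ncs) w :
  (\sum_(i <- r | P i) F i) w = \sum_(i <- r | P i) F i w.
Proof. by elim/big_rec2: _ => //= i y1 y2 _ <-; rewrite ncsD. Qed.

Lemma ncsM_nil f g : (f * g) [::] = f [::] * g [::]. Proof. by []. Qed.
Lemma ncsM_cons f g a w : (f * g) (a :: w) = f [::] * g (a :: w) + (de a f * g) w.
Proof. by []. Qed.

Lemma ncsME f g w :
  (f * g) w = \sum_(k < (size w).+1) f (take k w) * g (drop k w).
Proof.
elim: w f => [|a w IH] f; first by rewrite big_ord_recl big_ord0 addr0.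
by rewrite ncsM_cons IH [RHS]big_ord_recl.
Qed.

Lemma deM a f g : de a (f * g) = (fun w => f [::] * de a g w + (de a f * g) w).
Proof. by []. Qed.
Definition csc (x : A) : ncs := fun w => if w is [::] then x else 0.

Lemma cscM x f w : (csc x * f) w = x * f w.
Proof.
case: w => [|a w] //; rewrite ncsM_cons /= [X in _ + X](_ : _ = 0) ?addr0 //.
exact: conv0l.
Qed.
Lemma csc_is_zmod_morphism : zmod_morphism csc.
Proof. by move=> x y; apply/funext => -[|a w]; rewrite ncsB //= subr0. Qed.
Lemma csc_is_monoid_morphism : monoid_morphism csc.
Proof.
split; first by apply/funext => -[].
by move=> x y; apply/funext => -[|a w]; rewrite ?cscM //= mulr0.
Qed.
HB.instance Definition _ := GRing.isZmodMorphism.Build A ncs csc csc_is_zmod_morphism.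
HB.instance Definition _ := GRing.isMonoidMorphism.Build A ncs csc csc_is_monoid_morphism.

End Series.

Section Letters.
Variables (X : eqType) (A : nzRingType).
Implicit Types (f g : ncs X A) (w : seq X).

Definition lett (a : X) : ncs X A := fun w => (w == [:: a])%:R.

Lemma lettM_nil a f : (lett a * f) [::] = 0.
Proof. by rewrite ncsM_nil mul0r. Qed.

Lemma lettM_cons a f b w : (lett a * f) (b :: w) = (b == a)%:R * f w.
Proof.
rewrite ncsM_cons {1}/lett /= mul0r add0r.
have -> : de b (lett a) = @csc X A (b == a)%:R.
  by apply/funext => -[|d v]; rewrite /de /lett eqseq_cons ?andbT // andbF.
by rewrite cscM.
Qed.

Lemma lettM_ne a f b w : b != a -> (lett a * f) (b :: w) = 0.
Proof. by move=> /negPf h; rewrite lettM_cons h mul0r. Qed.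

Lemma lettM_eq a f w : (lett a * f) (a :: w) = f w.
Proof. by rewrite lettM_cons eqxx mul1r. Qed.

End Letters.
Arguments lett {X A}.
Arguments csc {X A}.

Section Truncation.
Variables (X : eqType) (A : nzRingType).
Implicit Types (f g : ncs X A) (w : seq X).

Definition eqn (n : nat) f g := forall w, (size w <= n)%N -> f w = g w.

Lemma eqnM n f f' g g' : eqn n f f' -> eqn n g g' -> eqn n (f * g) (f' * g').
Proof.
move=> ff gg w hw; rewrite !ncsME; apply: eq_bigr => k _.
rewrite ff ?gg ?size_drop ?size_take //; first lia.
by case: ltnP; lia.
Qed.

End Truncation.

(** * Quasi-shuffles *)

Section QuasiShuffle.
Variables (X : Type) (merge : X -> X -> seq X).

(** An empty [merge] gives the shuffle product; [merge a b = [:: (a + b).+2]], with [a] standing for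
    [a + 2], gives the harmonic product. *)
Fixpoint qsh (u : seq X) : seq X -> seq (seq X) :=
  if u is a :: u' then
    fix aux (v : seq X) : seq (seq X) :=
      if v is b :: v' then
        [seq a :: w | w <- qsh u' v] ++ [seq b :: w | w <- aux v']
        ++ flatten [seq [seq c :: w | w <- qsh u' v'] | c <- merge a b]
      else [:: u]
  else fun v => [:: v].

Variable A : comNzRingType.
Implicit Types f g : ncs X A.

(** A function of two words is viewed as a series in the first whose coefficients are series in the
    second, so that the ring structure is that of the completed tensor square. *)
Definition dl f : ncs X (ncs X A) := fun u v => \sum_(w <- qsh u v) f w.

Lemma dl_nil_l f v : dl f [::] v = f v.
Proof. by rewrite /dl big_seq1. Qed.

Lemma dl_nil f : dl f [::] = f.
Proof. by apply/funext => v; rewrite dl_nil_l. Qed.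

Lemma dl_nil_r f u : dl f u [::] = f u.
Proof. by case: u => [|a u]; rewrite /dl big_seq1. Qed.

Lemma dl_cons f a u b v : dl f (a :: u) (b :: v) =
  dl (de a f) u (b :: v) + dl (de b f) (a :: u) v
  + \sum_(c <- merge a b) dl (de c f) u v.
Proof.
rewrite /dl -[qsh (a :: u) (b :: v)]/(_ ++ _ ++ _) 2!big_cat /= !big_map addrA.
congr (_ + _); rewrite big_flatten big_map; apply: eq_bigr => c _.
by rewrite big_map.
Qed.

Lemma dl_lin x f g u v :
  dl (fun w => x * f w + g w) u v = x * dl f u v + dl g u v.
Proof. by rewrite /dl big_split mulr_sumr. Qed.

Definition tns f g : ncs X (ncs X A) := fun u v => f u * g v.

Lemma ncs2M (F G : ncs X (ncs X A)) u v :
  (F * G) u v = \sum_(k < (size u).+1) (F (take k u) * G (drop k u)) v.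
Proof. by rewrite ncsME ncs_sum. Qed.

Lemma tnsM f g f' g' : tns f g * tns f' g' = tns (f * f') (g * g').
Proof.
apply/funext => u; apply/funext => v; rewrite ncs2M /tns ncsME mulr_suml.
apply: eq_bigr => k _; rewrite !ncsME mulr_sumr; apply: eq_bigr => l _.
by rewrite mulrACA.
Qed.

(** Dual to the compatibility of deconcatenation with the quasi-shuffle product. The induction is on
    the total length; both sides are sorted by the first letter, which is [a], [b] or a merged
    one. *)
Lemma dlM f g : dl (f * g) = dl f * dl g.
Proof.
apply/funext => u; apply/funext => v.
have [n] := ubnP (size u + size v); elim: n f u v => // n IH f [|a u] v hn.
  by rewrite dl_nil_l ncsM_nil !dl_nil.
have d0 := dl_nil.
have dr h : forall u, (dl h u) [::] = h u by move=> ?; rewrite dl_nil_r.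
case: v hn => [|b v] hn.
  rewrite dl_nil_r ncs2M ncsME; apply: eq_bigr => k _.
  by rewrite ncsM_nil !dr.
rewrite dl_cons !deM !dl_lin.
under eq_bigr do rewrite deM dl_lin.
rewrite big_split -mulr_sumr /=.
rewrite !IH /=; [|move: hn => /=; lia..].
have IHm c : dl (de c f * g) u v = (dl (de c f) * dl g) u v.
  by apply: IH; move: hn => /=; lia.
under [X in _ + (_ + X)]eq_bigr do rewrite IHm.
have -> : (dl f * dl g) (a :: u) (b :: v)
   = f [::] * dl g (a :: u) (b :: v) + (de b f * dl g (a :: u)) v
     + (de a (dl f) * dl g) u (b :: v).
  by rewrite ncsM_cons ncsD d0 ncsM_cons.
rewrite dl_cons.
(* These are the cuts whose left part contains [a]; the left part is expanded by its own first
   letter. *)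
have key : (de a (dl f) * dl g) u (b :: v) =
   (dl (de a f) * dl g) u (b :: v) + \sum_(c <- merge a b) (dl (de c f) * dl g) u v
   + \sum_(k < (size u).+1) (dl (de b f) (a :: take k u) * dl g (drop k u)) v.
  rewrite !ncs2M.
  under [X in _ + X + _]eq_bigr do rewrite ncs2M.
  rewrite exchange_big -!big_split; apply: eq_bigr => k _ /=.
  rewrite !ncsM_cons !dr -!addrA; congr (_ + _); first by rewrite /de !dr.
  have -> : de b (de a (dl f) (take k u)) =
    de b (dl (de a f) (take k u)) + dl (de b f) (a :: take k u)
     + \sum_(c <- merge a b) dl (de c f) (take k u).
    apply/funext => w; rewrite [LHS](dl_cons f a (take k u) b w) !ncsD; congr (_ + _).
    by rewrite ncs_sum.
  rewrite !mulrDl mulr_suml !ncsD ncs_sum -!addrA; congr (_ + _).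
  by rewrite addrC.
rewrite key.
have -> : (dl (de b f) * dl g) (a :: u) v = (de b f * dl g (a :: u)) v +
   \sum_(k < (size u).+1) (dl (de b f) (a :: take k u) * dl g (drop k u)) v.
  by rewrite ncsM_cons ncsD d0 ncs2M.
by ring.
Qed.

(** [dl] is the coproduct dual to the quasi-shuffle product. *)
Definition grouplike f := dl f = tns f f.

Lemma grouplikeM f g : grouplike f -> grouplike g -> grouplike (f * g).
Proof. by rewrite /grouplike dlM => -> ->; rewrite tnsM. Qed.

Lemma grouplike1 : grouplike 1.
Proof.
apply/funext => u; apply/funext => v; rewrite /tns.
case: u => [|a u]; first by rewrite dl_nil_l mul1r.
case: v => [|b v]; first by rewrite dl_nil_r mulr1.
have dz u' v' : dl 0 u' v' = 0 by rewrite /dl big1.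
by rewrite dl_cons mul0r !dz big1 ?addr0.
Qed.

Lemma grouplikeE f u v : grouplike f -> \sum_(w <- qsh u v) f w = f u * f v.
Proof. by move=> gf; rewrite -[LHS]/(dl f u v) gf. Qed.

Lemma grouplike_prod I (r : seq I) (F : I -> ncs X A) :
  (forall i, grouplike (F i)) -> grouplike (\prod_(i <- r) F i).
Proof.
move=> h; elim/big_rec: _ => [|i x _ gx]; first exact: grouplike1.
exact: grouplikeM.
Qed.

End QuasiShuffle.

Section SeriesAlgebra.
Variables (X : Type) (C : comNzRingType).

Definition ncs_scale (x : C) (f : ncs X C) : ncs X C := fun w => x * f w.

Let scA a b v : ncs_scale a (ncs_scale b v) = ncs_scale (a * b) v.
Proof. by apply/funext => w; rewrite /ncs_scale mulrA. Qed.
Let sc1 : left_id 1 ncs_scale.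
Proof. by move=> v; apply/funext => w; rewrite /ncs_scale mul1r. Qed.
Let scDr : right_distributive ncs_scale +%R.
Proof. by move=> c u v; apply/funext => w; rewrite /ncs_scale mulrDr. Qed.
Let scDl v : {morph ncs_scale^~ v : a b / a + b}.
Proof. by move=> a b; apply/funext => w; rewrite /ncs_scale mulrDl. Qed.
HB.instance Definition _ := GRing.Zmodule_isLmodule.Build C (ncs X C) scA sc1 scDr scDl.

Lemma ncsZ x (f : ncs X C) w : (x *: f) w = x * f w.
Proof. by []. Qed.

Let scAl (a : C) (u v : ncs X C) : a *: (u * v) = (a *: u) * v.
Proof. by apply/funext => w; rewrite ncsZ [RHS]convZl. Qed.
HB.instance Definition _ := GRing.Lmodule_isLalgebra.Build C (ncs X C) scAl.

Let scAr (a : C) (u v : ncs X C) : a *: (u * v) = u * (a *: v).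
Proof.
apply/funext => w; rewrite ncsZ !ncsME mulr_sumr.
by apply: eq_bigr => k _; rewrite ncsZ mulrCA.
Qed.
HB.instance Definition _ := GRing.Lalgebra_isAlgebra.Build C (ncs X C) scAr.

Lemma deZ x a (f : ncs X C) : de a (x *: f) = x *: de a f. Proof. by []. Qed.

Lemma de_mul a (f g : ncs X C) : de a (f * g) = f [::] *: de a g + de a f * g.
Proof. by []. Qed.

End SeriesAlgebra.

(** * Substitution for the letters as a fixed point *)

Section FixUnique.
Variables (C : comNzRingType) (X : finType) (Xs : X -> ncs X C).
Hypothesis Xs0 : forall c, Xs c [::] = 0.

Lemma eqn_mul0 n c (f f' : ncs X C) : eqn n f f' -> eqn n.+1 (Xs c * f) (Xs c * f').
Proof.
move=> ff [|a w] hw; first by rewrite !ncsM_nil Xs0 !mul0r.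
rewrite !ncsM_cons Xs0 !mul0r !add0r.
by apply: (@eqnM _ _ n) => //.
Qed.

(** Since the [Xs c] have no constant term, the right-hand side up to length [n + 1] involves the
    unknown only up to length [n]. The index set [I] covers families of series that the left
    derivatives permute. *)
Lemma fix_unique (I : Type) (nxt : X -> I -> I) (A0 G H : I -> ncs X C) :
  (forall i, G i = A0 i + \sum_c Xs c * G (nxt c i)) ->
  (forall i, H i = A0 i + \sum_c Xs c * H (nxt c i)) ->
  forall i, G i = H i.
Proof.
move=> hG hH.
have h n i : eqn n (G i) (H i).
  elim: n i => [|n IH] i w hw.
    case: w hw => // _; rewrite hG hH !ncsD !ncs_sum; congr (_ + _).
    by apply: eq_bigr => c _; rewrite !ncsM_nil Xs0 !mul0r.
  rewrite hG hH !ncsD !ncs_sum; congr (_ + _); apply: eq_bigr => c _.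
  exact: (@eqn_mul0 n c _ _ (IH _) w hw).
by move=> i; apply/funext => w; exact: (h (size w)).
Qed.

Variables (Phi Phi' : ncs X C).
Hypothesis PhiK : Phi * Phi' = 1.
Hypothesis PhiK' : Phi' * Phi = 1.
Variable sigma : ncs X C -> ncs X C.
Hypothesis sigmaE : forall F, sigma F = F [::] *: Phi + \sum_c Xs c * sigma (de c F).

Lemma sigma_lin x F G : sigma (x *: F + G) = x *: sigma F + sigma G.
Proof.
pose nxt c (p : ncs X C * ncs X C) := (de c p.1, de c p.2).
apply: (@fix_unique (ncs X C * ncs X C)%type nxt
  (fun p => (x * p.1 [::] + p.2 [::]) *: Phi)
  (fun p => sigma (x *: p.1 + p.2)) (fun p => x *: sigma p.1 + sigma p.2) _ _ (F, G)).
  by move=> [f g]; exact: sigmaE.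
move=> [f g] /=.
rewrite [sigma f]sigmaE [sigma g]sigmaE scalerDr scalerDl scalerA.
rewrite addrACA -scalerA; congr (_ + _).
rewrite scaler_sumr -big_split; apply: eq_bigr => c _ /=.
by rewrite mulrDr scalerAr.
Qed.

(** [sigma F * Phi'] is [F] with [Xs c] substituted for each letter [c], which is multiplicative in
    [F]. *)
Lemma sigmaM F G : sigma (F * G) = sigma F * Phi' * sigma G.
Proof.
apply: (@fix_unique (ncs X C) (@de X C) (fun F => F [::] *: sigma G)
  (fun F => sigma (F * G)) (fun F => sigma F * Phi' * sigma G)) => f.
  rewrite sigmaE ncsM_nil -scalerA [in RHS](sigmaE G).
  rewrite scalerDr -addrA; congr (_ + _).
  rewrite scaler_sumr -big_split; apply: eq_bigr => c _ /=.
  by rewrite de_mul sigma_lin mulrDr scalerAr.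
rewrite [sigma f]sigmaE !mulrDl -!scalerAl PhiK mul1r; congr (_ + _).
by rewrite !mulr_suml; apply: eq_bigr => c _; rewrite !mulrA.
Qed.

End FixUnique.

(** * Exponentials of letters *)

Section Exponential.
Variables (K : numFieldType) (C : comNzRingType) (iota : {rmorphism K -> C}).
Variable X : eqType.

(** [exs i 0 x] is the exponential of [x] times the letter [i], and [exs i k x] its
    [k]-fold left derivative. *)
Definition exs (i : X) (k : nat) (x : C) : ncs X C := fun w =>
  if all (pred1 i) w then iota ((size w + k)`!%:R^-1) * x ^+ (size w + k) else 0.

Lemma exs_nil i k x : exs i k x [::] = iota (k`!%:R^-1) * x ^+ k.
Proof. by []. Qed.

Lemma exs0_nil i x : exs i 0 x [::] = 1.
Proof. by rewrite exs_nil fact0 invr1 rmorph1 mulr1. Qed.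

Lemma de_exs i k x : de i (exs i k x) = exs i k.+1 x.
Proof. by apply/funext => w; rewrite /de /exs /= eqxx addSnnS. Qed.

Lemma de_exs_ne j i k x : j != i -> de j (exs i k x) = 0.
Proof. by move=> /negPf h; apply/funext => w; rewrite /de /exs /= h. Qed.

Lemma exs_x0 i : exs i 0 0 = 1.
Proof.
apply/funext => -[|a w]; first by rewrite exs0_nil.
by rewrite /exs /= expr0n mulr0 ncs_1; case: ifP.
Qed.

Let nomerge (_ _ : X) : seq X := [::].

(** Pascal's rule: a shuffle of two powers of [i] starts with a letter of the one or of the
    other. *)
Lemma dl_size i (y : nat -> C) u v :
  dl nomerge (fun w => if all (pred1 i) w then y (size w) else 0) u v =
  if all (pred1 i) u && all (pred1 i) v
  then 'C(size u + size v, size u)%:R * y (size u + size v)%N else 0.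
Proof.
have [n] := ubnP (size u + size v); elim: n y u v => // n IH y [|a u] v hn.
  by rewrite dl_nil_l bin0 mul1r.
case: v hn => [|b v] hn; first by rewrite dl_nil_r andbT addn0 binn mul1r.
rewrite dl_cons big_nil addr0.
have dE c : de c (fun w : seq X => if all (pred1 i) w then y (size w) else 0) =
   (c == i)%:R *: ((fun w => if all (pred1 i) w then y (size w).+1 else 0) : ncs X C).
  apply/funext => w; rewrite ncsZ /de /=.
  by case: (c == i); rewrite ?mul1r ?mul0r.
have dz (x : C) f u' v' : dl nomerge (x *: f) u' v' = x * dl nomerge f u' v'.
  by rewrite /dl mulr_sumr.
rewrite !dE !dz.
rewrite (IH (fun k => y k.+1)); last by move: hn => /=; lia.
rewrite (IH (fun k => y k.+1)); last by move: hn => /=; lia.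
rewrite /= !addnS !addSn.
case: (a == i); case: (b == i); rewrite ?(mul0r, mul1r, andbF, addr0, add0r) //=;
 case: (all _ u); case: (all _ v); rewrite ?mulr0 ?addr0 //=.
by rewrite -mulrDl -natrD addnC -binS.
Qed.

Lemma exs_grouplike i x : grouplike nomerge (exs i 0 x).
Proof.
apply/funext => u; apply/funext => v.
rewrite (_ : exs i 0 x =
  fun w => if all (pred1 i) w then iota ((size w)`!%:R^-1) * x ^+ size w else 0); last first.
  by apply/funext => w; rewrite /exs addn0.
rewrite (dl_size i (fun n => iota (n`!%:R^-1) * x ^+ n)) /tns.
case: (all _ u); case: (all _ v); rewrite /= ?mul0r ?mulr0 //.
rewrite mulrACA -exprD -rmorphM mulrA; congr (_ * _).
rewrite -[_%:R](rmorph_nat iota) -rmorphM; congr (iota _).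
have := bin_fact (leq_addr (size v) (size u)).
rewrite -{2}addnC addnK => h.
have n0 k : k`!%:R != 0 :> K by rewrite pnatr_eq0 -lt0n fact_gt0.
have b0 : 'C(size u + size v, size u)%:R != 0 :> K.
  by rewrite pnatr_eq0 -lt0n bin_gt0 leq_addr.
by rewrite -h !natrM; field; rewrite b0 !n0.
Qed.

Lemma exsD i x y : exs i 0 (x + y) = exs i 0 x * exs i 0 y.
Proof.
apply/funext => w; rewrite ncsME /exs.
have hall n : all (pred1 i) w = all (pred1 i) (take n w) && all (pred1 i) (drop n w).
  by rewrite -all_cat cat_take_drop.
case: (boolP (all _ w)) => hw; last first.
  apply/esym/big1 => k _; case: ifP => h1; last by rewrite mul0r.
  case: ifP => h2; last by rewrite mulr0.
  by move: hw; rewrite (hall k) h1 h2.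
rewrite addn0 addrC exprDn mulr_sumr; apply: eq_bigr => k _.
have /andP[h1 h2] : all (pred1 i) (take k w) && all (pred1 i) (drop k w) by rewrite -hall.
have kw : (k <= size w)%N by rewrite -ltnS.
rewrite h1 h2 !addn0 size_drop size_take_min (minn_idPl kw).
rewrite -[_ *+ 'C(_, _)]mulr_natl -(rmorph_nat iota 'C(size w, k)).
transitivity (iota ((size w)`!%:R^-1 * 'C(size w, k)%:R) * (x ^+ k * y ^+ (size w - k))).
  by rewrite rmorphM; ring.
transitivity (iota (k`!%:R^-1 * (size w - k)`!%:R^-1) * (x ^+ k * y ^+ (size w - k)));
  last by rewrite rmorphM; ring.
congr (iota _ * _).
have n0 m : m`!%:R != 0 :> K by rewrite pnatr_eq0 -lt0n fact_gt0.
rewrite -(bin_fact kw) !natrM.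
have b0 : 'C(size w, k)%:R != 0 :> K by rewrite pnatr_eq0 -lt0n bin_gt0.
by field; rewrite b0 !n0.
Qed.

End Exponential.

(** * Words in the letters [1 0^(a+1)] *)

Section DepthWords.
Variable C : comNzRingType.
Implicit Types (f g : ncs bool C) (m : seq nat).

(** In words over [nat] the letter [a] stands for the integer [a + 2]. *)
Definition yword m : word := nword [seq a.+2 | a <- m].

Lemma yword_cons a m : yword (a :: m) = true :: nseq a.+1 false ++ yword m.
Proof. by []. Qed.

Definition rho f : ncs nat C := fun m => f (yword m).

Lemma rhoD f g : rho (f + g) = rho f + rho g. Proof. by []. Qed.
Lemma rhoZ x f : rho (x *: f) = x *: rho f. Proof. by []. Qed.
(** A cut before the end of the run of zeros leaves a right part on which [h] vanishes. *)
Lemma mul_zeros f h k w : (forall v, h (false :: v) = 0) ->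
  (f * h) (nseq k false ++ w) = (((fun v => f (nseq k false ++ v)) : ncs bool C) * h) w.
Proof.
move=> h0; elim: k f => [|k IH] f; first by [].
rewrite -[LHS]/((f * h) (false :: (nseq k false ++ w))).
by rewrite ncsM_cons h0 mulr0 add0r IH.
Qed.

(** Only cuts in front of a letter [1] count, and these are exactly the cuts between two letters of
    the depth word. *)
Lemma rhoM f g : rho (f * (lett true * g)) = rho f * rho (lett true * g).
Proof.
apply/funext => m; elim: m f => [|a m IH] f; first by [].
rewrite [RHS]ncsM_cons -[de a (rho f)]/(rho (fun v => f (true :: nseq a.+1 false ++ v))).
rewrite -IH /rho yword_cons ncsM_cons; congr (_ + _).
rewrite (@mul_zeros _ _ a.+1) //.
by move=> v; rewrite lettM_ne.
Qed.

(** A nonempty prefix of a depth word starts with [1], where [f] vanishes. *)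
Lemma rho_zeros f g : f [::] = 1 -> (forall v, f (true :: v) = 0) -> rho (f * g) = rho g.
Proof.
move=> f1 f0; apply/funext => -[|a m]; first by rewrite /rho ncsM_nil f1 mul1r.
rewrite /rho yword_cons ncsM_cons f1 mul1r.
by rewrite [X in _ + X]conv0l ?addr0 // => v; exact: f0.
Qed.

(** In a depth word every [1] is followed by a zero. Thus exponentials of the letter [1] can be cut
    after the linear term. *)
Lemma rho_11 f g : rho (f * (lett true * (lett true * g))) = 0.
Proof.
rewrite rhoM; have -> : rho (lett true * (lett true * g)) = 0; last by rewrite mulr0.
apply/funext => -[|a m]; first by rewrite /rho lettM_nil.
by rewrite /rho yword_cons lettM_eq /= lettM_ne.
Qed.

End DepthWords.

(** * Conjugation of partitions *)

Section Conjugation.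
Variables (C : comNzRingType) (D : algType C) (q c : C) (t : nat).
Hypothesis qt : q ^+ t.+1 = 0.
Variables (M Y : nat -> D).

Let lam u := c * \sum_(1 <= l < t.+1) q ^+ (u * l).

Definition Psi k := c *: \sum_(1 <= v < t.+1) q ^+ (k * v) *: M v.

Hypothesis YE : forall u, (0 < u)%N ->
  Y u = M u + \sum_(1 <= u' < u) lam u' *: (M (u - u')%N * Y u').

Let Th k := c *: \sum_(1 <= u < t.+1) q ^+ (k * u) *: Y u.

Let q0 n : (t < n)%N -> q ^+ n = 0.
Proof. by move=> h; rewrite -(subnK h) exprD qt mulr0. Qed.

(** The factor [q ^+ (k * u)] shifts the range of [l] by [k]; what moves beyond [t] vanishes. *)
Let lamE u k : (0 < u)%N -> q ^+ (k * u) * lam u = c * \sum_(k.+1 <= l < t.+1) q ^+ (l * u).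
Proof.
move=> u0; rewrite /lam mulrCA; congr (_ * _); rewrite mulr_sumr.
transitivity (\sum_(1 <= l < t.+1) q ^+ ((l + k) * u)).
  by apply: eq_bigr => l _; rewrite -exprD mulnDl addnC [(u * l)%N]mulnC.
rewrite -[k.+1]add1n (big_addn 1 t.+1 k).
case: (leqP k t) => hk; last first.
  rewrite [RHS]big_geq; last lia.
  by rewrite big_nat_cond big1 // => l /andP[/andP[l1 _] _]; apply: q0; nia.
rewrite (big_cat_nat (n := t.+1 - k)) //=; [|lia|lia].
rewrite addrC [X in X + _]big_nat_cond big1 ?add0r // => l /andP[/andP[l1 l2] _].
by apply: q0; nia.
Qed.

Let ThE k : (0 < k)%N -> Th k = Psi k * (1 + \sum_(k.+1 <= l < t.+1) Th l).
Proof.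
move=> k0.
have -> : \sum_(k.+1 <= l < t.+1) Th l =
   \sum_(1 <= u < t.+1) (q ^+ (k * u) * lam u) *: Y u.
  rewrite /Th; under eq_bigr do rewrite scaler_sumr.
  rewrite exchange_big_nat /= big_nat [RHS]big_nat.
  apply: eq_bigr => u /andP[u1 _].
  rewrite lamE // mulr_sumr scaler_suml; apply: eq_bigr => l _.
  by rewrite scalerA.
rewrite mulrDr mulr1 /Psi -scalerAl -scalerDr /Th; congr (_ *: _).
rewrite mulr_suml.
transitivity (\sum_(1 <= u < t.+1) (q ^+ (k * u) *: M u +
   \sum_(1 <= u' < u) (q ^+ (k * u) * lam u') *: (M (u - u')%N * Y u'))).
  rewrite big_nat [RHS]big_nat; apply: eq_bigr => u /andP[u1 _].
  rewrite YE // scalerDr scaler_sumr; congr (_ + _).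
  by apply: eq_bigr => u' _; rewrite scalerA.
rewrite big_split /=; congr (_ + _).
transitivity (\sum_(1 <= u < t.+1) \sum_(1 <= u' < t.+1 | (u' < u)%N)
   (q ^+ (k * u) * lam u') *: (M (u - u')%N * Y u')).
  rewrite big_nat [RHS]big_nat; apply: eq_bigr => u /andP[u1 u2].
  rewrite (big_nat_widen _ _ t.+1) //; lia.
rewrite (exchange_big_dep_nat predT) //=.
under [RHS]eq_bigr do rewrite mulr_sumr.
rewrite [RHS]exchange_big_nat /=.
rewrite big_nat [RHS]big_nat; apply: eq_bigr => u' /andP[u'1 u'2].
transitivity (\sum_(u'.+1 <= u < t.+1) (q ^+ (k * u) * lam u') *: (M (u - u')%N * Y u')).
  by rewrite [RHS](big_nat_widenl _ 1) //; lia.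
rewrite (big_addn 0 _ u'.+1) [RHS](big_addn 0 _ 1) /=.
rewrite [RHS](big_cat_nat (n := t.+1 - u'.+1)) //=; last lia.
rewrite [X in _ = _ + X]big_nat_cond [X in _ = _ + X]big1 ?addr0 => [|i /andP[/andP[i1 i2] _]].
  apply: eq_bigr => i _.
  rewrite -scalerAl -scalerAr scalerA [in RHS]mulrA -exprD.
  congr ((q ^+ _ * _) *: (M _ * _)); lia.
(* Here [v = i + 1] satisfies [v + u' > t], so [q ^+ (k * (v + u'))] is zero because [k > 0]. *)
rewrite -scalerAl -scalerAr scalerA mulrA -exprD q0 ?mul0r ?scale0r //; nia.
Qed.

(** Unfolding [Y] gives terms with [u_1 > ... > u_r], a power [q^(u_1 l_1 + ... + u_r l_r)] and the
    product of the [M (u_j - u_(j+1))]. Summation by parts rewrites the exponent as the sum of the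
    [(l_1 + ... + l_j) (u_j - u_(j+1))], which is the general term of the right-hand side. [Th k]
    collects the terms whose smallest index on the right is [k]. *)
Lemma conjugation : 1 + \sum_(1 <= u < t.+1) lam u *: Y u =
  \prod_(1 <= k < t.+1) (1 + Psi k).
Proof.
have h j : (j <= t)%N -> \prod_((t - j).+1 <= k < t.+1) (1 + Psi k) =
    1 + \sum_((t - j).+1 <= k < t.+1) Th k.
  elim: j => [|j IH] hj; first by rewrite subn0 !big_geq // addr0.
  have e : ((t - j.+1).+1 = t - j)%N by lia.
  rewrite e big_ltn; last lia.
  rewrite [in RHS]big_ltn; last lia.
  rewrite IH; last lia.
  by rewrite mulrDl mul1r -ThE ?addrA 1?[1 + Th _ + _]addrAC //; lia.
have := h t (leqnn t); rewrite subnn => ->; congr (_ + _).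
rewrite /Th.
under [RHS]eq_bigr do rewrite scaler_sumr.
rewrite [RHS]exchange_big_nat /= big_nat [RHS]big_nat.
apply: eq_bigr => u /andP[u1 _].
rewrite -[lam u]mul1r -(expr0 q) -(mul0n u) lamE // mulr_sumr scaler_suml.
by apply: eq_bigr => l _; rewrite scalerA.
Qed.

End Conjugation.

(** * The substituted series on depth words *)

Section Substituted.
Variables (K : numFieldType) (C : comNzRingType) (iota : {rmorphism K -> C}).
Variables (Phi Phi' : ncs bool C) (q c : C) (t : nat) (x : C).
Hypotheses (PhiK : Phi * Phi' = 1) (PhiK' : Phi' * Phi = 1).
Hypothesis qt : q ^+ t.+1 = 0.
Let lam u := c * \sum_(1 <= l < t.+1) q ^+ (u * l).
Local Notation E y := (exs iota false 0 y).
Local Notation e1 := (lett true : ncs bool C).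
Local Notation ex1 y := (exs iota true 0 y).

(** The grouplike product over [u = n .. 1], after the letter [1] has been conjugated by [Phi]. *)
Fixpoint Sprod (n : nat) : ncs bool C :=
  if n is m.+1 then
    E (- (n%:R * x)) * (Phi * ex1 (lam n) * Phi') * E (n%:R * x) * Sprod m
  else 1.

Let B := Phi' * E x * Phi.

Let V' := fix V' (n : nat) : ncs bool C := if n is m.+1 then ex1 (lam n) * B * V' m else 1.
Let V := fix V (n : nat) : ncs bool C :=
  if n is m.+1 then (1 + lam n *: e1) * B * V m else 1.

(** Neighbouring exponentials combine to [e^((n+1) x e_0) e^(- n x e_0) = e^(x e_0)], which [Phi']
    and [Phi] enclose to form [B]. *)
Let SprodE n : Sprod n * Phi = E (- (n%:R * x)) * Phi * V' n.
Proof.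
elim: n => [|n IH] /=; first by rewrite mul0r oppr0 exs_x0 !mul1r mulr1.
rewrite -mulrA IH /B !mulrA; do 2! congr (_ * _).
rewrite -[LHS]mulrA; congr (_ * _).
rewrite -exsD; congr (exs _ _ _ _).
by rewrite -mulrBl -natrB // subSnn mul1r.
Qed.

Let ex1E (y : C) : exists h, ex1 y = 1 + y *: e1 + e1 * (e1 * h).
Proof.
exists (exs iota true 2 y); apply/funext => -[|a [|b w]]; rewrite !ncsD ncsZ.
- by rewrite exs0_nil lettM_nil /lett /= mulr0 !addr0.
- rewrite lettM_cons lettM_nil /lett /exs /= mulr0 addr0 andbT add0r.
  case: a; rewrite /= ?mulr0 // (_ : (1 + 0)`! = 1%N) // invr1 rmorph1 mul1r mulr1.
  by rewrite expr1.
- rewrite !lettM_cons /lett /exs eqseq_cons andbF mulr0 !add0r /=.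
  by case: a; case: b; rewrite /= ?mul0r ?mul1r // addn0 !addn2.
Qed.

Let rho_ex1 f g y : rho (f * ex1 y * g) = rho (f * (1 + y *: e1) * g).
Proof.
have [h ->] := ex1E y.
rewrite mulrDr mulrDl rhoD -[RHS]addr0; congr (_ + _).
by rewrite -!mulrA rho_11.
Qed.

Let rho_V n f : rho (f * V' n) = rho (f * V n).
Proof.
elim: n f => [|n IH] f //=.
rewrite mulrA IH -!mulrA mulrA rho_ex1 !mulrA.
by rewrite -!mulrA.
Qed.

Let rhoE f y : rho (E y * f) = rho f.
Proof. by rewrite rho_zeros // exs0_nil. Qed.

Definition Mser j := rho (e1 * (Phi' * E (j%:R * x) * Phi)).

Let Bexp j : B ^+ j = Phi' * E (j%:R * x) * Phi.
Proof.
elim: j => [|j IH]; first by rewrite mul0r exs_x0 mulr1 PhiK'.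
rewrite exprS IH /B !mulrA -[_ * Phi * Phi']mulrA PhiK mulr1.
rewrite -[_ * E x * _]mulrA -exsD; congr (_ * E _ * _).
by rewrite -[in RHS]addn1 natrD mulrDl mul1r addrC.
Qed.

Let Yser u := rho (e1 * (B * V u.-1)).

(** Sorted by the first factor of [V m] that contributes its [e1]: the powers of [B] before it
    accumulate, and [rhoM] splits the word there. *)
Let YV m j : rho (e1 * (B ^+ j * V m)) =
  Mser (j + m) + \sum_(1 <= u < m.+1) lam u *: (Mser (j + m - u) * Yser u).
Proof.
elim: m j => [|m IH] j; first by rewrite big_geq // addr0 addn0 mulr1 Bexp.
rewrite /= -mulrA mulrDl mul1r mulrDr mulrDr rhoD.
rewrite [B ^+ j * (B * _)]mulrA -exprSr IH addSnnS [in RHS]big_nat_recr //= addrA; congr (_ + _).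
rewrite -scalerAl -!scalerAr rhoZ; congr (_ *: _).
by rewrite addnK [e1 * (B ^+ j * _)]mulrA rhoM Bexp.
Qed.

Let YserE u : (0 < u)%N ->
  Yser u = Mser u + \sum_(1 <= u' < u) lam u' *: (Mser (u - u') * Yser u').
Proof.
case: u => // u _; rewrite {1}/Yser /= -{1}[B]expr1 YV add1n; congr (_ + _).
Qed.

(** If no [e1] is taken from the first factor, [Phi * B = E x * Phi], and [rho] does not see an
    exponential of [e0] on the left. *)
Let PhiV n : rho (Phi * V n) = rho Phi * (1 + \sum_(1 <= u < n.+1) lam u *: Yser u).
Proof.
elim: n => [|n IH]; first by rewrite big_geq // addr0 !mulr1.
rewrite [V n.+1]/= -mulrA mulrDl mul1r mulrDr rhoD.
rewrite [X in rho X + _](_ : _ = E x * (Phi * V n)); last first.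
  by rewrite /B !mulrA PhiK mul1r.
rewrite rhoE IH [in RHS]big_nat_recr //= addrA [in RHS]mulrDr; congr (_ + _).
by rewrite -scalerAl -!scalerAr rhoZ rhoM.
Qed.

Lemma rho_Sprod : rho (Sprod t * Phi) =
  rho Phi * \prod_(1 <= k < t.+1) (1 + Psi q c t Mser k).
Proof.
by rewrite SprodE -mulrA rhoE rho_V PhiV (conjugation qt YserE).
Qed.

End Substituted.

(** * Sums over permutations and finite functions as sums over lists *)

Definition qsh0 : word -> word -> seq word := qsh (fun _ _ => [::]).

Section ShuffleSum.
Variable V : nmodType.

(** The condition of [is_shuffle] with the length and the cut as independent parameters, as the
    induction on the length requires. *)
Definition bsh (n N : nat) (s : 'S_n) : bool :=
  [forall i : 'I_n, forall j : 'I_n, ((i < j < N) || (N <= i < j))%N ==> (s i < s j)%N].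

Lemma bshP n N (s : 'S_n) :
  reflect (forall i j : 'I_n, ((i < j < N) || (N <= i < j))%N -> (s i < s j)%N) (bsh N s).
Proof.
apply: (iffP forallP) => h i; first by move=> j; move: (h i) => /forallP /(_ j) /implyP.
by apply/forallP => j; apply/implyP; apply: h.
Qed.

Lemma sum_lift_perm n (i0 : 'I_n.+1) (P : pred 'S_n.+1) (G : 'S_n.+1 -> V) :
  \sum_(s | P s && (s i0 == ord0)) G s =
  \sum_(s : 'S_n | P (lift_perm i0 ord0 s)) G (lift_perm i0 ord0 s).
Proof.
rewrite (reindex (lift_perm i0 ord0)); last first.
  pose ulsf i (s : 'S_n.+1) k := odflt k (unlift (s i) (s (lift i k))).
  have ulsfK i (s : 'S_n.+1) k: lift (s i) (ulsf i s k) = s (lift i k).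
    rewrite /ulsf; have:= neq_lift i k.
    by rewrite -(can_eq (permK s)) => /unlift_some[] ? ? ->.
  have inj_ulsf: injective (ulsf i0 _).
    move=> s; apply: can_inj (ulsf (s i0) s^-1%g) _ => k'.
    by rewrite {1}/ulsf ulsfK !permK liftK.
  exists (fun s => perm (inj_ulsf s)) => [s _ | s].
    by apply/permP=> k'; rewrite permE /ulsf lift_perm_lift lift_perm_id liftK.
  rewrite inE => /andP[_] /(s _ =P _) => si0; apply/permP=> k.
  case: (unliftP i0 k) => [k'|] ->; rewrite ?lift_perm_id //.
  by rewrite lift_perm_lift -si0 permE ulsfK.
by apply: eq_bigl => s; rewrite lift_perm_id eqxx andbT.
Qed.

(** The first letter of a shuffle is the first letter of one of the two words, so the index sent to
    [0] is [0] or [N]. *)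
Lemma bsh_lift n N (i0 : 'I_n.+1) (s : 'S_n) : (N <= n.+1)%N ->
  bsh N (lift_perm i0 ord0 s) =
  if (i0 < N)%N then (i0 == 0%N :> nat) && bsh N.-1 s else (i0 == N :> nat) && bsh N s.
Proof.
move=> hN; case: ifP => hi.
  case: eqP => [i00|] /=; last first.
    move=> i00; apply/bshP => h.
    have : (lift_perm i0 ord0 s ord0 < lift_perm i0 ord0 s i0)%N by apply: h => /=; lia.
    by rewrite lift_perm_id ltn0.
  have e : i0 = ord0 by apply: val_inj.
  subst i0; apply/bshP/bshP => h i j hij.
    have := h (lift ord0 i) (lift ord0 j); rewrite !lift_perm_lift /= /bump /= !add1n !ltnS.
    by apply; move: hij hi => /=; lia.
  case: (unliftP ord0 i) => [i'|] ei; case: (unliftP ord0 j) => [j'|] ej; subst i j.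
  - rewrite !lift_perm_lift /= /bump /= !add1n ltnS; apply: h.
    by move: hij; rewrite /= /bump /= !add1n; lia.
  - by move: hij; rewrite /= ltn0 andbF.
  - by rewrite lift_perm_id lift_perm_lift.
  - by move: hij; rewrite ltnn andbF.
case: eqP => [i00|] /=; last first.
  move=> i00.
  have hN' : (N < n.+1)%N by have := ltn_ord i0; lia.
  apply/bshP => h.
  have : (lift_perm i0 ord0 s (Ordinal hN') < lift_perm i0 ord0 s i0)%N by apply: h => /=; lia.
  by rewrite lift_perm_id ltn0.
apply/bshP/bshP => h i j hij.
  have := h (lift i0 i) (lift i0 j); rewrite !lift_perm_lift /= /bump /= !add1n !ltnS.
  apply; move: hij; rewrite -i00; lia.
case: (unliftP i0 i) => [i'|] ei; case: (unliftP i0 j) => [j'|] ej; subst i j.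
- rewrite !lift_perm_lift /= /bump /= !add1n ltnS; apply: h.
  by move: hij; rewrite /= /bump -i00; lia.
- by exfalso; move: hij; rewrite /= /bump -i00; lia.
- by rewrite lift_perm_id lift_perm_lift.
- by exfalso; move: hij; rewrite ltnn; lia.
Qed.

Lemma qsh0_split (G : word -> V) u v : u ++ v != [::] ->
  \sum_(w <- qsh0 u v) G w =
  (if u is a :: u' then \sum_(w <- qsh0 u' v) G (a :: w) else 0) +
  (if v is b :: v' then \sum_(w <- qsh0 u v') G (b :: w) else 0).
Proof.
have q0 w : qsh0 [::] w = [:: w] by [].
have q1 w : qsh0 w [::] = [:: w] by case: w.
case: u v => [|a u] [|b v] // _; rewrite ?q0 ?q1 ?big_seq1 ?add0r ?addr0 //.
by rewrite -[qsh0 (a :: u) (b :: v)]/(_ ++ _ ++ [::]) cats0 big_cat !big_map.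
Qed.

(** Both sides are sorted by the first letter of the shuffled word; deleting it lowers [n], and also
    [N] when it comes from the first word. *)
Lemma shuffle_sum_gen n N (x : 'I_n -> bool) (G : word -> V) : (N <= n)%N ->
  \sum_(s : 'S_n | bsh N s) G [seq x ((s^-1)%g i) | i : 'I_n] =
  \sum_(w <- qsh0 (take N [seq x i | i : 'I_n]) (drop N [seq x i | i : 'I_n])) G w.
Proof.
elim: n N x G => [|n IH] N x G hN.
  have e (f : 'I_0 -> bool) : [seq f i | i : 'I_0] = [::].
    by apply/nilP; rewrite /nilp size_map -cardE card_ord.
  rewrite e /= big_seq1 (bigD1 1%g) /=; last by apply/bshP => -[].
  by rewrite big1 ?addr0 ?e // => s /andP[_ /eqP[]]; apply/permP => -[].
rewrite (partition_big (fun s : 'S_n.+1 => (s^-1)%g ord0) predT) //=.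
under eq_bigr => i0 _.
  rewrite (eq_bigl (fun s : 'S_n.+1 => bsh N s && (s i0 == ord0))); last first.
    by move=> s; rewrite -(can_eq (permK s)) permKV eq_sym.
  rewrite sum_lift_perm.
  over.
have img (i0 : 'I_n.+1) s : [seq x (((lift_perm i0 ord0 s)^-1)%g i) | i : 'I_n.+1]
   = x i0 :: [seq x (lift i0 ((s^-1)%g i)) | i : 'I_n].
  rewrite /image_mem enum_ordSl /= lift_permV lift_perm_id; congr (_ :: _).
  by rewrite -map_comp; apply: eq_map => i /=; rewrite lift_perm_lift.
have hx : [seq x i | i : 'I_n.+1] = x ord0 :: [seq x (lift ord0 i) | i : 'I_n].
  by rewrite /image_mem enum_ordSl /= -map_comp.
have szx m (y : 'I_m -> bool) : size [seq y i | i : 'I_m] = m.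
  by rewrite size_map -cardE card_ord.
rewrite qsh0_split; last by rewrite cat_take_drop hx.
have T (i0 : 'I_n.+1) M : (M <= n)%N ->
  \sum_(s : 'S_n | bsh M s) G [seq x (((lift_perm i0 ord0 s)^-1)%g i) | i : 'I_n.+1] =
  \sum_(w <- qsh0 (take M [seq x (lift i0 i) | i : 'I_n])
                  (drop M [seq x (lift i0 i) | i : 'I_n])) G (x i0 :: w).
  move=> hM; rewrite -(IH M (fun i => x (lift i0 i)) (fun w => G (x i0 :: w)) hM).
  by apply: eq_bigr => s _; rewrite img.
have S1 : \sum_(i0 : 'I_n.+1 | (i0 < N)%N)
   \sum_(s : 'S_n | bsh N (lift_perm i0 ord0 s))
     G [seq x (((lift_perm i0 ord0 s)^-1)%g i) | i : 'I_n.+1] =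
   (if take N [seq x i | i : 'I_n.+1] is a :: u' then
     \sum_(w <- qsh0 u' (drop N [seq x i | i : 'I_n.+1])) G (a :: w) else 0).
  case: N hN => [|N] hN; first by rewrite big_pred0 // take0.
  rewrite (bigD1 ord0) //= [X in _ + X]big1 ?addr0; last first.
    move=> i0 /andP[hi0 i00]; rewrite big_pred0 // => s.
    by rewrite bsh_lift // hi0; move: i00; rewrite -val_eqE /= => /negPf ->.
  rewrite (eq_bigl (fun s => bsh N s)); last by move=> s; rewrite bsh_lift.
  by rewrite T // hx.
have S2 : \sum_(i0 : 'I_n.+1 | ~~ (i0 < N)%N)
   \sum_(s : 'S_n | bsh N (lift_perm i0 ord0 s))
     G [seq x (((lift_perm i0 ord0 s)^-1)%g i) | i : 'I_n.+1] =
   (if drop N [seq x i | i : 'I_n.+1] is b :: v' then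
     \sum_(w <- qsh0 (take N [seq x i | i : 'I_n.+1]) v') G (b :: w) else 0).
  case: (ltnP N n.+1) => hN'; last first.
    rewrite drop_oversize ?szx // big_pred0 // => i0.
    by rewrite (leq_trans (ltn_ord i0)).
  rewrite (bigD1 (Ordinal hN')) /= ?ltnn // [X in _ + X]big1 ?addr0; last first.
    move=> i0 /andP[hi0 i00]; rewrite big_pred0 // => s.
    by rewrite bsh_lift // (negPf hi0); move: i00; rewrite -val_eqE /= => /negPf ->.
  rewrite (eq_bigl (fun s => bsh N s)); last first.
    by move=> s; rewrite bsh_lift //= ltnn eqxx.
  rewrite T //.
  have n1 m (y : 'I_m -> bool) (i : 'I_m) : nth false [seq y i | i : 'I_m] i = y i.
    by rewrite (nth_map i) ?size_enum_ord // nth_ord_enum.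
  have -> : drop N [seq x i | i : 'I_n.+1] = x (Ordinal hN') :: drop N.+1 [seq x i | i : 'I_n.+1].
    by rewrite (drop_nth false) ?szx // -(n1 _ x (Ordinal hN')).
  set iN := Ordinal hN'.
  have nl k : (k < n)%N -> nth false [seq x (lift iN i) | i : 'I_n] k =
     nth false [seq x i | i : 'I_n.+1] (bump N k).
    move=> hk; rewrite -[k]/(nat_of_ord (Ordinal hk)) n1.
    by rewrite -[bump _ _]/(nat_of_ord (lift iN (Ordinal hk))) n1.
  have -> : take iN [seq x (lift iN i) | i : 'I_n] = take iN [seq x i | i : 'I_n.+1].
    apply: (@eq_from_nth _ false); first by rewrite !size_takel ?szx //= ltnW.
    move=> k; rewrite size_takel ?szx //= => hk'.
    rewrite !nth_take //= nl; last lia.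
    by rewrite /bump leqNgt hk'.
  have -> // : drop iN [seq x (lift iN i) | i : 'I_n] = drop iN.+1 [seq x i | i : 'I_n.+1].
  apply: (@eq_from_nth _ false); first by rewrite !size_drop !szx /=; lia.
  move=> k; rewrite size_drop szx => hk.
  rewrite !nth_drop nl /=; last by move: hk => /=; lia.
  by rewrite /bump leq_addr.
by rewrite -S1 -S2 (bigID (fun i0 : 'I_n.+1 => (i0 < N)%N)).
Qed.

Lemma shuffle_sum (G : word -> V) (u v : word) :
  \sum_(s : 'S_(size u + size v) | is_shuffle s) G (shuffle_word s) =
  \sum_(w <- qsh0 u v) G w.
Proof.
pose x (i : 'I_(size u + size v)) := nth false (u ++ v) i.
have hx : [seq x i | i : 'I_(size u + size v)] = u ++ v.
  apply: (@eq_from_nth _ false); first by rewrite size_map -cardE card_ord size_cat.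
  move=> k; rewrite size_map -cardE card_ord => hk.
  by rewrite (nth_map (Ordinal hk)) ?size_enum_ord // /x nth_enum_ord.
have := shuffle_sum_gen x G (leq_addr (size v) (size u)).
by rewrite hx take_size_cat // drop_size_cat.
Qed.

End ShuffleSum.

Section FfunSum.
Variable V : nmodType.

(** Trades sums over finite functions for sums over lists that can be generated by recursion. *)
Lemma sum_ffun_list m N (P : pred {ffun 'I_m -> 'I_N}) (Q : pred (seq nat))
    (L : seq (seq nat)) (G : seq nat -> V) :
  uniq L -> (forall u, P u = Q [seq (u j : nat) | j : 'I_m]) ->
  (forall s, (s \in L) = [&& size s == m, all (gtn N) s & Q s]) ->
  \sum_(u | P u) G [seq (u j : nat) | j : 'I_m] = \sum_(s <- L) G s.
Proof.
move=> uL hP hL.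
pose l (u : {ffun 'I_m -> 'I_N}) := [seq (u j : nat) | j : 'I_m].
have nl (u : {ffun 'I_m -> 'I_N}) (j : 'I_m) : nth 0%N (l u) j = u j.
  by rewrite /l (nth_map j) ?size_enum_ord // nth_ord_enum.
have linj : injective l.
  by move=> u u' e; apply/ffunP => j; apply: val_inj; rewrite /= -!nl e.
have szl u : size (l u) = m by rewrite size_map -cardE card_ord.
rewrite -big_filter -(big_map l predT G).
apply: perm_big; apply: uniq_perm => //.
  by rewrite map_inj_uniq // filter_uniq // index_enum_uniq.
move=> s; apply/mapP/idP => [[u] |].
  rewrite mem_filter => /andP[Pu _] ->; rewrite hL szl eqxx -hP Pu andbT /=.
  by apply/allP => k /mapP[j _ ->] /=.
rewrite hL => /and3P[/eqP sz /allP sN Qs].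
have h (j : 'I_m) : (nth 0%N s j < N)%N by apply: sN; rewrite mem_nth // sz.
exists [ffun j => Ordinal (h j)].
  rewrite mem_filter mem_index_enum andbT hP; congr (Q _): Qs.
  apply: (@eq_from_nth _ 0%N); first by rewrite szl.
  rewrite sz => j hj; rewrite -[j]/(nat_of_ord (Ordinal hj)) nl ffunE //.
apply: (@eq_from_nth _ 0%N); first by rewrite szl.
by rewrite sz => j hj; rewrite -[j in RHS]/(nat_of_ord (Ordinal hj)) nl ffunE.
Qed.

Fixpoint subs (k : nat) (l : seq nat) : seq (seq nat) :=
  match k, l with
  | 0, _ => [:: [::]]
  | k'.+1, [::] => [::]
  | k'.+1, a :: l' => [seq a :: s | s <- subs k' l'] ++ subs k l'
  end.

Lemma mem_subs k l s : (s \in subs k l) = (size s == k) && subseq s l.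
Proof.
elim: l k s => [|a l IH] [|k] [|b s] //=.
- by rewrite andbF.
- by rewrite mem_cat IH /= orbF; apply/negbTE/mapP => -[].
rewrite mem_cat IH eqSS /=.
case: (eqVneq b a) => [->|ne].
  rewrite (mem_map (fun x y => _ : a :: x = a :: y -> x = y)); last by move=> x y [].
  rewrite IH; case: (size s == k) => //=.
  apply/orP/idP => [[//|h]|->]; last by left.
  exact: subseq_trans (subseq_cons s a) h.
rewrite [X in X || _](_ : _ = false) //.
by apply/mapP => -[s' _ [e _]]; rewrite e eqxx in ne.
Qed.

Lemma subs_uniq k l : uniq l -> uniq (subs k l).
Proof.
elim: l k => [|a l IH] [|k] //= /andP[al ul].
rewrite cat_uniq map_inj_uniq ?IH //=; last by move=> x y [].
rewrite andbT; apply/hasPn => s; rewrite mem_subs => /andP[_ /mem_subseq sl].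
by apply/mapP => -[s' _ e]; move: al; rewrite sl // e mem_head.
Qed.

Lemma incr_sorted m N (u : {ffun 'I_m -> 'I_N}) :
  incr u = sorted ltn [seq (u j : nat) | j : 'I_m]
           && all (leq 1) [seq (u j : nat) | j : 'I_m].
Proof.
have nl (j : 'I_m) : nth 0%N [seq (u j : nat) | j : 'I_m] j = u j.
  by rewrite (nth_map j) ?size_enum_ord // nth_ord_enum.
have szl : size [seq (u j : nat) | j : 'I_m] = m by rewrite size_map -cardE card_ord.
rewrite /incr andbC; congr (_ && _); last first.
  apply/forallP/allP => [h k /mapP[j _ ->] //|h j].
  by apply: h; apply/mapP; exists j; rewrite ?mem_enum.
rewrite (sorted_pairwise ltn_trans).
apply/forallP/(pairwiseP 0%N) => [h i j|h i].
  rewrite !inE szl => hi hj ij.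
  have /forallP /(_ (Ordinal hj)) /implyP /(_ ij) := h (Ordinal hi).
  by rewrite -!nl.
apply/forallP => j; apply/implyP => ij; rewrite -!nl.
by apply: h; rewrite // inE szl.
Qed.

Lemma sorted_iota_subseq s n : subseq s (iota 1 n) =
  sorted ltn s && all (fun x => 0 < x <= n)%N s.
Proof.
apply/idP/andP => [h|[hs ha]].
  split; first exact: subseq_sorted ltn_trans _ _ h (iota_ltn_sorted 1 n).
  by apply/allP => x /(mem_subseq h); rewrite mem_iota; lia.
suff -> : s = [seq x <- iota 1 n | x \in s] by exact: filter_subseq.
apply: (irr_sorted_eq ltn_trans ltnn) => //.
  exact: sorted_filter ltn_trans _ _ (iota_ltn_sorted 1 n).
move=> x; rewrite mem_filter mem_iota; case: (boolP (x \in s)) => //= /(allP ha); lia.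
Qed.

Lemma sum_incr m N (G : seq nat -> V) :
  \sum_(u : {ffun 'I_m -> 'I_N.+1} | incr u) G [seq (u j : nat) | j : 'I_m] =
  \sum_(s <- subs m (iota 1 N)) G s.
Proof.
apply: (sum_ffun_list (Q := fun s => sorted ltn s && all (leq 1) s)).
- exact/subs_uniq/iota_uniq.
- by move=> u; rewrite incr_sorted.
move=> s; rewrite mem_subs sorted_iota_subseq; congr (_ && _).
rewrite andbCA; congr (_ && _); rewrite -all_predI; apply: eq_all => x /=; lia.
Qed.

Lemma subseq_rev (s l : seq nat) : subseq (rev s) (rev l) = subseq s l.
Proof.
have h (a b : seq nat) : subseq a b -> subseq (rev a) (rev b).
  move=> /subseqP[m sm ->]; apply/subseqP; exists (rev m); first by rewrite !size_rev.
  by rewrite rev_mask.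
by apply/idP/idP => /h //; rewrite !revK.
Qed.

Lemma perm_subs_rev k l : uniq l -> perm_eq (subs k l) (map rev (subs k (rev l))).
Proof.
move=> ul; apply: uniq_perm; first exact: subs_uniq.
  by rewrite map_inj_uniq ?subs_uniq ?rev_uniq //; exact: (can_inj revK).
move=> s; rewrite -[s in RHS]revK mem_map; last exact: (can_inj revK).
by rewrite !mem_subs size_rev subseq_rev.
Qed.

Fixpoint comps (m r : nat) : seq (seq nat) :=
  if m is m'.+1 then
    flatten [seq [seq i :: s | s <- comps m' (r - i)] | i <- iota 1 r]
  else if r == 0%N then [:: [::]] else [::].

Lemma mem_comps m r s : (s \in comps m r) = [&& size s == m, all (leq 1) s & sumn s == r].
Proof.
elim: m r s => [|m IH] r s /=.
  case: (eqVneq r 0%N) => [->|ne]; case: s => [|a s]; rewrite ?inE ?andbF //=.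
  by rewrite eq_sym (negPf ne).
apply/idP/idP.
  move=> /allpairsPdep[i [s' [+ hs' ->]]] /=.
  rewrite mem_iota => hi; move: hs'; rewrite IH eqSS.
  by move=> /and3P[-> -> /eqP ->]; rewrite andbT; lia.
case: s => [|i s] //= /and3P[]; rewrite eqSS => sz /andP[i1 hs] /eqP hr.
apply/allpairsPdep; exists i, s; split => //; first by rewrite mem_iota; lia.
by rewrite IH sz hs /=; lia.
Qed.

Lemma comps_uniq m r : uniq (comps m r).
Proof.
elim: m r => [|m IH] r /=; first by case: ifP.
elim: (iota 1 r) (iota_uniq 1 r) => //= i l IHl /andP[il ul].
rewrite cat_uniq IHl // andbT map_inj_uniq ?IH //=; last by move=> x y [].
apply/hasPn => s /flattenP[l' /mapP[j jl ->] /mapP[s' _ ->]].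
by apply/mapP => -[s'' _ [e _]]; rewrite -e jl in il.
Qed.

Lemma sumn_image m N (i : {ffun 'I_m -> 'I_N}) :
  (\sum_(j < m) i j)%N = sumn [seq (i j : nat) | j : 'I_m].
Proof. by rewrite sumnE big_map big_enum. Qed.

Lemma sum_composition r m (G : seq nat -> V) :
  \sum_(i : {ffun 'I_m -> 'I_r.+1} | composition i) G [seq (i j : nat) | j : 'I_m] =
  \sum_(s <- comps m r) G s.
Proof.
apply: (sum_ffun_list (Q := fun s => all (leq 1) s && (sumn s == r))).
- exact: comps_uniq.
- move=> u; rewrite /composition sumn_image; congr (_ && _).
  apply/forallP/allP => [h k /mapP[j _ ->] //|h j].
  by apply: h; apply/mapP; exists j; rewrite ?mem_enum.
move=> s; rewrite mem_comps; case: (size s == m) => //=.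
case: (boolP (all (leq 1) s)) => //= _; rewrite ?andbF //.
case: eqP => [e|]; rewrite ?andbF ?andbT //; apply/esym/allP => x xs /=.
rewrite ltnS -e sumnE; rewrite (big_rem x) //=; lia.
Qed.

Lemma perm_comps_rev m r : perm_eq (comps m r) (map rev (comps m r)).
Proof.
apply: uniq_perm; first exact: comps_uniq.
  by rewrite map_inj_uniq ?comps_uniq //; exact: (can_inj revK).
move=> s; rewrite -[s in RHS]revK mem_map; last exact: (can_inj revK).
by rewrite !mem_comps size_rev all_rev sumn_rev.
Qed.

End FfunSum.

(** * The characters of the algebra of iterated integrals *)

Section SumTransport.
Lemma Iint_qsh a u v b :
  Iint a u b * Iint a v b = \sum_(w <- qsh0 u v) Iint a w b.
Proof. by rewrite Iint_shuffle (shuffle_sum (fun w => Iint a w b)). Qed.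

Lemma qsh0_head u v w : w \in qsh0 u v ->
  (u == [::]) || head false u -> (v == [::]) || head false v ->
  (w == [::]) || head false w.
Proof.
case: u => [|a u] /=; first by rewrite inE => /eqP ->.
case: v => [|b v] /=; first by rewrite inE => /eqP ->.
rewrite cats0 mem_cat => /orP[] /mapP[w' _ ->] /= ha hb; by rewrite ?ha ?hb.
Qed.

Lemma head_nword w : (w == [::]) || head false w ->
  exists2 n, is_index n & w = nword n.
Proof.
have [m] := ubnP (size w); elim: m w => // m IH [|[] w] // hm _.
  by exists [::].
pose k := find id w.
have e : w = nseq k false ++ drop k w.
  rewrite -{1}[w](cat_take_drop k); congr (_ ++ _).
  apply: (@eq_from_nth _ true).
    by rewrite size_nseq size_take; case: ltnP => //; have := find_size id w; rewrite -/k; lia.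
  move=> i hi; have hik : (i < k)%N by move: hi; rewrite size_take_min leq_min => /andP[].
  rewrite nth_take // nth_nseq hik.
  have := @before_find _ true id w i; rewrite -/k => /(_ hik) ->.
  by [].
have hd : (drop k w == [::]) || head false (drop k w).
  case: (ltnP k (size w)) => hk; last by rewrite drop_oversize.
  rewrite -nth0 nth_drop addn0; apply/orP; right.
  by have := @nth_find _ false id w; rewrite has_find; apply.
have [|n hn en] := IH (drop k w) _ hd.
  by rewrite size_drop; move: hm => /=; lia.
exists (k.+1 :: n); first by [].
by rewrite /nword /= -/(nword n) -en -e.
Qed.

Lemma nword_head n : is_index n -> (nword n == [::]) || head false (nword n).
Proof. by case: n. Qed.

End SumTransport.

(** * Reduction of all symbols to words in the letters [n] *)

Section Span.

(** [z] is prescribed on the [Iw n] only, so its multiplicativity is proved on their span, and every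
    symbol has to be placed in it. *)
Inductive inspan : I1 -> Prop :=
| Span0 : inspan 0
| SpanS c n x : is_index n -> inspan x -> inspan (c *: Iw n + x).

Lemma spanD x y : inspan x -> inspan y -> inspan (x + y).
Proof. by elim=> [|c n x' hn _ IH] hy; rewrite ?add0r // -addrA; constructor; auto. Qed.

Lemma spanZ c x : inspan x -> inspan (c *: x).
Proof.
elim=> [|d n x' hn _ IH]; first by rewrite scaler0; constructor.
by rewrite scalerDr scalerA; constructor.
Qed.

Lemma span_sum I (r : seq I) (P : pred I) (F : I -> I1) :
  (forall i, P i -> inspan (F i)) -> inspan (\sum_(i <- r | P i) F i).
Proof. by move=> h; elim/big_rec: _ => [|i x Pi hx]; [constructor|apply: spanD; auto]. Qed.

Lemma span_sum_seq (I : eqType) (r : seq I) (F : I -> I1) :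
  (forall i, i \in r -> inspan (F i)) -> inspan (\sum_(i <- r) F i).
Proof.
move=> h; rewrite big_seq; by apply: span_sum => i; exact: h.
Qed.

Lemma span_Iw n : is_index n -> inspan (Iw n).
Proof.
by move=> hn; rewrite -[Iw n]addr0 -[Iw n]scale1r; constructor => //; constructor.
Qed.

Lemma span_head w : (w == [::]) || head false w -> inspan (Iint false w true).
Proof. by move=> /head_nword[n hn ->]; exact: span_Iw. Qed.

Lemma span_Iw_mul m n : is_index m -> is_index n -> inspan (Iw m * Iw n).
Proof.
move=> hm hn; rewrite /Iw Iint_qsh; apply: span_sum_seq => w hw.
by apply: span_head; apply: (qsh0_head hw); exact: nword_head.
Qed.

Lemma spanM x y : inspan x -> inspan y -> inspan (x * y).
Proof.
elim=> [|c m x' hm _ IHx] hy; first by rewrite mul0r; constructor.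
rewrite mulrDl; apply: spanD; last exact: IHx.
rewrite -scalerAl; apply: spanZ.
elim: hy => [|d n y' hn _ IHy]; first by rewrite mulr0; constructor.
rewrite mulrDr -scalerAr; apply: spanD => //; apply: spanZ; exact: span_Iw_mul.
Qed.

(** Multiplying by [I(0; 0; 1) = 0] expresses a word with [k.+1] leading zeros
    through words with [k] leading zeros. *)
Lemma qsh0_zeros (V : zmodType) (G : word -> V) k w :
  \sum_(v <- qsh0 [:: false] (nseq k false ++ true :: w)) G v =
  G (nseq k.+1 false ++ true :: w) *+ k.+1
  + \sum_(v <- qsh0 [:: false] w) G (nseq k false ++ true :: v).
Proof.
elim: k G => [|k IH] G /=.
  by rewrite cats0 big_cons big_map.
rewrite cats0 big_cons big_map -/(qsh0 _ _).
by rewrite (IH (fun v => G (false :: v))) addrA /= [in RHS]mulrS.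
Qed.

Lemma qsh0_all_zeros (V : zmodType) (G : word -> V) k :
  \sum_(v <- qsh0 [:: false] (nseq k false)) G v = G (nseq k.+1 false) *+ k.+1.
Proof.
elim: k G => [|k IH] G /=; first by rewrite big_seq1.
by rewrite cats0 big_cons big_map (IH (fun v => G (false :: v))) [RHS]mulrS.
Qed.

(** The induction is on the number of leading zeros, for all tails at once, since shuffling in a
    zero changes the tail. *)
Lemma zeros_ind (P : word -> Prop) :
  (forall k, P (nseq k.+1 false)) ->
  (forall w, (w == [::]) || head false w -> P w) ->
  (forall k w, (forall v, P (nseq k false ++ true :: v)) -> P (nseq k.+1 false ++ true :: w)) ->
  forall w, P w.
Proof.
move=> h0 h1 h2 w.
have h k v : P (nseq k false ++ true :: v).
  elim: k v => [|k IH] v; first exact: h1.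
  exact: h2.
case: (boolP (has id w)) => hw; last first.
  have -> : w = nseq (size w) false.
    elim: w hw => //= -[] w IH //= hw; congr (_ :: _); exact: IH.
  case: (size w) => [|k]; first exact: h1.
  exact: h0.
have [k [v ->]] : exists k v, w = nseq k false ++ true :: v.
  elim: w hw => // -[] w IH /= hw; first by exists 0%N, w.
  by have [k [v ->]] := IH hw; exists k.+1, v.
exact: h.
Qed.

Lemma Iint_zeros_solve k w :
  Iint false (nseq k.+1 false ++ true :: w) true =
  - (k.+1%:R^-1 : rat) *: \sum_(v <- qsh0 [:: false] w) Iint false (nseq k false ++ true :: v) true.
Proof.
have := Iint_qsh false [:: false] (nseq k false ++ true :: w) true.
rewrite Iint_001 mul0r (qsh0_zeros (fun v => Iint false v true)) => /esym /eqP.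
rewrite addr_eq0 => /eqP h.
by rewrite scaleNr -scalerN -h -scaler_nat scalerA mulVf ?scale1r // pnatr_eq0.
Qed.

Lemma Iint_all_zeros k : Iint false (nseq k.+1 false) true = 0.
Proof.
have := Iint_qsh false [:: false] (nseq k false) true.
rewrite Iint_001 mul0r (qsh0_all_zeros (fun v => Iint false v true)) => /esym /eqP.
rewrite -scaler_nat scaler_eq0 pnatr_eq0 /= => /eqP -> //.
Qed.

Lemma span01 w : inspan (Iint false w true).
Proof.
elim/zeros_ind: w => [k|w|k w IH]; first by rewrite Iint_all_zeros; constructor.
  exact: span_head.
by rewrite Iint_zeros_solve; apply: spanZ; apply: span_sum_seq => v _; exact: IH.
Qed.

Lemma span1 : inspan 1.
Proof. by rewrite -(Iint_unit false true); exact: span01. Qed.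

(** Composing the vanishing loop from [0] to [0] through the point [1] expresses the symbol by
    symbols from [0] to [1] and shorter ones from [1] to [0]. *)
Lemma span10 w : inspan (Iint true w false).
Proof.
have [m] := ubnP (size w); elim: m w => // m IH [|a w] hm.
  by rewrite Iint_unit; exact: span1.
have := Iint_path false (a :: w) false true.
rewrite Iint_loop // big_ord_recl take0 drop0 Iint_unit mul1r => /esym/eqP.
rewrite addr_eq0 => /eqP ->; rewrite -scaleN1r; apply: spanZ.
apply: span_sum => k _; apply: spanM; first exact: span01.
apply: IH; rewrite size_drop /= /bump /=; move: hm => /=; lia.
Qed.

Lemma span_Iint a w b : inspan (Iint a w b).
Proof.
case: a; case: b; [|exact: span10|exact: span01|];
  (case: (eqVneq w [::]) => [->|/Iint_loop ->]; [rewrite Iint_unit; exact: span1|by constructor]).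
Qed.

End Span.

(** * Grouplike series of regularised zeta values *)

Section ZetaCharacter.
Variables (R : realType) (Zsh : {linear HH -> {poly R} | ratr \; *:%R}).
Hypothesis hZ : is_shuffle_regularisation Zsh.
Variable z : {linear I1 -> R | ratr \; *%R}.
Hypothesis z_words : forall n : seq nat, is_index n -> z (Iw n) = zeta_sh Zsh n.

Lemma msupp_mono w : monalg.msupp (mono w : HH) = [fset w]%fset.
Proof. by rewrite /mono monalg.msuppU oner_eq0. Qed.

Lemma shuffle_mono u v : shuffle_prod (mono u) (mono v) = \sum_(w <- qsh0 u v) mono w.
Proof.
rewrite /shuffle_prod !msupp_mono !big_seq_fset1.
by rewrite !monalg.mcoeffUU mulr1 scale1r (shuffle_sum (fun w => mono w)).
Qed.

Lemma mono_H1 w : (w == [::]) || head false w -> in_H1 (mono w).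
Proof. by move=> hw; rewrite /in_H1 msupp_mono; apply/allP => v; rewrite inE => /eqP ->. Qed.

Lemma z_head w : (w == [::]) || head false w -> z (Iint false w true) = (Zsh (mono w))`_0.
Proof. by move=> /head_nword[n hn ->]; exact: z_words. Qed.

(** On words this is the shuffle property of [Zsh] read on constant terms; bilinearity does the
    rest. *)
Lemma zM x y : inspan x -> inspan y -> z (x * y) = z x * z y.
Proof.
have zZ (c : rat) x' : z (c *: x') = ratr c * z x' by rewrite linearZ.
elim=> [|c m x' hm _ IHx] hy; first by rewrite mul0r raddf0 mul0r.
rewrite mulrDl !raddfD /= IHx // mulrDl -scalerAl; congr (_ + _).
rewrite !zZ -[RHS]mulrA; congr (_ * _).
elim: hy => [|d n y' hn _ IHy]; first by rewrite mulr0 raddf0 mulr0.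
rewrite mulrDr !raddfD /= IHy mulrDr -scalerAr; congr (_ + _).
rewrite !zZ [RHS]mulrCA; congr (_ * _).
rewrite /Iw Iint_qsh raddf_sum /=.
rewrite (z_head (nword_head hm)) (z_head (nword_head hn)).
rewrite -coef0M -(Zsh_shuffle hZ); try by apply: mono_H1; exact: nword_head.
rewrite shuffle_mono raddf_sum coef_sum big_seq [RHS]big_seq.
apply: eq_bigr => w hw; apply: z_head.
by apply: (qsh0_head hw); exact: nword_head.
Qed.

(** The unit is the empty word, and each partial sum for the empty index is a single empty
    product. *)
Lemma z1 : z 1 = 1.
Proof.
have h := zM span1 span1; rewrite mulr1 in h.
have := Zsh_zeta hZ (n := [::]) isT.
move=> /(congr1 (fun p : {poly R} => p`_0)).
rewrite -(z_head (w := [::])) // coefC Iint_unit => -> /=.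
rewrite /zeta (_ : @zeta_partial R [::] = fun=> 1); first exact: lim_cst.
apply/funext => N; rewrite /zeta_partial (eq_bigr (fun=> 1)); last by move=> m _; rewrite big_ord0.
rewrite sumr_const (eq_card (B := predT)) ?card_ffun ?card_ord ?expn0 //.
by move=> u; rewrite !inE; apply/andP; split; apply/forallP => -[].
Qed.

Definition Zser a b : ncs bool R := fun w => z (Iint a w b).

Lemma Zser_nil a b : Zser a b [::] = 1.
Proof. by rewrite /Zser Iint_unit z1. Qed.

Lemma Zser_path a b x : Zser a b = Zser a x * Zser x b.
Proof.
apply/funext => w; rewrite ncsME /Zser (Iint_path _ _ _ x) raddf_sum /=.
by apply: eq_bigr => k _; rewrite zM //; exact: span_Iint.
Qed.

Lemma Zser_diag a : Zser a a = 1.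
Proof.
apply/funext => -[|c w]; first exact: Zser_nil.
by rewrite /Zser Iint_loop // raddf0.
Qed.

Lemma ZserK a b : Zser a b * Zser b a = 1.
Proof. by rewrite -Zser_path Zser_diag. Qed.

Lemma Zser_grouplike a b : grouplike (fun _ _ => [::]) (Zser a b).
Proof.
apply/funext => u; apply/funext => v; rewrite /dl /tns /Zser.
rewrite -zM; try exact: span_Iint.
by rewrite Iint_qsh raddf_sum.
Qed.

Lemma Zser_0 : Zser false true [:: false] = 0.
Proof. by rewrite /Zser Iint_001 raddf0. Qed.

Lemma Zser_zeta n : admissible n -> Zser false true (nword n) = zeta R n.
Proof.
move=> hn; have hi : is_index n by case/andP: hn.
by rewrite /Zser -/(Iw n) z_words // /zeta_sh (Zsh_zeta hZ) // coefC.
Qed.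

Lemma z_prod (I : Type) (r : seq I) (F : I -> I1) : (forall i, inspan (F i)) ->
  z (\prod_(i <- r) F i) = \prod_(i <- r) z (F i).
Proof.
move=> h; suff [] : inspan (\prod_(i <- r) F i) /\ z (\prod_(i <- r) F i) = \prod_(i <- r) z (F i) by [].
elim: r => [|i r [IH1 IH2]]; first by rewrite !big_nil z1; split => //; exact: span1.
by rewrite !big_cons; split; [exact: spanM | rewrite zM // IH2].
Qed.

End ZetaCharacter.

(** * Inverses of grouplike series *)

Section Antipode.
Variables (C : comNzRingType) (Phi Phi' : ncs bool C).
Hypotheses (PhiG : grouplike (fun _ _ => [::]) Phi) (PhiK : Phi' * Phi = 1) (Phi_nil : Phi [::] = 1).

(** A shuffle of the reversed prefix with the suffix starts with the letter just before or just
    after the cut. Each starting letter thus arises from two neighbouring cuts with opposite signs,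
    and the sum telescopes. *)
Lemma antipode_sum (G : word -> C) w : w != [::] ->
  \sum_(k < (size w).+1) (-1) ^+ k * (\sum_(v <- qsh0 (rev (take k w)) (drop k w)) G v) = 0.
Proof.
move=> w0.
pose A k : C := if k is k'.+1 then
   (if (k' < size w)%N then
     \sum_(v <- qsh0 (rev (take k' w)) (drop k w)) G (nth false w k' :: v) else 0) else 0.
have h k : (k <= size w)%N -> \sum_(v <- qsh0 (rev (take k w)) (drop k w)) G v = A k + A k.+1.
  move=> hk; rewrite qsh0_split; last first.
    by rewrite -size_eq0 size_cat size_rev -size_cat cat_take_drop size_eq0.
  congr (_ + _).
    case: k hk => [|k] hk; first by rewrite take0.
    by rewrite (take_nth false) // rev_rcons /= hk.
  rewrite /A; case: ltnP => hk'; last by rewrite drop_oversize.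
  by rewrite (drop_nth false).
transitivity (\sum_(k < (size w).+1) ((-1) ^+ k * A k - (-1) ^+ k.+1 * A k.+1)).
  apply: eq_bigr => k _; rewrite h; last by rewrite -ltnS.
  by rewrite mulrDr exprS mulN1r mulNr opprK.
have := telescope_sumr (fun k => (-1) ^+ k * A k) (leq0n (size w).+1).
rewrite big_mkord => t.
rewrite -[LHS]opprK -sumrN (eq_bigr (fun k : 'I_(size w).+1 => (-1) ^+ k.+1 * A k.+1 - (-1) ^+ k * A k)).
  by rewrite t /A ltnn !mulr0 subrr oppr0.
by move=> k _; rewrite opprB.
Qed.

(** By [antipode_sum] the series [S] is a left inverse of [Phi], hence equal to [Phi']. *)
Lemma antipode w : Phi' w = (-1) ^+ size w * Phi (rev w).
Proof.
pose S : ncs bool C := fun w => (-1) ^+ size w * Phi (rev w).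
have SK : S * Phi = 1.
  apply/funext => v; rewrite ncsME ncs_1; case: v => [|a v].
    by rewrite big_ord1 /S /= Phi_nil !mulr1.
  rewrite -[RHS](antipode_sum Phi (w := a :: v)) //.
  apply: eq_bigr => k _; rewrite (grouplikeE _ _ PhiG) /S mulrA size_takel //.
  by rewrite -ltnS.
suff -> : Phi' = S by [].
(* [Phi'] has constant term 1 and can be cancelled on the left, so the left inverse [Phi'] is also a
   right inverse. *)
have PhiK' : Phi * Phi' = 1.
  apply/eqP; rewrite -subr_eq0; apply/eqP.
  have e : Phi' * (Phi * Phi' - 1) = 0 by rewrite mulrBr mulrA PhiK mul1r mulr1 subrr.
  have P'1 : Phi' [::] = 1.
    have := congr1 (fun f : ncs bool C => f [::]) PhiK.
    by rewrite ncsM_nil Phi_nil mulr1.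
  set X := Phi * Phi' - 1 in e *.
  apply/funext => v; have [n] := ubnP (size v); elim: n v => // n IH v hn.
  have := congr1 (fun f : ncs bool C => f v) e.
  rewrite ncsME big_ord_recl take0 drop0 P'1 mul1r big1 ?addr0 // => k _.
  rewrite IH ?mulr0 // size_drop /= /bump /=.
  have := ltn_ord k; move: hn; lia.
by rewrite -[S]mulr1 -PhiK' mulrA SK mul1r.
Qed.

End Antipode.

(** * Goncharov's coproduct as a substitution of series *)

Section Positions.
Variable V : comPzSemiRingType.

Fixpoint pathprod (H : nat -> nat -> V) (x : nat) (s : seq nat) : V :=
  if s is y :: s' then H x y * pathprod H y s' else 1.

Lemma pathprodE H x s :
  \prod_(p < size s) H (nth 0%N (x :: s) p) (nth 0%N (x :: s) p.+1) = pathprod H x s.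
Proof.
elim: s x => [|y s IH] x; first by rewrite big_ord0.
by rewrite big_ord_recl /= -IH.
Qed.

Fixpoint sum_subs (l : seq nat) (G : seq nat -> V) : V :=
  if l is a :: l' then sum_subs l' (fun s => G (a :: s)) + sum_subs l' G else G [::].

Lemma sum_subsE l G : \sum_(k < (size l).+1) \sum_(s <- subs k l) G s = sum_subs l G.
Proof.
elim: l G => [|a l IH] G; first by rewrite big_ord_recl big_ord0 addr0 big_seq1.
rewrite big_ord_recl /= -(IH (fun s => G (a :: s))) -(IH G) big_seq1.
rewrite [X in _ = _ + X]big_ord_recl [X in _ = _ + (X + _)](_ : _ = G [::]); last first.
  by case: (l) => [|? ?]; rewrite big_seq1.
rewrite [RHS]addrCA; congr (_ + _).
transitivity (\sum_(i < (size l).+1)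
   (\sum_(s <- subs i l) G (a :: s) + \sum_(s <- subs i.+1 l) G s)).
  by apply: eq_bigr => i _; rewrite big_cat big_map.
rewrite big_split; congr (_ + _).
rewrite big_ord_recr /= [X in _ + X](_ : _ = 0) ?addr0 //.
apply: big1_seq => s /andP[_]; rewrite mem_subs => /andP[/eqP sz /size_subseq].
by rewrite sz ltnn.
Qed.

End Positions.

Section Goncharov.
Variables (C : comNzRingType) (Z : bool -> bool -> ncs bool C) (b : bool).
Implicit Types F : ncs bool C.

(** Goncharov's sum over the subwords of [w]: [p] is the current gap, which starts
    after the letter [a], and [F] weights the subword of the letters kept. *)
Fixpoint goncharov_sum (a : bool) F (p w : word) : C :=
  if w is c :: w' then goncharov_sum a F (rcons p c) w' + Z a c p * goncharov_sum c (de c F) [::] w'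
  else F [::] * Z a b p.

Definition goncharov_series a F : ncs bool C := goncharov_sum a F [::].

(** Sorted by the first letter [c] that is kept; the letters before it extend the gap [p]. *)
Lemma goncharov_sumE a F p w : goncharov_sum a F p w = F [::] * Z a b (p ++ w) +
  \sum_c (((fun v => Z a c (p ++ v)) : ncs bool C) * (lett c * goncharov_series c (de c F))) w.
Proof.
elim: w p => [|d w IH] p.
  rewrite /= cats0 big1 ?addr0 // => c _.
  by rewrite ncsM_nil lettM_nil mulr0.
rewrite /= IH cat_rcons -addrA; congr (_ + _).
under [RHS]eq_bigr => c _ do rewrite ncsM_cons cats0 lettM_cons.
rewrite big_split addrC; congr (_ + _).
  rewrite (bigD1 d) //= eqxx mul1r big1 ?addr0 // => c cd.
  by rewrite eq_sym (negPf cd) mul0r mulr0.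
apply: eq_bigr => c _.
rewrite (_ : de d _ = ((fun v => Z a c (rcons p d ++ v)) : ncs bool C)) //.
by apply/funext => v; rewrite /de cat_rcons.
Qed.

Lemma goncharov_seriesE a F : goncharov_series a F =
  F [::] *: Z a b + \sum_c Z a c * (lett c * goncharov_series c (de c F)).
Proof. by apply/funext => w; rewrite ncsD ncs_sum /goncharov_series goncharov_sumE. Qed.

Hypothesis Zpath : forall a x c, Z a c = Z a x * Z x c.

Lemma goncharov_series_shift a x F : goncharov_series a F = Z a x * goncharov_series x F.
Proof.
rewrite [in RHS]goncharov_seriesE goncharov_seriesE mulrDr -scalerAr -Zpath; congr (_ + _).
by rewrite mulr_sumr; apply: eq_bigr => c _; rewrite mulrA -Zpath.
Qed.

(** Path composition moves the starting point of every gap back to [0]. The recursion becomes the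
    substitution of [Z 0 c * c * Z c 0] for the letter [c]; when the [Z a a] are 1, this leaves [e0]
    alone and conjugates [e1]. *)
Lemma goncharov_series_fix F : goncharov_series false F =
  F [::] *: Z false b + \sum_c (Z false c * lett c * Z c false) * goncharov_series false (de c F).
Proof.
rewrite goncharov_seriesE; congr (_ + _); apply: eq_bigr => c _.
by rewrite -mulrA (goncharov_series_shift c false) !mulrA.
Qed.

Lemma sum_subs_gon (A : nat -> bool) F x0 o n : (x0 < o)%N -> A (o + n)%N = b ->
  sum_subs (iota o n) (fun s =>
    pathprod (fun x y => Z (A x) (A y) [seq A j | j <- index_iota x.+1 y]) x0 (rcons s (o + n)%N)
    * F [seq A j | j <- s]) =
  goncharov_sum (A x0) F [seq A j | j <- index_iota x0.+1 o] [seq A j | j <- iota o n].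
Proof.
have sumM (r : C) l G : sum_subs l (fun s => r * G s) = r * sum_subs l G.
  by elim: l G => [|c l IH] G //=; rewrite !IH mulrDr.
elim: n o x0 F => [|n IH] o x0 F h.
  by rewrite addn0 => hb /=; rewrite mulr1 mulrC hb.
rewrite -addSnnS => hb /=; rewrite addrC; congr (_ + _).
  rewrite IH //; last by rewrite ltnW.
  congr (goncharov_sum _ _ _ _).
  by rewrite /index_iota subSn // -[(_ - _).+1]addn1 iotaD map_cat subnKC // cats1.
under [X in sum_subs _ X = _]funext => s do rewrite -mulrA.
rewrite sumM; congr (_ * _).
by rewrite (IH o.+1 o (de (A o) F)) // /index_iota subnn.
Qed.

End Goncharov.

Section CoproductFormula.
Variables (R : realType) (Delta : {linear I1 -> tensor I1 I1}).
Hypothesis Delta_goncharov : is_goncharov_coproduct Delta.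
Variables (Zsh : {linear HH -> {poly R} | ratr \; *:%R}).
Hypothesis hZ : is_shuffle_regularisation Zsh.
Variable z : {linear I1 -> R | ratr \; *%R}.
Hypothesis z_words : forall n : seq nat, is_index n -> z (Iw n) = zeta_sh Zsh n.
Variable g : {linear I1 -> (nat -> R[i]^o) | ratr \; *:%R}.
Variables (C : comNzRingType) (iota : {rmorphism R[i] -> C}) (cf : C -> R[i]).
Hypotheses (cfD : {morph cf : x y / x + y}) (cfZ : forall a x, cf (iota a * x) = a * cf x).
Variables (t : nat) (P : ncs bool C).
Hypothesis gP : forall v, g (Iint false v true) t = cf (P v).

Definition ZC a b : ncs bool C := fun w => iota (z (Iint a w b))%:C%C.

Lemma tens_map0 : tens_map z g (0 : tensor I1 I1) t = 0.
Proof.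
have := tens_mapD z g 0 0 t; rewrite addr0 => /eqP.
by rewrite -subr_eq0 opprD addrA subrr sub0r oppr_eq0 => /eqP.
Qed.

Lemma tens_map_sum I (r : seq I) (Q : pred I) (F : I -> tensor I1 I1) :
  tens_map z g (\sum_(i <- r | Q i) F i) t = \sum_(i <- r | Q i) tens_map z g (F i) t.
Proof.
elim/big_rec2: _ => [|i x y _ <-]; first exact: tens_map0.
by rewrite tens_mapD.
Qed.

Lemma cf0 : cf 0 = 0.
Proof. by rewrite -(mul0r 0) -(rmorph0 iota) cfZ mul0r. Qed.

(** The left tensor factors are products of symbols, on which [z] is multiplicative; their values
    are scalars and pass through [cf]. *)
Lemma coproduct_formula w :
  tens_map z g (Delta (Iint false w true)) t = cf (goncharov_series ZC true false P w).
Proof.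
rewrite Delta_goncharov tens_map_sum.
set N := size w.
pose A := nth false (false :: rcons w true).
pose Gl (s : seq nat) : C := pathprod
  (fun x y => ZC (A x) (A y) [seq A j | j <- index_iota x.+1 y]) 0 (rcons s N.+1)
  * P [seq A j | j <- s].
have step k : tens_map z g (\sum_(i : {ffun 'I_k -> 'I_N.+1} | incr i)
      tens (goncharov_left false true i) (goncharov_right false true i)) t =
    \sum_(s <- subs k (seq.iota 1 N)) cf (Gl s).
  rewrite tens_map_sum -(sum_incr k N (fun s => cf (Gl s))).
  apply: eq_bigr => i _; rewrite tens_mapE.
  have szi : size [seq (i j : nat) | j : 'I_k] = k by rewrite size_map -cardE card_ord.
  rewrite /goncharov_right -/A gP -cfZ; congr (cf _).
  rewrite /Gl; congr (_ * _); last first.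
    by congr (P _); rewrite /image_mem -map_comp.
  rewrite /goncharov_left (z_prod hZ z_words); last by move=> p; exact: span_Iint.
  rewrite !rmorph_prod -pathprodE size_rcons szi.
  by apply: eq_bigr => p _.
under eq_bigr do rewrite step.
have cf_sum (I : Type) (r : seq I) (F : I -> C) : \sum_(s <- r) cf (F s) = cf (\sum_(s <- r) F s).
  by elim/big_rec2: _ => [|i x y _ ->]; rewrite ?cf0 ?cfD.
under eq_bigr do rewrite cf_sum.
rewrite cf_sum; congr (cf _).
have := sum_subsE (seq.iota 1 N) Gl; rewrite size_iota => ->.
have hA : A (1 + N)%N = true.
  by rewrite /A add1n /= nth_rcons ltnn eqxx.
rewrite /Gl (sum_subs_gon ZC P (x0 := 0) (o := 1) (n := N) (A := A) _ hA) //.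
rewrite /goncharov_series; congr (goncharov_sum _ _ _ _ _ _).
apply: (@eq_from_nth _ false); first by rewrite size_map size_iota.
move=> j; rewrite size_map size_iota => hj.
by rewrite (nth_map 0%N) ?size_iota // nth_iota // /A add1n /= nth_rcons hj.
Qed.

End CoproductFormula.

(** * Substitution in a product of exponentials *)

Section SubstituteExp.
Variables (K : numFieldType) (C : comNzRingType) (iota : {rmorphism K -> C}).
Variables (Z : bool -> bool -> ncs bool C).
Hypothesis Zpath : forall a x c, Z a c = Z a x * Z x c.
Hypothesis Zdiag : forall a, Z a a = 1.
Let Phi := Z false true.
Let Phi' := Z true false.
Let sigma := goncharov_series Z true false.
Let Xs c : ncs bool C := Z false c * lett c * Z c false.

Let PhiK : Phi * Phi' = 1. Proof. by rewrite /Phi /Phi' -Zpath Zdiag. Qed.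
Let PhiK' : Phi' * Phi = 1. Proof. by rewrite /Phi /Phi' -Zpath Zdiag. Qed.

Let Xs0 c : Xs c [::] = 0.
Proof. by rewrite /Xs !ncsM_nil /lett mulr0 mul0r. Qed.

Let sigmaE F : sigma F = F [::] *: Phi + \sum_c Xs c * sigma (de c F).
Proof. exact: goncharov_series_fix. Qed.

Let sigma_mul F G : sigma (F * G) = sigma F * Phi' * sigma G.
Proof. exact: (sigmaM Xs0 PhiK sigmaE). Qed.

Lemma exs_rec i k x : exs iota i k x = exs iota i k x [::] *: 1 + lett i * exs iota i k.+1 x :> ncs bool C.
Proof.
apply/funext => -[|a w]; rewrite ncsD ncsZ ncs_1 ?lettM_nil ?lettM_cons ?mulr1 ?addr0 //.
rewrite mulr0 add0r; case: (eqVneq a i) => [->|ai].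
  by rewrite mul1r -(de_exs iota i k).
by rewrite mul0r -/(de a _ w) de_exs_ne.
Qed.

Let sigma_exs i k x (H : nat -> ncs bool C) :
  (forall k, H k = exs iota i k x [::] *: Phi + Xs i * H k.+1) ->
  sigma (exs iota i k x) = H k.
Proof.
move=> hH; rewrite -[exs _ _ _ _]scale1r -[RHS]scale1r.
(* Scalar multiples of the derivatives of an exponential are closed under [de]; the index records
   the scalar and the order of the derivative. *)
pose nxt (c : bool) (p : C * nat) := (p.1 * (c == i)%:R, p.2.+1).
apply: (@fix_unique C _ Xs Xs0 (C * nat)%type nxt (fun p => (p.1 * exs iota i p.2 x [::]) *: Phi)
  (fun p => sigma (p.1 *: exs iota i p.2 x)) (fun p => p.1 *: H p.2) _ _ (1, k)) => -[b n] /=.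
  rewrite sigmaE; congr (_ + _); apply: eq_bigr => c _; congr (_ * sigma _).
  rewrite deZ -scalerA; case: (eqVneq c i) => [->|ci].
    by rewrite de_exs scale1r.
  by rewrite de_exs_ne // scale0r.
rewrite hH scalerDr scalerA; congr (_ + _).
rewrite (bigD1 i) //= eqxx mulr1 big1 ?addr0 ?scalerAr // => c /negPf ->.
by rewrite mulr0 scale0r mulr0.
Qed.

Lemma sigma_exs0 x : sigma (exs iota false 0 x) = exs iota false 0 x * Phi.
Proof.
rewrite (sigma_exs (i := false) 0 (x := x) (H := fun k => exs iota false k x * Phi)) // => k.
rewrite {1}exs_rec mulrDl -scalerAl mul1r; congr (_ + _).
by rewrite /Xs Zdiag mul1r mulr1 mulrA.
Qed.

Lemma sigma_exs1 x : sigma (exs iota true 0 x) = Phi * exs iota true 0 x.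
Proof.
rewrite (sigma_exs (i := true) 0 (x := x) (H := fun k => Phi * exs iota true k x)) // => k.
rewrite {1}exs_rec mulrDr -scalerAr mulr1; congr (_ + _).
by rewrite /Xs -/Phi -/Phi' -[RHS]mulrA [Phi' * _]mulrA PhiK' mul1r -!mulrA.
Qed.

Variables (q c : C) (t : nat) (x : C).
Let lam u := c * \sum_(1 <= l < t.+1) q ^+ (u * l).

Fixpoint Pprod (n : nat) : ncs bool C :=
  if n is m.+1 then
    exs iota false 0 (- (n%:R * x)) * exs iota true 0 (lam n) * exs iota false 0 (n%:R * x) * Pprod m
  else 1.

Lemma sigma_Pprod n : sigma (Pprod n) = Sprod iota Phi Phi' q c t x n * Phi.
Proof.
elim: n => [|n IH] /=.
  rewrite sigmaE scale1r mul1r big1 ?addr0 // => d _.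
  have -> : de d (1 : ncs bool C) = 0 by apply/funext.
  rewrite (_ : sigma 0 = 0) ?mulr0 //.
  have := sigma_lin Xs0 sigmaE (-1) 0 0.
  by rewrite scaler0 addr0 scaleN1r addNr.
rewrite !sigma_mul IH !sigma_exs0 sigma_exs1.
by rewrite -!mulrA ![Phi * (Phi' * _)]mulrA PhiK !mul1r.
Qed.

Lemma Pprod_grouplike n : grouplike (fun _ _ => [::]) (Pprod n).
Proof. by elim: n => [|n IH] /=; [exact: grouplike1|do !apply: grouplikeM => //; exact: exs_grouplike]. Qed.

Lemma Sprod_grouplike n : grouplike (fun _ _ => [::]) Phi -> grouplike (fun _ _ => [::]) Phi' ->
  grouplike (fun _ _ => [::]) (Sprod iota Phi Phi' q c t x n * Phi).
Proof.
move=> h h'; apply: grouplikeM => //.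
by elim: n => [|n IH] /=; [exact: grouplike1|do !apply: grouplikeM => //; exact: exs_grouplike].
Qed.

End SubstituteExp.

(** * Substitution of linear forms in exponentials *)

Section LinearForms.
Variable n : nat.
Implicit Types (b : 'I_n -> rat) (l : multinom n).

Definition linform b : mpoly n rat := \sum_(j < n) b j *: mpolyX rat (mnm1 j).

(** The coefficient of [x^l] in the exponential of the linear form with coefficients [b]. *)
Definition expcoef b l : rat := \prod_(j < n) (b j ^+ l j / (l j)`!%:R).

Lemma mderiv_linform b i : mderiv i (linform b) = mpolyC n (b i).
Proof.
rewrite /linform raddf_sum (bigD1 i) //= big1 ?addr0 => [|j ji].
  rewrite mderivZ mderivX mnm1E eqxx scale1r (_ : mnm_sub _ _ = mnm0).
    by rewrite mpolyX0 -mul_mpolyC mulr1.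
  by apply/mnmP => k; rewrite mnmBE mnm0E subnn.
by rewrite mderivZ mderivX mnm1E (negPf ji) scale0r scaler0.
Qed.

Lemma mderiv_linformX b i e :
  mderiv i (linform b ^+ e.+1) = (e.+1%:R * b i) *: linform b ^+ e.
Proof.
elim: e => [|e IH].
  by rewrite expr1 mderiv_linform expr0 mul1r -mul_mpolyC mulr1.
rewrite exprS mderivM IH mderiv_linform mul_mpolyC -scalerAr -exprS -scalerDl.
by congr (_ *: _); rewrite -[e.+2%:R]natr1; ring.
Qed.

(** The multinomial theorem, by induction on [e] through the derivative in a variable that occurs in
    [l]. *)
Lemma mcoeff_linformX b e l : mpoly.mcoeff l (linform b ^+ e) =
  if mpoly.mdeg l == e then e`!%:R * expcoef b l else 0.
Proof.
elim: e l => [|e IH] l.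
  rewrite expr0 mcoeff1 mdeg_eq0; case: eqP => // ->.
  rewrite fact0 mul1r /expcoef big1 // => j _.
  by rewrite mnm0E expr0 fact0 invr1 mulr1.
case: (boolP (mpoly.mdeg l == 0%N)) => [l0|l0].
  move: (l0); rewrite mdeg_eq0 => /eqP ->; rewrite mdeg0 /=.
  rewrite exprS (rmorphM (mcoeff mnm0)) /=.
  rewrite [X in X * _](_ : _ = 0) ?mul0r // /linform raddf_sum big1 // => j _.
  by rewrite [LHS]mcoeffZ mcoeffX mnm1_eq0 mulr0.
have /existsP [i li] : [exists i, l i != 0%N].
  apply: contraR l0; rewrite negb_exists => /forallP h.
  rewrite mdegE big1 // => i _; apply/eqP; move: (h i); by rewrite negbK.
pose m := mnm_sub l (mnm1 i).
have lE : l = mnm_add m (mnm1 i).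
  apply/mnmP => j; rewrite mnmDE mnmBE mnm1E.
  case: eqP => [<-|_]; last by rewrite subn0 addn0.
  by rewrite subnK // lt0n.
have h := mcoeff_mderiv i (linform b ^+ e.+1) m.
rewrite mderiv_linformX mcoeffZ IH -lE in h.
have mi0 : (m i).+1%:R != 0 :> rat by rewrite pnatr_eq0.
have dl : mpoly.mdeg l = (mpoly.mdeg m).+1 by rewrite lE mdegD mdeg1 addn1.
rewrite dl eqSS; move: h; rewrite -[_ *+ (m i).+1]mulr_natr.
case: eqP => em h; last first.
  move: h; rewrite mulr0 => /esym /eqP; rewrite mulf_eq0 (negPf mi0) orbF.
  by move=> /eqP.
apply: (mulIf mi0); rewrite -h -[RHS]mulrA.
have -> : expcoef b l * (m i).+1%:R = b i * expcoef b m.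
  rewrite /expcoef (bigD1 i) //= [in RHS](bigD1 i) //=.
  rewrite (eq_bigr (fun j => b j ^+ m j / (m j)`!%:R)); last first.
    by move=> j ji; rewrite lE mnmDE mnm1E eq_sym (negPf ji) addn0.
  have -> : l i = (m i).+1 by rewrite lE mnmDE mnm1E eqxx addn1.
  rewrite factS natrM exprS.
  have f0 : (m i)`!%:R != 0 :> rat by rewrite pnatr_eq0 -lt0n fact_gt0.
  by field; rewrite f0 /= addrC natr1 mi0.
by rewrite factS natrM; ring.
Qed.

Lemma exp_linform b d :
  \sum_(k : bmultinom n d.+1) expcoef b k *: mpolyX rat k =
  \sum_(e < d.+1) e`!%:R^-1 *: linform b ^+ e.
Proof.
apply/mpolyP => l; rewrite !raddf_sum /=.
under [RHS]eq_bigr do rewrite mcoeffZ mcoeff_linformX.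
under eq_bigr do rewrite mcoeffZ mcoeffX.
case: (ltnP (mpoly.mdeg l) d.+1) => hl.
  rewrite (bigD1 (BMultinom hl)) //= eqxx mulr1 big1 ?addr0 => [|k kl]; last first.
    by move: kl; rewrite bmeqP /= => /negPf ->; rewrite mulr0.
  rewrite (bigD1 (Ordinal hl)) //= eqxx big1 ?addr0 => [|e el]; last first.
    case: (eqVneq (mpoly.mdeg l) e) => [h|_]; rewrite ?mulr0 //.
    by move: el; rewrite -val_eqE /= h eqxx.
  by rewrite mulrA mulVf ?mul1r // pnatr_eq0 -lt0n fact_gt0.
rewrite !big1 // => [e _|k _].
  by case: eqP => [h|]; rewrite ?mulr0 //; move: (ltn_ord e); rewrite -h ltnNge hl.
case: eqP => [h|]; rewrite ?mulr0 //.
by move: (bmdeg k); rewrite h ltnNge hl.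
Qed.

End LinearForms.

Section SubstLinear.
Variables (m r : nat) (L : 'I_m -> mpoly r rat) (t : nat).
Implicit Types (f : ser m) (l : multinom r).

Lemma subst_ext f f' l : (forall k, f k t = f' k t) -> subst_lin f L l t = subst_lin f' L l t.
Proof.
move=> h; rewrite /subst_lin; congr (mpoly.mcoeff _ (comp_mpoly _ _)).
by apply: eq_bigr => k _; rewrite h.
Qed.

Lemma subst_scale c f l : subst_lin (fun k t => c * f k t) L l t = c * subst_lin f L l t.
Proof.
rewrite /subst_lin -mcoeffZ -comp_mpolyZ scaler_sumr.
congr (mpoly.mcoeff _ (comp_mpoly _ _)).
by apply: eq_bigr => k _; rewrite scalerA.
Qed.

Lemma subst_sum I (s : seq I) (P : pred I) (F : I -> ser m) l :
  subst_lin (fun k t => \sum_(i <- s | P i) F i k t) L l t =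
  \sum_(i <- s | P i) subst_lin (F i) L l t.
Proof.
rewrite /subst_lin -!raddf_sum /=; congr (mpoly.mcoeff _ _).
congr (comp_mpoly _ _).
under eq_bigr do rewrite scaler_suml.
by rewrite exchange_big.
Qed.

Variable Lc : 'I_m -> 'I_r -> rat.
Hypothesis LE : forall j, L j = linform (Lc j).

Lemma subst_exp (a : 'I_m -> rat) l :
  subst_lin (fun k _ => expcoef a k) L l t =
  expcoef (fun b => \sum_(j < m) a j * Lc j b) l.
Proof.
rewrite /subst_lin exp_linform.
have c e : mpoly.mcoeff l (comp_mpoly [tuple L j | j < m] (e`!%:R^-1 *: linform a ^+ e)) =
  if mpoly.mdeg l == e then expcoef (fun b => \sum_(j < m) a j * Lc j b) l else 0.
  rewrite comp_mpolyZ rmorphXn /= mcoeffZ.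
  have -> : comp_mpoly [tuple L j | j < m] (linform a) =
            linform (fun b => \sum_(j < m) a j * Lc j b).
    rewrite /linform raddf_sum /=.
    under eq_bigr => j _ do rewrite comp_mpolyZ comp_mpolyXU -tnth_nth tnth_mktuple LE /linform scaler_sumr.
    rewrite exchange_big /=; apply: eq_bigr => b _.
    by rewrite scaler_suml; apply: eq_bigr => j _; rewrite scalerA.
  rewrite mcoeff_linformX; case: eqP => _; rewrite ?mulr0 //.
  by rewrite mulrA mulVf ?mul1r // pnatr_eq0 -lt0n fact_gt0.
rewrite (raddf_sum (comp_mpoly _)) raddf_sum /=.
under eq_bigr do rewrite c.
(* Linear forms preserve the degree, so only the top term of the truncated exponential reaches
   [x^l]. *)
rewrite (bigD1 ord_max) //= eqxx big1 ?addr0 // => e he.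
case: (eqVneq (mpoly.mdeg l) e) => // h.
by case/eqP: he; apply: val_inj; exact: esym h.
Qed.

End SubstLinear.

(** * The coefficients of [g_sh] *)

(** With each [u_j] repeated [i_j] times, the exponential in a term of [h] is that of the linear
    form with these coefficients. *)
Definition flat (us is_ : seq nat) : seq nat := flatten [seq nseq p.2 p.1 | p <- zip us is_].

Definition Wrat t (us is_ : seq nat) : rat :=
  (\prod_(i <- is_) i`!%:R)^-1 * (\prod_(p <- zip us is_) qgeom t p.1 ^+ p.2)`_t.

Lemma nth_flat us is_ a : size us = size is_ ->
  nth 0%N (flat us is_) a =
  (\sum_(j < size is_ | \sum_(l < size is_ | l < j) nth 0 is_ l <= a
       < \sum_(l < size is_ | l <= j) nth 0 is_ l) nth 0 us j)%N.
Proof.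
elim: is_ us a => [|i is_ IH] [|u us] a //= sz.
  by rewrite big_ord0 nth_nil.
case: sz => sz; rewrite /flat /= -/(flat us is_) nth_cat size_nseq nth_nseq.
rewrite big_mkcond big_ord_recl /=.
have s1 (j : nat) : (\sum_(l < (size is_).+1 | (l < j.+1)%N) nth 0 (i :: is_) l =
            i + \sum_(l < size is_ | (l < j)%N) nth 0 is_ l)%N.
  by rewrite big_mkcond big_ord_recl /= [in RHS]big_mkcond.
rewrite [X in if (X <= _ < _)%N then _ else _](_ : _ = 0%N); last first.
  by rewrite big_pred0.
have s1' (j : nat) : (\sum_(l < (size is_).+1 | (l <= j.+1)%N) nth 0 (i :: is_) l =
            i + \sum_(l < size is_ | (l <= j)%N) nth 0 is_ l)%N.
  by rewrite big_mkcond big_ord_recl /= [in RHS]big_mkcond.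
have -> : (\sum_(l < (size is_).+1 | (l <= 0)%N) nth 0 (i :: is_) l = i)%N.
  by rewrite big_mkcond big_ord_recl /= big1 // addn0.
case: ltnP => hi /=.
  rewrite [X in (_ + X)%N]big1 ?addn0 // => j _.
  rewrite /bump leq0n add1n s1.
  by case: ifP => // /andP[h _]; move: h hi; lia.
rewrite add0n IH // big_mkcond; apply: eq_bigr => j _.
rewrite /bump leq0n add1n s1 s1'.
have -> // : forall x y : nat, (x <= a - i < y)%N = (i + x <= a < i + y)%N by move=> x y; lia.
Qed.

Lemma hserE r k t : @hser r k t =
  \sum_(m < r.+1) \sum_(is_ <- comps m r) \sum_(us <- subs m (iota 1 t))
    Wrat t us is_ * expcoef (fun a : 'I_r => (nth 0%N (flat us is_) a)%:R) k.
Proof.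
apply: eq_bigr => m _.
rewrite -(sum_composition r m (fun is_ => \sum_(us <- subs m (iota 1 t)) Wrat t us is_ *
  expcoef (fun a : 'I_r => (nth 0%N (flat us is_) a)%:R) k)).
apply: eq_bigr => i _.
set is_ := [seq (i j : nat) | j : 'I_m].
have sz : size is_ = m by rewrite size_map -cardE card_ord.
have ni (j : 'I_m) : nth 0%N is_ j = i j.
  by rewrite (nth_map j) ?size_enum_ord // nth_ord_enum.
rewrite -(sum_incr m t (fun us => Wrat t us is_ *
  expcoef (fun a : 'I_r => (nth 0%N (flat us is_) a)%:R) k)).
pose Lc (j : 'I_m) (a : 'I_r) : rat :=
  ((\sum_(l < m | l < j) i l <= a < \sum_(l < m | l <= j) i l)%N)%:R.
have LE j : yform i j = linform (Lc j).
  rewrite /yform /linform big_mkcond; apply: eq_bigr => a _.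
  by rewrite /Lc; case: ifP => _; rewrite ?scale1r ?scale0r.
pose F (u : {ffun 'I_m -> 'I_t.+1}) : ser m := fun k t' =>
  (\prod_(j < m) qgeom t (u j) ^+ i j)`_t * expcoef (fun j => (u j)%:R) k.
rewrite (@subst_ext m r (yform i) t _ (fun k t' => \sum_(u : {ffun 'I_m -> 'I_t.+1} | incr u) F u k t') k); last first.
  move=> k'; rewrite /Hser; apply: eq_bigr => u _.
  by rewrite mulrC.
rewrite subst_sum mulr_sumr; apply: eq_bigr => u _.
set us := [seq (u j : nat) | j : 'I_m].
have szu : size us = m by rewrite size_map -cardE card_ord.
have nu (j : 'I_m) : nth 0%N us j = u j.
  by rewrite (nth_map j) ?size_enum_ord // nth_ord_enum.
rewrite /F subst_scale (subst_exp _ LE) mulrA; congr (_ * _).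
  rewrite /Wrat /is_ big_map big_enum; congr (_ * _`_ _).
  have -> : zip us [seq (i j : nat) | j : 'I_m] = [seq (u j : nat, i j : nat) | j : 'I_m].
    by rewrite /us /image_mem; elim: (enum _) => //= j s ->.
  by rewrite big_map big_enum.
apply: eq_bigr => a _; congr (_ ^+ _ / _).
rewrite nth_flat ?sz // natr_sum [RHS]big_mkcond; apply: eq_bigr => j _.
rewrite /Lc nu.
have -> : (\sum_(l < m | (l < j)%N) nth 0 is_ l)%N = (\sum_(l < m | (l < j)%N) i l)%N.
  by apply: eq_bigr => l _; rewrite ni.
have -> : (\sum_(l < m | (l <= j)%N) nth 0 is_ l)%N = (\sum_(l < m | (l <= j)%N) i l)%N.
  by apply: eq_bigr => l _; rewrite ni.
by case: ifP => _; rewrite ?mulr1 ?mulr0.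
Qed.

(** The arguments [x_r - x_(r-1), ..., x_1] reverse the variables and turn the coefficients into
    differences of neighbours; listing the [u_j] in decreasing order absorbs the reversal. *)
Lemma gserE r l t : @gser r l t =
  \sum_(m < r.+1) \sum_(us <- subs m (rev (iota 1 t))) \sum_(is_ <- comps m r)
    Wrat t us is_ *
    expcoef (fun b : 'I_r => (nth 0%N (flat us is_) b)%:R - (nth 0%N (flat us is_) b.+1)%:R) l.
Proof.
pose Fh : ser r := fun k _ => \sum_(m < r.+1) \sum_(is_ <- comps m r) \sum_(us <- subs m (iota 1 t))
    Wrat t us is_ * expcoef (fun a : 'I_r => (nth 0%N (flat us is_) a)%:R) k.
rewrite /gser (@subst_ext r r (@gform r) t _ Fh l); last by move=> k; exact: hserE.
rewrite /Fh subst_sum; apply: eq_bigr => m _.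
rewrite subst_sum.
under eq_bigr do rewrite subst_sum.
rewrite (perm_big _ (perm_comps_rev m r)) big_map /=.
under eq_bigr do rewrite (perm_big _ (perm_subs_rev m (iota_uniq 1 t))) big_map /=.
rewrite exchange_big /= big_seq [RHS]big_seq; apply: eq_bigr => us.
rewrite mem_subs => /andP[/eqP szu _].
rewrite big_seq [RHS]big_seq; apply: eq_bigr => is_.
rewrite mem_comps => /and3P[/eqP szi _ /eqP sumi].
pose Lc (a b : 'I_r) : rat := ((a + b).+1 == r)%N%:R - ((a + b).+2 == r)%N%:R.
have LE a : gform a = linform (Lc a).
  rewrite /gform /linform big_mkcond [X in _ - X]big_mkcond -sumrB.
  apply: eq_bigr => b _; rewrite /Lc scalerBl.
  by congr (_ - _); case: ifP => _; rewrite ?scale1r ?scale0r.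
rewrite subst_scale (subst_exp _ LE); congr (_ * _).
  rewrite /Wrat -rev_zip ?szu ?szi // !(perm_big _ (permEl (perm_rev _))) //=.
have flat_rev : flat (rev us) (rev is_) = rev (flat us is_).
  rewrite /flat -rev_zip ?szu ?szi // map_rev rev_flatten; congr flatten.
  congr rev; rewrite -map_comp; apply: eq_map => p /=.
  by rewrite rev_nseq.
have szf : size (flat us is_) = r.
  rewrite /flat size_flatten /shape -map_comp.
  rewrite (eq_map (g := snd)); last by move=> p /=; rewrite size_nseq.
  by rewrite -/(unzip2 _) unzip2_zip ?szu ?szi.
have nr (a : nat) : (a < r)%N -> nth 0%N (flat (rev us) (rev is_)) a = nth 0%N (flat us is_) (r - a.+1).
  by move=> ha; rewrite flat_rev nth_rev szf.
apply: eq_bigr => b _; congr (_ ^+ _ / _).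
under eq_bigr do rewrite /Lc mulrBr.
rewrite sumrB; congr (_ - _).
  have hb : (r - b.+1 < r)%N by have := ltn_ord b; lia.
  rewrite (bigD1 (Ordinal hb)) //= big1 ?addr0 => [|a ab].
    rewrite nr // (_ : ((r - b.+1 + b).+1 == r)%N = true); last by apply/eqP; have := ltn_ord b; lia.
    by rewrite mulr1; congr (nth _ _ _)%:R; have := ltn_ord b; lia.
  rewrite (_ : ((a + b).+1 == r)%N = false) ?mulr0 //.
  by apply/negP => /eqP h; case/eqP: ab; apply: val_inj => /=; lia.
case: (ltnP b.+1 r) => hb1.
  have hb : (r - b.+2 < r)%N by lia.
  rewrite (bigD1 (Ordinal hb)) //= big1 ?addr0 => [|a ab].
    rewrite nr // (_ : ((r - b.+2 + b).+2 == r)%N = true); last by apply/eqP; lia.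
    by rewrite mulr1; congr (nth _ _ _)%:R; lia.
  rewrite (_ : ((a + b).+2 == r)%N = false) ?mulr0 //.
  by apply/negP => /eqP h; case/eqP: ab; apply: val_inj => /=; lia.
(* The last variable has no right neighbour; the default value 0 stands for it. *)
rewrite (nth_default _ (s := flat us is_)) ?szf // big1 // => a _.
rewrite (_ : ((a + b).+2 == r)%N = false) ?mulr0 //.
by apply/negP => /eqP; have := ltn_ord a; lia.
Qed.

(** * The generating series of the [q]-series [g^sh] *)

Section QuotientCoef.
Variables (K : fieldType) (t : nat).

(** Power series modulo [q^(t+1)]; the same ring serves later for truncated Taylor expansions at a
    pole. *)
Definition tq : comNzRingType := {poly %/ ('X^(t.+1) : {poly K})}.

Definition tin : {rmorphism {poly K} -> tq} := in_qpoly ('X^(t.+1) : {poly K}).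
Definition tconst : {rmorphism K -> tq} := tin \o polyC.
Definition tcf (s : nat) (x : tq) : K :=
  (@qpoly.polyn K (size (mk_monic ('X^(t.+1) : {poly K}))).-1 x)`_s.

Lemma mk_monicXn : mk_monic ('X^(t.+1) : {poly K}) = 'X^(t.+1).
Proof. by rewrite /mk_monic size_polyXn monicXn. Qed.

Lemma tcf_tin s p : (s <= t)%N -> tcf s (tin p) = p`_s.
Proof.
move=> st; rewrite /tcf /=.
have := Pdiv.RingMonic.rdivp_eq (monicXn K t.+1) p.
rewrite mk_monicXn => {2}->; rewrite coefD coefMXn ltnS st add0r //.
Qed.

Lemma tinX : tin 'X ^+ t.+1 = 0.
Proof.
rewrite -rmorphXn /=; apply: val_inj => /=.
by rewrite mk_monicXn (Pdiv.RingMonic.rmodpp (monicXn K t.+1)).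
Qed.

Lemma tin_polyn (x : tq) : x = tin (@qpoly.polyn K (size (mk_monic ('X^(t.+1) : {poly K}))).-1 x).
Proof.
apply: val_inj => /=; rewrite Pdiv.CommonRing.rmodp_small //.
have sz : size (mk_monic ('X^(t.+1) : {poly K})) = t.+2 by rewrite mk_monicXn size_polyXn.
by apply: (leq_ltn_trans (@size_npoly K _ x)); rewrite sz.
Qed.

Lemma tcfD s : {morph tcf s : x y / x + y}.
Proof. by move=> x y; rewrite /tcf -coefD. Qed.

Lemma tcfZ s a x : (s <= t)%N -> tcf s (tconst a * x) = a * tcf s x.
Proof.
move=> st; rewrite [x in LHS]tin_polyn /tconst /= -(rmorphM tin) tcf_tin //.
by rewrite coefCM.
Qed.

End QuotientCoef.

Section Evaluation.
Variables (K : numFieldType) (C : comNzRingType) (iota : {rmorphism K -> C}).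
Variables (q c : C) (t : nat) (x : C).
Let lam u := c * \sum_(1 <= l < t.+1) q ^+ (u * l).
Local Notation E y := (exs iota false 0 y).
Local Notation e1 := (lett true : ncs bool C).
Local Notation fi k := (iota (k`!%:R^-1)).

Definition ev (f : ncs bool C) (k : nat) (n : seq nat) : C := f (nseq k false ++ nword n).

Lemma ev_nil y (f : ncs bool C) k : ev (E y * (e1 * f)) k [::] = 0.
Proof.
rewrite /ev (@mul_zeros _ _ _ k) => [|v]; last by rewrite lettM_ne.
by rewrite ncsM_nil lettM_nil mulr0.
Qed.

Lemma ev_cons y (f : ncs bool C) k p n :
  ev (E y * (e1 * f)) k (p :: n) = fi k * y ^+ k * ev f p.-1 n.
Proof.
rewrite /ev (@mul_zeros _ _ _ k) => [|v]; last by rewrite lettM_ne.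
rewrite -[nword (p :: n)]/(true :: (nseq p.-1 false ++ nword n)).
rewrite ncsM_cons lettM_eq cats0 [X in _ + X]conv0l ?addr0 => [|v].
  by rewrite /exs all_nseq orbT size_nseq addn0.
by rewrite /de /exs all_cat /= andbF.
Qed.

Lemma evD f g k n : ev (f + g) k n = ev f k n + ev g k n. Proof. by []. Qed.
Lemma evZ a f k n : ev (a *: f) k n = a * ev f k n. Proof. by []. Qed.

(** Sorted by the number [i] of further letters [1] taken from the exponential; [j] counts those
    taken before, for the induction. *)
Lemma ev_exp n j k y (l : C) (f : ncs bool C) :
  ev (E y * (exs iota true j l * f)) k n =
  \sum_(i < (size n).+1) fi (i + j)%N * l ^+ (i + j) * ev (E y * (e1 ^+ i * f)) k n.
Proof.
elim: n j k y => [|p n IH] j k y.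
  rewrite big_ord1 expr0 mul1r add0n (exs_rec iota true) mulrDl -scalerAl mul1r mulrDr -scalerAr.
  by rewrite evD evZ -mulrA ev_nil addr0 exs_nil.
rewrite big_ord_recl expr0 mul1r (exs_rec iota true) mulrDl -scalerAl mul1r mulrDr -scalerAr.
rewrite evD evZ exs_nil; congr (_ + _).
rewrite -mulrA ev_cons.
have := IH j.+1 p.-1 0; rewrite exs_x0 mul1r => ->.
rewrite mulr_sumr; apply: eq_bigr => i _; rewrite /= /bump add1n addSnnS.
by rewrite mul1r [e1 ^+ _.+1]exprS -[e1 * _ * f]mulrA ev_cons mulrCA !mulrA.
Qed.

(** The letters [1] are taken from the factors listed in [al]. Between letters taken from [a] and
    [a'], the exponentials combine to [e^((a - a') x e_0)], which produces the run of zeros. *)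
Fixpoint clo (p : K) (k : nat) (al n : seq nat) : C :=
  match al, n with
  | [::], [::] => fi k * (iota p * x) ^+ k
  | a :: al', b :: n' => fi k * (iota (p - a%:R) * x) ^+ k * clo a%:R b.-1 al' n'
  | _, _ => 0
  end.

Fixpoint Tsum (us : seq nat) (r : nat) (F : seq nat -> C) : C :=
  if us is u :: us' then
    \sum_(i < r.+1) fi i * lam u ^+ i * Tsum us' (r - i) (fun al => F (nseq i u ++ al))
  else if r == 0%N then F [::] else 0.

Lemma TsumM us r a F : Tsum us r (fun al => a * F al) = a * Tsum us r F.
Proof.
elim: us r F => [|u us IH] r F /=; first by case: ifP; rewrite ?mulr0.
by rewrite mulr_sumr; apply: eq_bigr => i _; rewrite IH mulrCA.
Qed.

Lemma ev_Pprod m p k n :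
  ev (E (iota p * x) * Pprod iota q c t x m) k n =
  Tsum (rev (seq.iota 1 m)) (size n) (fun al => clo p k al n).
Proof.
elim: m p k n => [|m IH] p k n.
  rewrite /= mulr1 /ev /exs; case: n => [|b n] /=.
    by rewrite cats0 all_nseq orbT size_nseq addn0.
  by rewrite all_cat /= andbF.
rewrite -[m.+1]addn1 seq.iotaD rev_cat /= add1n addn1.
have -> : E (iota p * x) * (E (- (m.+1%:R * x)) * exs iota true 0 (c * \sum_(1 <= l < t.+1) q ^+ (m.+1 * l))
     * E (m.+1%:R * x) * Pprod iota q c t x m) =
   E (iota (p - m.+1%:R) * x) * (exs iota true 0 (lam m.+1) * (E (m.+1%:R * x) * Pprod iota q c t x m)).
  rewrite !mulrA -exsD; congr (exs _ _ _ _ * _ * _ * _).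
  by rewrite rmorphB rmorph_nat mulrBl.
rewrite ev_exp; apply: eq_bigr => i _; rewrite addn0; congr (_ * _).
move: (ltn_ord i); rewrite ltnS; move: (nat_of_ord i) => j {i}.
elim: j p k n => [|j IHj] p k n.
  move=> _; rewrite expr0 mul1r mulrA -exsD subn0 -IH.
  by congr (ev (exs _ _ _ _ * _) _ _); rewrite rmorphB rmorph_nat -mulrDl subrK.
case: n => // b n hj; rewrite exprS -mulrA ev_cons /= TsumM; congr (_ * _).
have := IHj m.+1%:R b.-1 n hj.
by rewrite subrr rmorph0 mul0r exs_x0 mul1r.
Qed.

Definition Wc (us is_ : seq nat) : C := \prod_(p <- zip us is_) (fi p.2 * lam p.1 ^+ p.2).

(** Factors that yield no letter are dropped: the others form a subsequence of [us], and their
    multiplicities a composition of [r]. *)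
Lemma Tsum_subs M us r F : (r < M)%N ->
  Tsum us r F =
  \sum_(m < M) \sum_(s <- subs m us) \sum_(is_ <- comps m r) Wc s is_ * F (flat s is_).
Proof.
elim: us M r F => [|u us IH] M r F hM.
  case: M hM => // M hM; rewrite big_ord_recl [X in _ + X]big1 ?addr0 => [|m _]; last by rewrite lift0 /= big_nil.
  rewrite big_seq1 /=; case: ifP => _; rewrite ?big_nil // big_seq1.
  by rewrite /Wc big_nil mul1r.
case: M hM => // M hM.
have wide : forall m, subs m.+1 (u :: us) = [seq u :: s | s <- subs m us] ++ subs m.+1 us by [].
rewrite big_ord_recl.
under [X in _ = _ + X]eq_bigr => m _.
  rewrite /= /bump add1n big_cat /= big_map addrC; over.
rewrite big_split /= addrA.
have -> : \sum_(s <- subs 0 (u :: us)) \sum_(is_ <- comps 0 r) Wc s is_ * F (flat s is_)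
   = \sum_(s <- subs 0 us) \sum_(is_ <- comps 0 r) Wc s is_ * F (flat s is_).
  by case: (us).
rewrite big_ord_recl fact0 invr1 rmorph1 mul1r expr0 mul1r subn0 /=.
have -> : Tsum us r (fun al => F al) = Tsum us r F by [].
rewrite (IH M.+1 r F hM) big_ord_recl; congr (_ + _).
transitivity (\sum_(1 <= i < r.+1) fi i * lam u ^+ i * Tsum us (r - i) (fun al => F (nseq i u ++ al))).
  by rewrite big_add1 /= big_mkord.
rewrite big_nat.
under eq_bigr => i hi.
  rewrite (IH M); last by move: hi hM; lia.
  rewrite mulr_sumr; under eq_bigr => m _ do rewrite mulr_sumr.
  over.
rewrite -big_nat exchange_big /=; apply: eq_bigr => m _.
rewrite exchange_big /=; apply: eq_bigr => s _.
rewrite big_flatten big_map /index_iota subn1 /=.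
apply: eq_bigr => i _; rewrite big_map mulr_sumr; apply: eq_bigr => is_ _.
by rewrite /Wc /= big_cons /= !mulrA.
Qed.

(** After the last letter [1], only the exponential of its own factor is left; this agrees with the
    default value 0 of [nth]. *)
Lemma clo_prod p k al n : size al = size n ->
  clo p k al n = fi k * (iota (p - (nth 0%N al 0)%:R) * x) ^+ k *
   \prod_(b < size n) (fi (nth 0%N n b).-1 *
     (iota ((nth 0%N al b)%:R - (nth 0%N al b.+1)%:R) * x) ^+ (nth 0%N n b).-1).
Proof.
elim: n p k al => [|b n IH] p k [|a al] //= sz; first by rewrite big_ord0 subr0 mulr1.
rewrite big_ord_recl /= (IH _ _ _ (eq_add_S _ _ sz)) -!mulrA; congr (_ * (_ * (_ * (_ * _)))).
Qed.

(** In each factor the linear terms of the two exponentials of [e0] cancel. This matches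
    [Iint_001]. *)
Lemma Pprod_letter0 n : Pprod iota q c t x n [:: false] = 0.
Proof.
have m1 (f g : ncs bool C) a : (f * g) [:: a] = f [::] * g [:: a] + f [:: a] * g [::].
  by rewrite ncsM_cons.
have Pn m : Pprod iota q c t x m [::] = 1.
  by elim: m => //= m IH; rewrite !ncsM_nil IH !exs0_nil !mulr1.
elim: n => [|n IH] //=.
rewrite !m1 IH !ncsM_nil !exs0_nil !mul1r Pn ?mulr0 add0r !mulr1 /exs /= !expr1.
by rewrite (_ : (1 + 0)`! = 1%N) // invr1 rmorph1 !mul1r add0r addrN.
Qed.

End Evaluation.

Section GshSeries.
Variables (R : realType) (t : nat).
Local Notation K := (R[i] : numFieldType).
Definition cpi : R[i] := (0 +i* (- (2 * pi)))%C.
Local Notation C := (tq K t).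
Local Notation iota := (tconst K t).

Definition Pt : ncs bool C := Pprod iota (tin K t 'X) (iota cpi) t (iota cpi) t.

(** Each letter [1] of the word brings the factor [c] of a [lam u], and each zero a factor [c] from
    an exponential; together they give the normalisation [c^(n_1 + ... + n_r)]. *)
Lemma g_sh_Pt n : is_index n -> g_sh R n t = tcf t (Pt (nword n)).
Proof.
move=> hn; rewrite /g_sh -/cpi gserE.
have -> : Pt (nword n) = ev (exs iota false 0 (iota 0 * iota cpi) * Pt) 0 n.
  by rewrite rmorph0 mul0r exs_x0 mul1r.
rewrite ev_Pprod.
erewrite Tsum_subs; last exact: (ltnSn (size n)).
have tcf_sum (I : Type) (r : seq I) (F : I -> C) : tcf t (\sum_(i <- r) F i) = \sum_(i <- r) tcf t (F i).
  elim/big_rec2: _ => [|i y1 y2 _ <-]; last by rewrite tcfD.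
  by rewrite /tcf coef0.
rewrite tcf_sum rmorph_sum !mulr_sumr; apply: eq_bigr => m _.
rewrite tcf_sum rmorph_sum !mulr_sumr big_seq [RHS]big_seq; apply: eq_bigr => us.
rewrite mem_subs => /andP[/eqP szu _].
rewrite tcf_sum rmorph_sum !mulr_sumr big_seq [RHS]big_seq; apply: eq_bigr => is_.
rewrite mem_comps => /and3P[/eqP szi _ /eqP sumi].
have szf : size (flat us is_) = size n.
  rewrite /flat size_flatten /shape -map_comp.
  rewrite (eq_map (g := snd)); last by move=> p /=; rewrite size_nseq.
  by rewrite -/(unzip2 _) unzip2_zip ?szu ?szi.
rewrite clo_prod // fact0 invr1 rmorph1 expr0 !mul1r.
have prodE : \prod_(b < size n)
     (iota ((nth 0%N n b).-1`!%:R^-1) *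
      (iota ((nth 0%N (flat us is_) b)%:R - (nth 0%N (flat us is_) b.+1)%:R) * iota cpi) ^+ (nth 0%N n b).-1) =
   iota (cpi ^+ (\sum_(k <- n) k.-1)%N * ratr (expcoef (fun b : 'I_(size n) =>
      (nth 0%N (flat us is_) b)%:R - (nth 0%N (flat us is_) b.+1)%:R)
      (Multinom [tuple (nth 0%N n j).-1 | j < size n]))).
  rewrite (big_nth 0%N) big_mkord -prodrXr /expcoef (rmorph_prod (ratr : rat -> R[i])) -big_split (rmorph_prod iota).
  apply: eq_bigr => b _; rewrite -(rmorphM iota) -(rmorphXn iota) -(rmorphM iota); congr (iota _).
  rewrite /= (rmorphM (ratr : rat -> R[i])) (fmorphV (ratr : rat -> R[i])) (rmorphXn (ratr : rat -> R[i])) (rmorphB (ratr : rat -> R[i])) /= !ratr_nat.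
  have -> : fun_of_multinom (Multinom [tuple (nth 0%N n j).-1 | j < size n]) b = (nth 0%N n b).-1.
    by rewrite /fun_of_multinom tnth_mktuple.
  by rewrite exprMn; ring.
have WE : Wc iota (tin K t 'X) (iota cpi) t us is_ =
   iota (cpi ^+ size n * ratr ((\prod_(i <- is_) i`!%:R)^-1)) *
   tin K t (map_poly ratr (\prod_(p <- zip us is_) qgeom t p.1 ^+ p.2)).
  pose tn := tin K t; pose io := iota.
  pose MP : {rmorphism {poly rat} -> {poly R[i]}} := map_poly (ratr : rat -> R[i]).
  rewrite -[map_poly _ _]/(MP _) -/tn -/io.
  transitivity ((\prod_(p <- zip us is_) io (p.2`!%:R^-1)) * \prod_(p <- zip us is_)
     ((io cpi * \sum_(1 <= l < t.+1) tn 'X ^+ (p.1 * l)) ^+ p.2)); first by rewrite -big_split.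
  rewrite (rmorphM io) [X in _ = X * _]mulrC -[RHS]mulrA; congr (_ * _).
    rewrite -(rmorph_prod io) (fmorphV (ratr : rat -> R[i])) (rmorph_prod (ratr : rat -> R[i])).
    congr (io _); rewrite prodfV; congr (_^-1).
    rewrite -[is_ in RHS](unzip2_zip (s := us)) ?szu ?szi // big_map.
    by apply: eq_bigr => p _; rewrite /= ratr_nat.
  rewrite (rmorph_prod MP) (rmorph_prod tn).
  have -> : io (cpi ^+ size n) = \prod_(p <- zip us is_) io cpi ^+ p.2.
    rewrite (rmorphXn io) prodrXr; congr (_ ^+ _).
    by rewrite -sumi sumnE -[is_ in LHS](unzip2_zip (s := us)) ?szu ?szi // big_map.
  rewrite -big_split; apply: eq_bigr => p _.
  rewrite exprMn; congr (_ * _).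
  rewrite (rmorphXn MP) (rmorphXn tn); congr (_ ^+ _).
  rewrite /qgeom (rmorph_sum MP) (rmorph_sum tn); apply: eq_bigr => d _.
  by rewrite -(rmorphXn tn); congr (tn _); rewrite /MP /= map_polyXn.
rewrite WE prodE [X in tcf t X](_ : _ = iota (cpi ^+ size n * ratr (\prod_(i <- is_) i`!%:R)^-1 *
    (cpi ^+ (\sum_(k <- n) k.-1)%N * ratr (expcoef (fun b : 'I_(size n) =>
      (nth 0%N (flat us is_) b)%:R - (nth 0%N (flat us is_) b.+1)%:R)
      (Multinom [tuple (nth 0%N n j).-1 | j < size n])))) *
   tin K t (map_poly ratr (\prod_(p <- zip us is_) qgeom t p.1 ^+ p.2))); last first.
  by rewrite !rmorphM; ring.
rewrite tcfZ // tcf_tin // coef_map /Wrat !rmorphM /=; ring.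
Qed.

Lemma Pt_grouplike : grouplike (fun _ _ => [::]) Pt.
Proof. exact: Pprod_grouplike. Qed.

Lemma Pt_0 : Pt [:: false] = 0.
Proof.
exact: Pprod_letter0.
Qed.

Variables (g : {linear I1 -> (nat -> R[i]^o) | ratr \; *:%R}).
Hypothesis g_words : forall n : seq nat, is_index n -> g (Iw n) = g_sh R n.

(** On the words [nword n] this is [g_sh_Pt]. Both sides obey the same recursion on the number of
    leading zeros, since [I(0; 0; 1)] and [Pt [:: false]] both vanish. *)
Lemma g_Pt v : g (Iint false v true) t = tcf t (Pt v).
Proof.
have iK k : iota (k.+1%:R^-1) * k.+1%:R = 1.
  by rewrite -(rmorph_nat iota) -rmorphM mulVf ?rmorph1 // pnatr_eq0.
have gsum (I : Type) (r : seq I) (F : I -> I1) : g (\sum_(i <- r) F i) t = \sum_(i <- r) g (F i) t.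
  by elim/big_rec2: _ => [|i y1 y2 _ <-]; rewrite ?linear0 ?linearD.
have tsum (I : Type) (r : seq I) (F : I -> C) : tcf t (\sum_(i <- r) F i) = \sum_(i <- r) tcf t (F i).
  elim/big_rec2: _ => [|i y1 y2 _ <-]; last by rewrite tcfD.
  by rewrite /tcf coef0.
elim/zeros_ind: v => [k|w /head_nword[n hn ->]|k w IH].
- rewrite Iint_all_zeros linear0.
  have := grouplikeE [:: false] (nseq k false) Pt_grouplike.
  rewrite -/(qsh0 _ _) (qsh0_all_zeros Pt) Pt_0 mul0r -mulr_natr => h.
  have -> : Pt (nseq k.+1 false) = 0 by rewrite -[LHS]mul1r -(iK k) -mulrA [_%:R * _]mulrC h mulr0.
  by rewrite /tcf coef0.
- by rewrite -/(Iw n) g_words // g_sh_Pt.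
have := grouplikeE [:: false] (nseq k false ++ true :: w) Pt_grouplike.
rewrite -/(qsh0 _ _) (qsh0_zeros Pt) Pt_0 mul0r => /eqP; rewrite addr_eq0 => /eqP h.
have -> : Pt (nseq k.+1 false ++ true :: w) =
    iota (- k.+1%:R^-1) * \sum_(v <- qsh0 [:: false] w) Pt (nseq k false ++ true :: v).
  rewrite rmorphN mulNr -mulrN -h -[Pt _ *+ _]mulr_natl mulrA iK mul1r //.
rewrite tcfZ // tsum Iint_zeros_solve linearZ -[LHS]/(ratr (- k.+1%:R^-1) *
  g (\sum_(v <- qsh0 [:: false] w) Iint false (nseq k false ++ true :: v) true) t) gsum.
have -> : \sum_(v <- qsh0 [:: false] w) g (Iint false (nseq k false ++ true :: v) true) t =
  \sum_(v <- qsh0 [:: false] w) tcf t (Pt (nseq k false ++ true :: v)).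
  by apply: eq_bigr => v _; exact: IH.
congr (_ * _).
by rewrite rmorphN /= fmorphV /= ratr_nat.
Qed.

End GshSeries.

(** * Ordered sums of inverse powers and their partial fractions *)

Notation harm_merge := (fun a b : nat => [:: (a + b).+2]) (only parsing).

Section OrderedSums.
Variable A : comNzRingType.

Definition fac (y : A) : ncs nat A := fun m =>
  match m with [::] => 1 | [:: a] => y ^+ a.+2 | _ => 0 end.

(** At a word [a_1 ... a_r]: the sum of the products of [y_j ^+ (a_j + 2)] over the
    subsequences [y_1, ..., y_r] of [s]. *)
Definition hs (s : seq A) : ncs nat A := \prod_(y <- s) fac y.

Lemma facM_nil y f : (fac y * f) [::] = f [::].
Proof. by rewrite ncsM_nil mul1r. Qed.

Lemma facM_cons y f a m : (fac y * f) (a :: m) = f (a :: m) + y ^+ a.+2 * f m.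
Proof.
rewrite ncsM_cons mul1r; congr (_ + _).
have -> : de a (fac y) = csc (y ^+ a.+2) by apply/funext => -[|b [|c w]].
by rewrite cscM.
Qed.

Lemma hs_nil s : hs s [::] = 1.
Proof.
elim: s => [|y s IH]; first by rewrite /hs big_nil.
by rewrite /hs big_cons facM_nil.
Qed.

Lemma hs0 m : hs [::] m = if m is [::] then 1 else 0.
Proof. by rewrite /hs big_nil. Qed.

Lemma hs_cons y s a m : hs (y :: s) (a :: m) = hs s (a :: m) + y ^+ a.+2 * hs s m.
Proof. by rewrite /hs big_cons facM_cons. Qed.

(** Only words of length at most one count, so for single letters everything reduces to the merged
    one: [y^(a+2) y^(b+2) = y^((a + b).+2 + 2)]. *)
Lemma fac_grouplike y : grouplike harm_merge (fac y).
Proof.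
apply/funext => u; apply/funext => v; rewrite /tns.
case: u => [|a u]; first by rewrite dl_nil_l mul1r.
case: v => [|b v]; first by rewrite dl_nil_r mulr1.
have z (n : nat) (x : A) (u' v' : seq nat) : (0 < size u' + size v')%N ->
    dl harm_merge (csc x : ncs nat A) u' v' = 0.
  have d0 u1 v1 : dl harm_merge (0 : ncs nat A) u1 v1 = 0 by rewrite /dl big1.
  case: u' v' => [|c u'] [|d v'] //= _; rewrite ?dl_nil_l ?dl_nil_r //.
  by rewrite dl_cons big_seq1 !d0 !addr0.
have dE c : de c (fac y) = csc (y ^+ c.+2) by apply/funext => -[|? [|? ?]].
rewrite dl_cons big_seq1 !dE.
rewrite (z 0%N _ u (b :: v)); last by rewrite /= addnS.
rewrite (z 0%N _ (a :: u) v) // add0r add0r.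
case: u => [|? u]; case: v => [|? v]; first by rewrite dl_nil_l /= -exprD; congr (_ ^+ _); lia.
all: by rewrite z //= ?mul0r ?mulr0.
Qed.

Lemma hs_grouplike s : grouplike harm_merge (hs s).
Proof. by apply: grouplike_prod => y; exact: fac_grouplike. Qed.

Lemma hs_cat s1 s2 : hs (s1 ++ s2) = hs s1 * hs s2.
Proof. by rewrite /hs big_cat. Qed.

Lemma hs_rcons s y a m : hs (rcons s y) (rcons m a) = hs s (rcons m a) + hs s m * y ^+ a.+2.
Proof.
have step (f : ncs nat A) : (f * fac y) (rcons m a) = f (rcons m a) + f m * y ^+ a.+2.
  elim: m f => [|b m IH] f.
    by rewrite /= ncsM_cons ncsM_nil mulr1 /= addrC.
  rewrite rcons_cons ncsM_cons IH /de /=.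
  by case: m {IH} => [|? ?]; rewrite /= mulr0 add0r.
by rewrite -cats1 hs_cat /hs big_seq1 step.
Qed.

Lemma hs_rev s m : hs (rev s) (rev m) = hs s m.
Proof.
elim: s m => [|y s IH] m; first by case/lastP: m => [|m a] //; rewrite rev_rcons !hs0; case: m.
case: m => [|a m]; first by rewrite !hs_nil.
by rewrite !rev_cons hs_rcons -rev_cons !IH hs_cons mulrC.
Qed.

End OrderedSums.

Section SplitSums.
Variables (A : nmodType).

(** The sum over the ways to split [l] at one of its items. *)
Fixpoint ssum (T : Type) (l : seq T) (F : seq T -> T -> seq T -> A) : A :=
  if l is a :: l' then F [::] a l' + ssum l' (fun p => F (a :: p)) else 0.

Lemma eq_ssum T (l : seq T) F G : (forall p a r, l = p ++ a :: r -> F p a r = G p a r) ->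
  ssum l F = ssum l G.
Proof.
elim: l F G => [|a l IH] F G h //=; congr (_ + _); first exact: h.
by apply: IH => p b r e; apply: h; rewrite e.
Qed.

Lemma ssumD T (l : seq T) F G :
  ssum l (fun p a r => F p a r + G p a r) = ssum l F + ssum l G.
Proof.
elim: l F G => [|a l IH] F G /=; first by rewrite addr0.
by rewrite IH addrACA.
Qed.

Lemma ssum_zero T (l : seq T) : ssum l (fun _ _ _ => 0) = 0.
Proof. by elim: l => //= a l ->; rewrite addr0. Qed.

End SplitSums.

Lemma ssum_morph (A B : nmodType) (f : A -> B) (f0 : f 0 = 0) (fD : {morph f : x y / x + y})
    T (l : seq T) F : f (ssum l F) = ssum l (fun p a r => f (F p a r)).
Proof. by elim: l F => //= a l IH F; rewrite fD IH. Qed.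

(** * Taylor expansions at a pole and partial fractions *)

Section Local.
Variables (K : fieldType) (N : nat).
Local Notation TQ := (tq K N).
Local Notation eps := (tin K N 'X).

(** The inverse of [eps + d] for [d != 0]. *)
Definition einv (d : K) : TQ := tin K N (\poly_(k < N.+1) ((-1) ^+ k * d^-1 ^+ k.+1)).

Lemma tcf_einv s d : (s <= N)%N -> tcf s (einv d) = (-1) ^+ s * d^-1 ^+ s.+1.
Proof. by move=> h; rewrite tcf_tin // coef_poly ltnS h. Qed.

Lemma tcfM s (x y : TQ) : (s <= N)%N -> tcf s (x * y) = \sum_(i < s.+1) tcf i x * tcf (s - i) y.
Proof.
move=> h; rewrite [x in LHS]tin_polyn [y in LHS]tin_polyn -(rmorphM (tin K N)) tcf_tin //.
by rewrite coefM.
Qed.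

Lemma tcf_ext (x y : TQ) : (forall s, (s <= N)%N -> tcf s x = tcf s y) -> x = y.
Proof.
move=> h; rewrite [x]tin_polyn [y]tin_polyn; congr (tin _ _ _).
apply/polyP => i; case: (leqP i N) => hi; first exact: h.
have sz (z : TQ) : (size (@qpoly.polyn K (size (mk_monic ('X^(N.+1) : {poly K}))).-1 z) <= N.+1)%N.
  by apply: (leq_trans (@size_npoly K _ z)); rewrite mk_monicXn size_polyXn.
by rewrite !nth_default // (leq_trans (sz _)).
Qed.

Lemma tcf0 s : tcf s (0 : TQ) = 0. Proof. by rewrite /tcf coef0. Qed.

Lemma tcf1 s : (s <= N)%N -> tcf s (1 : TQ) = (s == 0%N)%:R.
Proof. by move=> h; rewrite -(rmorph1 (tin K N)) tcf_tin // coef1. Qed.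

Lemma tcf_sum (I : Type) (r : seq I) (P : pred I) (F : I -> TQ) s :
  tcf s (\sum_(i <- r | P i) F i) = \sum_(i <- r | P i) tcf s (F i).
Proof. by elim/big_rec2: _ => [|i x y _ <-]; rewrite ?tcf0 ?tcfD. Qed.

Lemma tcf_eps0 (x : TQ) : tcf 0 (eps * x) = 0.
Proof. by rewrite tcfM // big_ord1 tcf_tin // coefX mul0r. Qed.

Lemma tcf_epsS s (x : TQ) : (s < N)%N -> tcf s.+1 (eps * x) = tcf s x.
Proof.
by move=> h; rewrite [x]tin_polyn -(rmorphM (tin K N)) !tcf_tin ?(ltnW h) // coefXM.
Qed.

Lemma einvE d : d != 0 -> (eps + tconst K N d) * einv d = 1.
Proof.
move=> d0; apply: tcf_ext => s hs; rewrite mulrDl tcfD tcfZ // tcf1 // tcf_einv //.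
case: s hs => [|s] hs; first by rewrite tcf_eps0 expr0 mul1r expr1 add0r mulfV.
rewrite tcf_epsS // tcf_einv ?(ltnW hs) // [_ ^+ s.+2]exprS [(-1) ^+ s.+1]exprS.
by rewrite mulN1r mulNr mulrN [d * (_ * _)]mulrCA mulVKf // addrN.
Qed.

Section Polar.
Variables (A : comNzRingType) (iota : {rmorphism K -> A}).

(** The principal part of [G (X) / X ^+ k], with [i] for [1 / X]. *)
Definition pol (i : A) (k : nat) (G : TQ) : A := \sum_(s < k) iota (tcf s G) * i ^+ (k - s).

Lemma pol_D i k : {morph pol i k : G H / G + H}.
Proof.
by move=> G H; rewrite /pol -big_split; apply: eq_bigr => s _; rewrite tcfD rmorphD mulrDl.
Qed.

Lemma pol0 i k : pol i k 0 = 0.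
Proof. by rewrite /pol big1 // => s _; rewrite tcf0 rmorph0 mul0r. Qed.

Lemma pol_sum i k (I : Type) (r : seq I) (F : I -> TQ) :
  pol i k (\sum_(j <- r) F j) = \sum_(j <- r) pol i k (F j).
Proof. by elim/big_rec2: _ => [|j x y _ <-]; rewrite ?pol0 ?pol_D. Qed.

Lemma pol_Z i k r G : (k <= N.+1)%N -> pol i k (tconst K N r * G) = iota r * pol i k G.
Proof.
move=> h; rewrite /pol mulr_sumr; apply: eq_bigr => s _.
by rewrite tcfZ ?rmorphM ?mulrA // -ltnS (leq_trans (ltn_ord s)).
Qed.

Lemma pol_1 i k : (0 < k <= N.+1)%N -> pol i k 1 = i ^+ k.
Proof.
case: k => // k h; rewrite /pol big_ord_recl tcf1 // rmorph1 mul1r subn0 big1 ?addr0 // => s _.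
by rewrite tcf1 ?lift0 ?rmorph0 ?mul0r //; have := ltn_ord s; lia.
Qed.

Lemma pol_eps i k G : (k <= N)%N -> pol i k.+1 (eps * G) = pol i k G.
Proof.
move=> h; rewrite /pol big_ord_recl tcf_eps0 rmorph0 mul0r add0r.
by apply: eq_bigr => s _; rewrite lift0 tcf_epsS ?subSS // (leq_trans (ltn_ord s)).
Qed.

Lemma pol_conv i k G H : (k <= N.+1)%N ->
  \sum_(s < k) iota (tcf s G) * pol i (k - s) H = pol i k (G * H).
Proof.
move=> h; rewrite /pol.
transitivity (\sum_(s < k) \sum_(u < k | (s <= u)%N)
    iota (tcf s G * tcf (u - s) H) * i ^+ (k - u)).
  apply: eq_bigr => s _; rewrite mulr_sumr.
  rewrite -(big_mkord xpredT (fun j => iota (tcf s G) * (iota (tcf j H) * i ^+ (k - s - j)))).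
  rewrite -(big_mkord (fun u => (s <= u)%N) (fun u => iota (tcf s G * tcf (u - s) H) * i ^+ (k - u))).
  rewrite [RHS](eq_bigl (fun u => true && (s <= u)%N)) // -(big_nat_widenl s 0 k xpredT) //.
  rewrite (big_addn 0 k s).
  by apply: eq_bigr => j _; rewrite rmorphM mulrA addnK -subnDA addnC.
rewrite (exchange_big_dep predT) //=; apply: eq_bigr => u _.
rewrite tcfM; last by have := ltn_ord u; lia.
rewrite rmorph_sum mulr_suml.
rewrite -(big_mkord (fun s => (s <= u)%N) (fun s => iota (tcf s G * tcf (u - s) H) * i ^+ (k - u))).
rewrite -(big_mkord xpredT (fun s => iota (tcf s G * tcf (u - s) H) * i ^+ (k - u))).
by rewrite [RHS](big_nat_widen 0 u.+1 k) //=; apply: eq_bigl.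
Qed.

(** Induction on [a + k] from [i0 - i = (d - d0) i i0]. With [eps = X + d0], [einv (d - d0)] is the
    expansion of [1 / (X + d)] at the pole [- d0]. *)
Lemma two_point (X i i0 : A) (d d0 : K) (a k : nat) :
  d != d0 -> (X + iota d) * i = 1 -> (X + iota d0) * i0 = 1 ->
  (0 < a + k)%N -> (a <= N)%N -> (k <= N)%N ->
  i ^+ a * i0 ^+ k = pol i0 k (einv (d - d0) ^+ a) + pol i a (einv (d0 - d) ^+ k).
Proof.
move=> dd hi hi0.
have e0 : d - d0 != 0 by rewrite subr_eq0.
have e0' : d0 - d != 0 by rewrite subr_eq0 eq_sym.
have ii : i0 - i = iota (d - d0) * (i * i0).
  rewrite rmorphB -[i0 in LHS]mul1r -[i in X in _ - X]mul1r -{1}hi -hi0; ring.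
have [n] := ubnP (a + k); elim: n a k => // n IH [|a] [|k] //.
- by move=> _ _ _ hk; rewrite !expr0 mul1r pol_1 ?(leqW hk) // [pol i 0 _]big_ord0 addr0.
- by move=> _ _ ha _; rewrite !expr0 mulr1 [pol i0 0 _]big_ord0 add0r pol_1 ?(leqW ha).
move=> hn _ ha hk.
have h1 : pol i0 k.+1 (einv (d - d0) ^+ a) =
   pol i0 k (einv (d - d0) ^+ a.+1) + iota (d - d0) * pol i0 k.+1 (einv (d - d0) ^+ a.+1).
  rewrite -[einv _ ^+ a]mul1r -(einvE e0) -mulrA -exprS mulrDl pol_D pol_eps ?pol_Z //; lia.
have h2 : pol i a.+1 (einv (d0 - d) ^+ k) =
   pol i a (einv (d0 - d) ^+ k.+1) + iota (d0 - d) * pol i a.+1 (einv (d0 - d) ^+ k.+1).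
  rewrite -[einv _ ^+ k]mul1r -(einvE e0') -mulrA -exprS mulrDl pol_D pol_eps ?pol_Z //; lia.
have k1 : i ^+ a * i0 ^+ k.+1 - i ^+ a.+1 * i0 ^+ k = iota (d - d0) * (i ^+ a.+1 * i0 ^+ k.+1).
  transitivity (i ^+ a * i0 ^+ k * (i0 - i)); first by rewrite !exprS; ring.
  by rewrite ii !exprS; ring.
have inv : iota (d - d0)^-1 * iota (d - d0) = 1 by rewrite -rmorphM mulVf ?rmorph1.
rewrite -[LHS]mul1r -inv -mulrA -k1 IH; [|move: hn ha hk; lia..].
rewrite IH; [|move: hn ha hk; lia..].
rewrite h1 h2.
have -> : iota (d0 - d) = - iota (d - d0) by rewrite -rmorphN opprB.
rewrite -[RHS]mul1r -inv; ring.
Qed.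

End Polar.

Definition Hl (l : seq K) (d0 : K) : ncs nat TQ := hs [seq einv (d - d0) | d <- l].

Definition bounded_word (m : seq nat) : bool := all (fun a => a.+2 <= N)%N m.

(** The poles are at the items [- d0]; [Hl l d0 * Hl r d0] collects the Taylor
    expansions at [- d0] of the factors with [d] before and after [d0] in [ds]. *)
Theorem partial_fractions (A : comNzRingType) (iota : {rmorphism K -> A}) (X : A)
    (i : K -> A) (ds : seq K) (m : seq nat) :
  uniq ds -> (forall d, d \in ds -> (X + iota d) * i d = 1) ->
  m != [::] -> bounded_word m ->
  hs [seq i d | d <- ds] m =
  ssum ds (fun l d0 r => ssum m (fun m' a m'' =>
    pol iota (i d0) a.+2 (Hl l d0 m' * Hl r d0 m''))).
Proof.
(* The ring varies, because the induction hypothesis is also applied over the truncated expansions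
   at the new pole [- d]. *)
elim: ds m A iota X i => [|d ds IH] m A iota X i.
  by case: m => [|a m] // _ _ _ _; rewrite hs0.
case: m => // a m /= /andP[dds uds] hi _ /andP[aN mN].
have hid : (X + iota d) * i d = 1 by apply: hi; rewrite mem_head.
have hids d0 : d0 \in ds -> (X + iota d0) * i d0 = 1.
  by move=> h; apply: hi; rewrite inE h orbT.
rewrite hs_cons (IH (a :: m) A iota X i) //=; last by rewrite aN.
have PF2 : i d ^+ a.+2 * hs [seq i d | d <- ds] m =
   pol iota (i d) a.+2 (Hl ds d m) +
   ssum ds (fun l d0 r => ssum m (fun m' b m'' =>
    pol iota (i d0) b.+2 (einv (d - d0) ^+ a.+2 * Hl l d0 m' * Hl r d0 m''))).
  case: (eqVneq m [::]) => [->|m0].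
    rewrite hs_nil mulr1 /= [Hl _ _ _]hs_nil pol_1; last lia.
    by rewrite ssum_zero addr0.
  rewrite (IH m A iota X i) //.
  (* The expansion at [- d] of the ordered sum over the other items is again such a sum, taken at
     [X = eps - d]. *)
  have -> : Hl ds d m = ssum ds (fun l d0 r => ssum m (fun m' b m'' =>
      pol (tconst K N) (einv (d0 - d)) b.+2 (Hl l d0 m' * Hl r d0 m''))).
    rewrite /Hl (IH m TQ (tconst K N) (eps - tconst K N d) (fun d0 => einv (d0 - d))) // => d0 hd0.
    rewrite -[_ - _ + _]addrA [- _ + _]addrC -rmorphB einvE //.
    by rewrite subr_eq0; apply: contraNneq dds => <-.
  rewrite (ssum_morph (f := pol iota (i d) a.+2)); [|exact: pol0|exact: pol_D].
  rewrite -ssumD (ssum_morph (f := fun y => i d ^+ a.+2 * y)); [|by rewrite mulr0|by move=> x y; rewrite mulrDr].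
  apply: eq_ssum => l d0 r eds.
  have hd0 : d0 \in ds by rewrite eds mem_cat mem_head orbT.
  rewrite (ssum_morph (f := pol iota (i d) a.+2)); [|exact: pol0|exact: pol_D].
  rewrite -ssumD (ssum_morph (f := fun y => i d ^+ a.+2 * y)); [|by rewrite mulr0|by move=> x y; rewrite mulrDr].
  apply: eq_ssum => m' b m'' em.
  have bN : (b.+2 <= N)%N by move: mN; rewrite em /bounded_word all_cat /= => /and3P[].
  set G := Hl l d0 m' * Hl r d0 m''.
  have dd0 : d != d0 by apply: contraNneq dds => ->.
  have E1 : pol iota (i d0) b.+2 (einv (d - d0) ^+ a.+2 * Hl l d0 m' * Hl r d0 m'') =
     \sum_(s < b.+2) iota (tcf s G) * pol iota (i d0) (b.+2 - s) (einv (d - d0) ^+ a.+2).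
    by rewrite -mulrA -/G [einv _ ^+ _ * G]mulrC pol_conv //; lia.
  have E2 : pol iota (i d) a.+2 (pol (tconst K N) (einv (d0 - d)) b.+2 G) =
     \sum_(s < b.+2) iota (tcf s G) * pol iota (i d) a.+2 (einv (d0 - d) ^+ (b.+2 - s)).
    rewrite {2}/pol pol_sum; apply: eq_bigr => s _.
    by rewrite pol_Z //; lia.
  (* For each Taylor coefficient of [G] there remains a fraction with the two poles [- d] and
     [- d0]. *)
  rewrite E1 E2 -big_split /= {1}/pol mulr_sumr; apply: eq_bigr => s _.
  rewrite -mulrDr mulrCA; congr (_ * _).
  rewrite (two_point dd0 hid (hids _ hd0)) ?[_ + pol _ _ a.+2 _]addrC //; have := ltn_ord s; lia.
rewrite PF2.
have Hl0 d0 b w : Hl [::] d0 (b :: w) = 0 by rewrite /Hl hs0.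
have F1 : ssum (a :: m) (fun m' b m'' => pol iota (i d) b.+2 (Hl [::] d m' * Hl ds d m'')) =
   pol iota (i d) a.+2 (Hl ds d m).
  rewrite /= {1}/Hl hs_nil mul1r -[RHS]addr0; congr (_ + _).
  rewrite -[RHS](ssum_zero _ m); apply: eq_ssum => m' b m'' _.
  by rewrite Hl0 mul0r pol0.
have F2 : ssum ds (fun l d0 r => ssum (a :: m) (fun m' b m'' =>
      pol iota (i d0) b.+2 (Hl (d :: l) d0 m' * Hl r d0 m''))) =
    ssum ds (fun l d0 r => ssum (a :: m) (fun m' b m'' =>
      pol iota (i d0) b.+2 (Hl l d0 m' * Hl r d0 m''))) +
    ssum ds (fun l d0 r => ssum m (fun m' b m'' =>
      pol iota (i d0) b.+2 (einv (d - d0) ^+ a.+2 * Hl l d0 m' * Hl r d0 m''))).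
  rewrite -ssumD; apply: eq_ssum => l d0 r _ /=.
  rewrite /Hl !hs_nil -addrA -ssumD; congr (_ + _); apply: eq_ssum => m' b m'' _.
  by rewrite /= hs_cons mulrDl pol_D.
rewrite [RHS]/= -/(ssum (a :: m) (fun m' b m'' => pol iota (i d) b.+2 (Hl [::] d m' * Hl ds d m''))).
have -> := F1.
have -> := F2.
by rewrite addrCA.
Qed.

End Local.

(** * Taylor coefficients at the poles and words *)

Section TaylorRecursion.
Variables (K : numFieldType) (N : nat).
Local Notation TQ := (tq K N).

(** Up to sign, the effect on the word of differentiating a product of powers [(x + m_j)^-(a_j + 2)]
    in [x]. *)
Fixpoint wder (V : zmodType) (f : seq nat -> V) (m : seq nat) : V :=
  if m is a :: m' then f (a.+1 :: m') *+ a.+2 + wder (fun v => f (a :: v)) m' else 0.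

(** The equation [d (f m) / d eps = - wder f m], read on coefficients because the derivative lowers
    the order of truncation. *)
Definition taylor_rec (f : seq nat -> TQ) := forall m s, (s < N)%N ->
  s.+1%:R * tcf s.+1 (f m) = - tcf s (wder f m).

Lemma tcfMn s n (x : TQ) : tcf s (x *+ n) = tcf s x *+ n.
Proof. by elim: n => [|n IH]; rewrite ?mulr0n ?tcf0 // !mulrS tcfD IH. Qed.

Lemma tcfN s (x : TQ) : tcf s (- x) = - tcf s x.
Proof. by apply/eqP; rewrite -addr_eq0 -tcfD addNr tcf0. Qed.

Lemma leibniz (x y x' y' : TQ) s : (s < N)%N ->
  (forall i, (i <= s)%N -> i.+1%:R * tcf i.+1 x = - tcf i x') ->
  (forall i, (i <= s)%N -> i.+1%:R * tcf i.+1 y = - tcf i y') ->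
  s.+1%:R * tcf s.+1 (x * y) = - tcf s (x' * y + x * y').
Proof.
move=> sN hx hy; rewrite tcfM // tcfD !tcfM ?(ltnW sN) // mulr_sumr opprD -!sumrN.
transitivity (\sum_(i < s.+2) (i%:R * tcf i x * tcf (s.+1 - i) y +
    tcf i x * ((s.+1 - i)%:R * tcf (s.+1 - i) y))).
  apply: eq_bigr => i _.
  rewrite natrB; last by rewrite -ltnS.
  ring.
rewrite big_split /=; congr (_ + _).
  rewrite big_ord_recl !mul0r add0r; apply: eq_bigr => i _.
  by rewrite lift0 hx ?subSS ?mulNr // -ltnS.
rewrite big_ord_recr /= subnn mul0r mulr0 addr0; apply: eq_bigr => i _.
have iS : (i <= s)%N by rewrite -ltnS.
by rewrite subSn // hy ?leq_subr // mulrN.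
Qed.

Lemma einvX_taylor (d : K) n s : (s < N)%N ->
  s.+1%:R * tcf s.+1 (einv N d ^+ n) = - tcf s (einv N d ^+ n.+1 *+ n).
Proof.
elim: n s => [|n IH] s sN; first by rewrite tcf1 // mulr0n tcf0 oppr0 mulr0.
have h1 i : (i <= s)%N -> i.+1%:R * tcf i.+1 (einv N d) = - tcf i (einv N d * einv N d).
  move=> iS; rewrite tcfM; last lia.
  rewrite tcf_einv; last lia.
  rewrite (eq_bigr (fun=> (-1) ^+ i * d^-1 ^+ i.+2)).
    by rewrite sumr_const card_ord -mulr_natl [(-1) ^+ i.+1]exprS; ring.
  move=> j _; rewrite !tcf_einv; [|have := ltn_ord j; lia..].
  rewrite mulrACA -!exprD subnKC; last by rewrite -ltnS.
  by congr (_ * _ ^+ _); have := ltn_ord j; lia.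
rewrite exprS (leibniz (x' := einv N d * einv N d) (y' := einv N d ^+ n.+1 *+ n)) //.
  congr (- tcf s _).
  rewrite mulrnAr -exprS mulrS; congr (_ + _); by rewrite !exprS mulrA.
by move=> i iS; apply: IH; lia.
Qed.

Lemma hs_taylor (ds : seq K) : taylor_rec (hs [seq einv N d | d <- ds]).
Proof.
have wD (V : zmodType) (f g : seq nat -> V) m :
    wder (fun v => f v + g v) m = wder f m + wder g m.
  by elim: m f g => [|a m IH] f g /=; rewrite ?addr0 // IH mulrnDl addrACA.
have wM (x : TQ) (f : seq nat -> TQ) m : wder (fun v => x * f v) m = x * wder f m.
  by elim: m f => [|a m IH] f /=; rewrite ?mulr0 // IH mulrDr mulrnAr.
elim: ds => [|d ds IH] m s sN.
  have z m' : wder (hs [::] : seq nat -> TQ) m' = 0.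
    case: m' => //= a m'; rewrite hs0 mul0rn add0r.
    rewrite (_ : (fun v => _) = fun _ => 0); last by apply/funext => v; rewrite hs0.
    by elim: m' => //= b m' ->; rewrite mul0rn addr0.
  rewrite z tcf0 oppr0 hs0; case: m => [|? ?]; rewrite ?tcf0 ?mulr0 //.
  by rewrite tcf1 // mulr0.
case: m => [|a m]; first by rewrite hs_nil tcf1 // mulr0 tcf0 oppr0.
rewrite [map _ _]/= hs_cons tcfD mulrDr IH //.
rewrite (leibniz (x' := einv N d ^+ a.+3 *+ a.+2) (y' := wder (hs [seq einv N d | d <- ds]) m)) //;
  first last.
- by move=> i iS; apply: IH; lia.
- by move=> i iS; rewrite einvX_taylor ?tcfN //; lia.
rewrite -opprD -tcfD /=; congr (- tcf s _).
have -> : (fun v => hs (einv N d :: [seq einv N d | d <- ds]) (a :: v)) =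
   (fun v => hs [seq einv N d | d <- ds] (a :: v) + einv N d ^+ a.+2 * hs [seq einv N d | d <- ds] v).
  by apply/funext => v; rewrite hs_cons.
by rewrite wD wM hs_cons mulrnDl mulrnAl; exact: addrACA.
Qed.

(** The substitution of [- eps] for [eps]. *)
Definition reflected (x y : TQ) := forall s, (s <= N)%N -> tcf s x = (-1) ^+ s * tcf s y.

Lemma reflectedM x y x' y' : reflected x y -> reflected x' y' -> reflected (x * x') (y * y').
Proof.
move=> h h' s sN; rewrite !tcfM // mulr_sumr; apply: eq_bigr => i _.
have iS : (i <= s)%N by rewrite -ltnS.
rewrite h ?h'; [|lia..].
have -> : (-1) ^+ s = (-1) ^+ i * (-1) ^+ (s - i) :> K by rewrite -exprD subnKC.
ring.
Qed.

Lemma reflectedD x y x' y' : reflected x y -> reflected x' y' -> reflected (x + x') (y + y').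
Proof. by move=> h h' s sN; rewrite !tcfD h // h' // mulrDr. Qed.

Definition weight (m : seq nat) : nat := sumn [seq a.+2 | a <- m].

(** From [1 / (eps - d) = - 1 / (- eps + d)], with one sign for each unit of weight. *)
Lemma hs_reflected (ds : seq K) m :
  reflected (hs [seq einv N (- d) | d <- ds] m)
    ((-1) ^+ weight m * hs [seq einv N d | d <- ds] m).
Proof.
have r0 : reflected 0 0 by move=> s sN; rewrite tcf0 mulr0.
have r1 : reflected 1 1.
  by move=> s sN; rewrite tcf1 //; case: s sN => [|s] _; rewrite ?mulr0 ?mulr1.
have re d : reflected (einv N (- d)) ((-1) * einv N d).
  move=> s sN; rewrite mulN1r tcfN !tcf_einv // invrN [(- d^-1) ^+ _]exprNn [(-1) ^+ s.+1]exprS.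
  ring.
elim: ds m => [|d ds IH] m.
  rewrite !hs0; case: m => [|a m]; rewrite ?mulr0 // /weight /= mulr1; exact: r1.
case: m => [|a m]; first by rewrite !hs_nil mulr1; exact: r1.
rewrite [map _ (d :: ds)]/= [map _ (d :: ds)]/= !hs_cons mulrDr; apply: reflectedD; first exact: IH.
have -> : (-1) ^+ weight (a :: m) * (einv N d ^+ a.+2 * hs [seq einv N i | i <- ds] m) =
   ((-1) * einv N d) ^+ a.+2 * ((-1) ^+ weight m * hs [seq einv N i | i <- ds] m) :> TQ.
  by rewrite -[weight (a :: m)]/(a.+2 + weight m)%N exprD exprMn; exact: mulrACA.
apply: reflectedM; last exact: IH.
by elim: a.+2 => [|k IHk]; rewrite ?expr0 // !exprS; exact: reflectedM.
Qed.

End TaylorRecursion.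

(** * Coefficients of the conjugates of powers of [e0] *)

Section WordCuts.
Variables (C : comNzRingType) (Phi Phi' : ncs bool C).
Local Notation e0 := (lett false : ncs bool C).
Local Notation e1 := (lett true : ncs bool C).

(** These numbers appear as limits of the coefficients of [(x + n)^-(k+1)] in partial fractions
    ([kapH_rate]), the same at every pole, and as the coefficients of [Mser] ([Mser_kap]). *)
Definition kap (m : seq nat) (k : nat) : C := (e1 * (Phi' * (e0 ^+ k * Phi))) (yword m).

Lemma mul_zeros_cut (f h : ncs bool C) c w :
  (f * h) (nseq c false ++ w) =
  \sum_(s < c) f (nseq s false) * h (nseq (c - s) false ++ w) +
  (((fun v => f (nseq c false ++ v)) : ncs bool C) * h) w.
Proof.
elim: c f => [|c IH] f; first by rewrite big_ord0 add0r.
rewrite big_ord_recl -addrA -[LHS]/((f * h) (false :: (nseq c false ++ w))).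
by rewrite ncsM_cons IH subn0.
Qed.

Lemma e0X_zeros k c m : (e0 ^+ k * Phi) (nseq c false ++ yword m) =
  if (k <= c)%N then Phi (nseq (c - k) false ++ yword m) else 0.
Proof.
elim: k c => [|k IH] c; first by rewrite mul1r subn0.
rewrite exprS -mulrA; case: c => [|c].
  by case: (m) => [|b m']; rewrite /= ?lettM_nil // yword_cons lettM_ne.
by rewrite [nseq _ _ ++ _]/= lettM_eq IH.
Qed.

(** [Phi' (negw m s)] is the limit of the coefficient of [eps ^+ s] in the sums over
    negative integers. *)
Definition negw (m : seq nat) (s : nat) : word := behead (yword m ++ true :: nseq s false).

(** The two cuts, before and after the zeros matched by [e0 ^+ k], lie in a single run of zeros,
    that of the letter [b]; [s] zeros of this run stay on the left. *)
Lemma cut_words (f : ncs bool C) k a m :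
  (f * (e0 ^+ k * Phi)) (nseq a.+1 false ++ yword m) =
  ssum (a :: m) (fun m' b m'' => \sum_(s < b.+2 | (s + k <= b.+1)%N)
     f (negw m' s) * Phi (nseq (b.+1 - s - k) false ++ yword m'')).
Proof.
elim: m f a => [|b m IH] f a.
  rewrite mul_zeros_cut ncsM_nil [RHS]addr0 [RHS]big_mkcond [RHS]big_ord_recr /=.
  congr (_ + _).
    apply: eq_bigr => s _; rewrite (e0X_zeros k _ [::]) /negw /=.
    have -> : (s + k <= a.+1)%N = (k <= a.+1 - s)%N by have := ltn_ord s; lia.
    by case: ifP => _; rewrite ?mulr0.
  rewrite cats0 /negw /= subnn.
  have -> : (e0 ^+ k * Phi) [::] = _ := e0X_zeros k 0 [::].
  have -> : (a.+1 + k <= a.+1)%N = (k <= 0)%N by lia.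
  by case: ifP => _; rewrite ?mulr0.
rewrite mul_zeros_cut yword_cons ncsM_cons cats0 addrA.
rewrite [RHS]/=; congr (_ + _).
  rewrite [RHS]big_mkcond [RHS]big_ord_recr /=; congr (_ + _).
    apply: eq_bigr => s _.
    rewrite -[true :: _]/(yword (b :: m)) e0X_zeros /negw /=.
    have -> : (s + k <= a.+1)%N = (k <= a.+1 - s)%N by have := ltn_ord s; lia.
    by case: ifP => _; rewrite ?mulr0.
  rewrite -[true :: _]/(nseq 0 false ++ yword (b :: m)) e0X_zeros /negw /= subnn.
  have -> : (a.+1 + k <= a.+1)%N = (k <= 0)%N by lia.
  by case: ifP => _; rewrite ?mulr0.
rewrite (IH _ b) -[RHS]/(ssum (b :: m) (fun m' d m'' => \sum_(s < d.+2 | (s + k <= d.+1)%N)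
     f (negw (a :: m') s) * Phi (nseq (d.+1 - s - k) false ++ yword m''))).
apply: eq_ssum => m' d m'' _.
apply: eq_bigr => s _; congr (_ * _).
rewrite /de /negw; congr (f _).
rewrite yword_cons -[RHS]/((nseq a.+1 false ++ yword m') ++ true :: nseq s false) -catA.
by congr (_ ++ _); case: m' => [|? ?]; rewrite ?yword_cons.
Qed.

Lemma kapE m k : m != [::] -> kap m k =
  ssum m (fun m' b m'' => \sum_(s < b.+2 | (s + k <= b.+1)%N)
     Phi' (negw m' s) * Phi (nseq (b.+1 - s - k) false ++ yword m'')).
Proof.
case: m => // a m _.
by rewrite /kap yword_cons lettM_eq cut_words.
Qed.

(** [Phi'] and [Phi] cancel, and the letter [1] alone is not a depth word. In the limit there are
    thus no simple poles, whose sum over the integers converges only conditionally. *)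
Lemma kap_0 m : Phi' * Phi = 1 -> kap m 0 = 0.
Proof.
move=> h; rewrite /kap expr0 mul1r h mulr1 /lett.
by case: m => [|a m] //; rewrite yword_cons.
Qed.

Lemma negw_rev m s : rev (negw m s) = nseq s false ++ yword (rev m).
Proof.
have e : negw m s = flatten [seq rcons (nseq a.+1 false) true | a <- m] ++ nseq s false.
  rewrite /negw; case: m => [|a m] //; rewrite yword_cons.
  rewrite -[LHS]/((nseq a.+1 false ++ yword m) ++ true :: nseq s false).
  elim: m a => [|b m IH] a; first by rewrite [map _ _]/= /yword /= !cats0 cat_rcons.
  rewrite yword_cons -[flatten _]/(rcons (nseq a.+1 false) true ++
    flatten [seq rcons (nseq i.+1 false) true | i <- b :: m]) -[RHS]catA -IH cat_rcons -!catA.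
  by rewrite cat_cons -!catA.
rewrite e rev_cat rev_nseq; congr (_ ++ _).
rewrite rev_flatten -map_comp -map_rev /yword /nword -map_comp.
congr flatten; apply: eq_map => a.
by rewrite -[LHS]/(rev (rcons (nseq a.+1 false) true)) rev_rcons rev_nseq.
Qed.

Hypothesis PhiG : grouplike (fun _ _ => [::]) Phi.
Hypothesis Phi_0 : Phi [:: false] = 0.

(** Shuffling in one zero gives 0, as [Phi [:: false] = 0]. It enlarges either the leading run, in
    [s + 1] ways, or the run of a letter [a], in [a + 2] ways. This is the recursion of
    [taylor_rec]. *)
Lemma Phi_zeros_rec s m :
  Phi (nseq s.+1 false ++ yword m) *+ s.+1 = - wder (fun v => Phi (nseq s false ++ yword v)) m.
Proof.
case: m => [|a m].
  have := grouplikeE [:: false] (nseq s false) PhiG.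
  by rewrite -/(qsh0 _ _) (qsh0_all_zeros Phi) Phi_0 mul0r oppr0 /= !cats0.
have := grouplikeE [:: false] (nseq s false ++ yword (a :: m)) PhiG.
rewrite yword_cons -/(qsh0 _ _) (qsh0_zeros Phi) Phi_0 mul0r => /eqP.
rewrite addr_eq0 => /eqP ->; congr (- _).
have key (G : word -> C) b m' : \sum_(v <- qsh0 [:: false] (nseq b.+1 false ++ yword m')) G v =
   wder (fun w => G (if w is x :: w' then nseq x.+1 false ++ yword w' else [::])) (b :: m').
  elim: m' G b => [|d m' IH] G b.
    by rewrite cats0 (qsh0_all_zeros G) /= cats0 addr0.
  rewrite yword_cons (qsh0_zeros G) [in RHS]/= yword_cons; congr (_ + _).
  rewrite (IH (fun v => G (nseq b.+1 false ++ true :: v)) d) /=.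
  by rewrite yword_cons.
rewrite (key (fun v => Phi (nseq s false ++ true :: v))) /=.
by congr (_ + _).
Qed.

End WordCuts.

(** * Eisenstein series *)

(** [\sum_m (x + m) ^- (a + 2) = (pP (pi ^+ 2) a).[pi cot (pi x)]]: the recursion is
    [d/dx], since [pi cot (pi x)] solves [y' = - (y^2 + pi^2)]. *)
Fixpoint pP (K : fieldType) (p2 : K) (a : nat) : {poly K} :=
  if a is b.+1 then b.+2%:R^-1 *: (('X^2 + p2%:P) * (pP p2 b)^`()) else 'X^2 + p2%:P.

Section Eisenstein.
Variable R : realType.
Implicit Types (x y h : R).
Local Open Scope classical_set_scope.

Definition sint (M : nat) : seq R := [seq i%:R - M%:R | i <- iota 0 (M + M.+1)].

Definition eis (k M : nat) (x : R) : R := \sum_(d <- sint M) (x + d)^-1 ^+ k.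

Definition tau x : R := pi * cos (pi * x) / sin (pi * x).

Definition csq y : R := (sin y ^+ 2)^-1.

Lemma csqN y : csq (- y) = csq y.
Proof. by rewrite /csq sinN sqrrN. Qed.

Lemma csqBpi y : csq (y - pi) = csq y.
Proof. by rewrite -{2}(subrK pi y) /csq sinDpi sqrrN. Qed.

(** With [csq_half] iterated, this gives the expansion of [pi^2 / sin^2 (pi x)]
    into the sum of the [(x + m) ^- 2]. *)
Lemma csq_bounds y : 0 < `|y| <= pi / 2 -> y^-1 ^+ 2 <= csq y <= y^-1 ^+ 2 + 1.
Proof.
wlog y0 : y / 0 < y => [H|].
  case: (ltgtP y 0) => [yn|yp|->]; last by rewrite normr0 ltxx.
    by rewrite -normrN -csqN -[y^-1 ^+ 2]sqrrN -invrN; apply: H; rewrite oppr_gt0.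
  exact: H.
rewrite gtr0_norm // => /andP[_ ypi].
have ypi' : y < pi by apply: (le_lt_trans ypi); rewrite ltr_pdivrMr // ltr_pMr ?pi_gt0 // ltr1n.
have sy : 0 < sin y by apply: sin_gt0_pi; rewrite y0.
have [|c cI] := @MVT_segment R sin cos 0 y (ltW y0).
  exact/continuous_subspaceT/continuous_sin.
move: cI; rewrite sin0 !subr0 in_itv /= => /andP[c0 cy] es.
have cc : cos y <= cos c.
  move: cy; rewrite le_eqVlt => /predU1P[->//|cy].
  rewrite ltW // ltr_cos // in_itv /= ?c0 ?(ltW y0) ?(ltW ypi') //.
  by rewrite (le_trans (ltW cy)) // ltW.
have cy0 : 0 <= cos y by apply: cos_ge0_pihalf; rewrite ypi andbT (le_trans _ (ltW y0)) // oppr_le0 divr_ge0 ?pi_ge0.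
have c1 : sin y <= y by rewrite es ler_piMl ?cos_le1 // ltW.
have c2 : y * cos y <= sin y by rewrite es mulrC ler_wpM2r // ltW.
have sn : sin y != 0 by rewrite gt_eqF.
have yn : y != 0 by rewrite gt_eqF.
apply/andP; split; rewrite -subr_ge0.
  have -> : csq y - y^-1 ^+ 2 = (y ^+ 2 - sin y ^+ 2) / (y ^+ 2 * sin y ^+ 2).
    by rewrite /csq; field; rewrite ?yn ?sn.
  apply: divr_ge0; last by rewrite mulr_ge0 ?sqr_ge0.
  by rewrite subr_ge0 ler_sqr // nnegrE ltW.
have -> : y^-1 ^+ 2 + 1 - csq y = (sin y ^+ 2 - (y * cos y) ^+ 2) / (y ^+ 2 * sin y ^+ 2).
  by rewrite /csq exprMn cos2sin2; field; rewrite ?yn ?sn.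
apply: divr_ge0; last by rewrite mulr_ge0 ?sqr_ge0.
by rewrite subr_ge0 ler_sqr // nnegrE ?mulr_ge0 // ltW.
Qed.

Lemma csq_half y : sin y != 0 -> csq y = 4^-1 * (csq (y / 2) + csq (y / 2 + pi / 2)).
Proof.
move=> s0; have e : sin y = 2 * (sin (y / 2) * cos (y / 2)).
  by rewrite {1}(splitr y) sinD; ring.
have cs := cos2Dsin2 (y / 2).
move: s0; rewrite e mulf_eq0 negb_or mulf_eq0 negb_or => /and3P[_ s0 c0].
rewrite /csq sinDpihalf e.
have -> : (sin (y / 2) ^+ 2)^-1 + (cos (y / 2) ^+ 2)^-1 =
   (cos (y / 2) ^+ 2 + sin (y / 2) ^+ 2) / (sin (y / 2) ^+ 2 * cos (y / 2) ^+ 2).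
  by field; rewrite s0 c0.
by rewrite cs; field; rewrite s0 c0.
Qed.

Lemma sin_pi_neq0 x : 0 < x < 1 -> 0 < sin (pi * x).
Proof.
move=> /andP[x0 x1]; apply: sin_gt0_pi.
by rewrite mulr_gt0 ?pi_gt0 //= gtr_pMr ?pi_gt0.
Qed.

Lemma csq_dyadic n x : 0 < x < 1 ->
  csq (pi * x) = (4 ^+ n)^-1 * \sum_(k < 2 ^ n) csq (pi * ((x + k%:R) / 2 ^+ n)).
Proof.
move=> x01; elim: n => [|n IH].
  by rewrite expn0 big_ord1 !expr0 invr1 mul1r mulr1 addr0.
have e2 : 2 ^+ n != 0 :> R by rewrite expf_neq0.
have [x0 x1] := andP x01.
have a2 : (2 ^ n.+1 = 2 ^ n + 2 ^ n)%N by rewrite expnS mul2n addnn.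
rewrite IH a2 big_split_ord /= -big_split /= [4 ^+ n.+1]exprS invfM [4^-1 * _]mulrC -mulrA; congr (_ * _).
rewrite mulr_sumr; apply: eq_bigr => k _; rewrite csq_half; last first.
  rewrite gt_eqF // sin_pi_neq0 // divr_gt0 ?exprn_gt0 ?addr_gt0_ge0 //=; last first.
    by rewrite ltr_wpDr.
  rewrite ltr_pdivrMr ?exprn_gt0 // mul1r.
  have : (k.+1 <= 2 ^ n)%N by [].
  by rewrite -(ler_nat R) natrX -natr1; lra.
congr (_ * _); congr (csq _ + csq _); rewrite [2 ^+ n.+1]exprS.
  by field.
by rewrite natrD natrX; field.
Qed.

(** With [M] terms on either side, [M = 2 ^ n] matches the number of terms of [csq_dyadic]. *)
Definition eisT (k M : nat) (x : R) : R :=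
  \sum_(i < M) (x - i.+1%:R)^-1 ^+ k + \sum_(i < M) (x + i%:R)^-1 ^+ k.

Lemma eis_split k M x : eis k M x = eisT k M x + (x + M%:R)^-1 ^+ k.
Proof.
rewrite /eis /sint big_map iotaD big_cat /= -addrA; congr (_ + _).
  have -> : iota 0 M = index_iota 0 M by rewrite /index_iota subn0.
  rewrite big_mkord.
  rewrite (reindex_inj rev_ord_inj) /=; apply: eq_bigr => i _.
  by rewrite natrB //; rewrite addrAC subrr add0r.
rewrite -(big_ord_recr M (fun i => (x + i%:R)^-1 ^+ k)) /=.
have sh N : \sum_(i <- iota (0 + M) N) (x + (i%:R - M%:R))^-1 ^+ k = \sum_(i < N) (x + i%:R)^-1 ^+ k.
  rewrite addnC iotaDl big_map -(big_mkord xpredT (fun i => (x + i%:R)^-1 ^+ k)) /index_iota subn0.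
  by apply: eq_bigr => i _; rewrite natrD addrAC subrr add0r.
by have := sh M.+1; rewrite /= => ->.
Qed.

Lemma eisT_le M M' x : (M <= M')%N -> eisT 2 M x <= eisT 2 M' x.
Proof.
elim: M' => [|M' IH]; first by rewrite leqn0 => /eqP ->.
rewrite leq_eqVlt => /predU1P[->//|]; rewrite ltnS => /IH h; apply: (le_trans h).
by rewrite /eisT !big_ord_recr /= addrACA lerDl addr_ge0 // sqr_ge0.
Qed.

(** [csq_dyadic] at level [n + 1], with half of the arguments moved by [- pi], is compared term by
    term through [csq_bounds]; the [2^(n+1)] errors [(pi / 2^(n+1))^2] stay below the bound. *)
Lemma eisT_bounds n x : 0 < x < 1 ->
  eisT 2 (2 ^ n) x <= pi ^+ 2 * csq (pi * x) <= eisT 2 (2 ^ n) x + pi ^+ 2 / 2 ^+ n.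
Proof.
move=> x01; have [x0 x1] := andP x01.
have e2 : 0 < 2 ^+ n :> R by rewrite exprn_gt0.
have e2n : 2 ^+ n != 0 :> R by rewrite gt_eqF.
have pn : pi != 0 :> R by rewrite gt_eqF ?pi_gt0.
have a2 : (2 ^ n.+1 = 2 ^ n + 2 ^ n)%N by rewrite expnS mul2n addnn.
have kn (k : 'I_(2 ^ n)) : k%:R + 1 <= 2 ^+ n :> R.
  by have : (k.+1 <= 2 ^ n)%N by []; rewrite -(ler_nat R) natrX -natr1.
have -> : pi ^+ 2 * csq (pi * x) =
   \sum_(i < 2 ^ n) (pi / 2 ^+ n.+1) ^+ 2 * csq (pi / 2 ^+ n.+1 * (x - i.+1%:R)) +
   \sum_(i < 2 ^ n) (pi / 2 ^+ n.+1) ^+ 2 * csq (pi / 2 ^+ n.+1 * (x + i%:R)).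
  rewrite (csq_dyadic n.+1 x01) a2 big_split_ord /= -!mulr_sumr -mulrDr mulrA.
  congr (_ * _).
    by rewrite exprMn exprVn -exprM mulnC exprM [2 ^+ 2]expr2 -natrM.
  rewrite addrC; congr (_ + _).
    rewrite (reindex_inj rev_ord_inj) /=; apply: eq_bigr => i _.
    rewrite -csqBpi; congr csq; rewrite natrD natrB // natrX exprS -natr1.
    by field.
  by apply: eq_bigr => i _; congr csq; rewrite exprS; field.
have key z : 0 < `|z| <= 2 ^+ n ->
   z^-1 ^+ 2 <= (pi / 2 ^+ n.+1) ^+ 2 * csq (pi / 2 ^+ n.+1 * z) <=
   z^-1 ^+ 2 + (pi / 2 ^+ n.+1) ^+ 2.
  move=> /andP[z0 zn].
  have zn0 : z != 0 by rewrite -normr_gt0.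
  have c0 : 0 < pi / 2 ^+ n.+1 :> R by rewrite divr_gt0 ?pi_gt0 ?exprn_gt0.
  have c20 : 0 < (pi / 2 ^+ n.+1) ^+ 2 :> R by rewrite exprn_gt0.
  have [|l u] := andP (@csq_bounds (pi / 2 ^+ n.+1 * z) _).
    rewrite normrM (gtr0_norm c0) mulr_gt0 //=.
    have -> : pi / 2 ^+ n.+1 * `|z| = pi / 2 * (`|z| / 2 ^+ n) by rewrite exprS; field.
    by rewrite ger_pMr ?divr_gt0 ?pi_gt0 // ler_pdivrMr // mul1r.
  have e : z^-1 ^+ 2 = (pi / 2 ^+ n.+1) ^+ 2 * (pi / 2 ^+ n.+1 * z)^-1 ^+ 2.
    by rewrite -exprMn invfM mulrA mulfV ?gt_eqF // mul1r.
  rewrite e ler_pM2l // l /= -[X in _ + X]mulr1 -mulrDr ler_pM2l //.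
have k1 (i : 'I_(2 ^ n)) : 0 < `|x - i.+1%:R| <= 2 ^+ n.
  rewrite distrC ger0_norm; have := kn i; rewrite -natr1; have := ler0n R i; lra.
have k2 (i : 'I_(2 ^ n)) : 0 < `|x + i%:R| <= 2 ^+ n.
  rewrite ger0_norm; have := kn i; have := ler0n R i; lra.
apply/andP; split.
  by apply: lerD; apply: ler_sum => i _; [have /andP[] := key _ (k1 i) | have /andP[] := key _ (k2 i)].
have -> : pi ^+ 2 / 2 ^+ n = \sum_(i < 2 ^ n) (pi / 2 ^+ n.+1) ^+ 2 +
    \sum_(i < 2 ^ n) (pi / 2 ^+ n.+1) ^+ 2 + pi ^+ 2 / 2 ^+ n / 2 :> R.
  have sc (c : R) : \sum_(i < 2 ^ n) c = 2 ^+ n * c by rewrite sumr_const card_ord -natrX mulr_natl.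
  by rewrite !sc [2 ^+ n.+1]exprS; field.
apply: (@le_trans _ _ (eisT 2 (2 ^ n) x + (\sum_(i < 2 ^ n) (pi / 2 ^+ n.+1) ^+ 2 +
    \sum_(i < 2 ^ n) (pi / 2 ^+ n.+1) ^+ 2))); last first.
  by rewrite lerD2l lerDl divr_ge0 // divr_ge0 ?sqr_ge0 // ltW.
rewrite /eisT addrACA -!big_split /=; apply: ler_sum => i _.
by apply: lerD; [have /andP[] := key _ (k1 i) | have /andP[] := key _ (k2 i)].
Qed.

Definition eis2 x : R := pi ^+ 2 * csq (pi * x).

Lemma eis2_le M x : 0 < x < 1 -> eis 2 M x <= eis2 x.
Proof.
move=> x01; have /andP[h _] := eisT_bounds M.+1 x01; apply: le_trans h.
apply: (@le_trans _ _ (eisT 2 M.+1 x)); last by apply: eisT_le; rewrite ltnW // ltn_expl.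
rewrite eis_split /eisT !big_ord_recr /= addrA lerD2r lerD2r lerDl; exact: sqr_ge0.
Qed.

Lemma eis2_cvg x : 0 < x < 1 -> eis 2 ^~ x @ \oo --> eis2 x.
Proof.
move=> x01; apply/cvgrPdist_le => e e0.
have [n hn] : exists n, pi ^+ 2 / 2 ^+ n <= e.
  exists (Num.bound (pi ^+ 2 / e)); rewrite ler_pdivrMr ?exprn_gt0 // mulrC -ler_pdivrMr //.
  apply: (@le_trans _ _ (Num.bound (pi ^+ 2 / e))%:R).
    by rewrite ltW // archi_boundP // divr_ge0 ?sqr_ge0 // ltW.
  by rewrite -natrX ler_nat ltnW // ltn_expl.
exists (2 ^ n)%N => // M /= hM.
rewrite ger0_norm; last by rewrite subr_ge0 eis2_le.
have /andP[_ u] := eisT_bounds n x01.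
rewrite lerBlDl; apply: (le_trans u); apply: lerD => //.
apply: (le_trans (eisT_le x hM)); rewrite eis_split lerDl; exact: sqr_ge0.
Qed.

Lemma eis2E x : 0 < x < 1 -> eis2 x = ('X^2 + (pi ^+ 2)%:P).[tau x].
Proof.
move=> x01; have s0 : sin (pi * x) != 0 by rewrite gt_eqF ?sin_pi_neq0.
rewrite /eis2 /csq /tau !hornerE /= !exprMn cos2sin2.
by field.
Qed.

Lemma is_derive_tau x : 0 < x < 1 -> is_derive x 1 tau (- (tau x ^+ 2 + pi ^+ 2)).
Proof.
move=> x01; have s0 : sin (pi * x) != 0 by rewrite gt_eqF ?sin_pi_neq0.
have d1 : is_derive x 1 (fun y => pi * y) pi.
  by apply: is_derive_eq; rewrite -[_ *: _]/(pi * 1) mulr1.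
have ds : is_derive x 1 (fun y => sin (pi * y)) (cos (pi * x) * pi).
  exact: (@is_derive1_comp R sin (fun y => pi * y)).
have dc : is_derive x 1 (fun y => cos (pi * y)) (- sin (pi * x) * pi).
  exact: (@is_derive1_comp R cos (fun y => pi * y)).
have dV := is_deriveV s0 ds.
have dcp : is_derive x 1 (pi \*: (fun y => cos (pi * y))) (pi *: (- sin (pi * x) * pi)) by exact: is_deriveZ.
have dM := is_deriveM dcp dV.
have -> : tau = (pi \*: (fun y => cos (pi * y))) * (fun y => (sin (pi * y))^-1) by apply/funext.
apply: (is_derive_eq dM).
rewrite -[LHS]/(pi * cos (pi * x) * (- sin (pi * x) ^- 2 * (cos (pi * x) * pi)) +
  (sin (pi * x))^-1 * (pi * (- sin (pi * x) * pi))).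
rewrite -[RHS]/(- ((pi * cos (pi * x) / sin (pi * x)) ^+ 2 + pi ^+ 2)).
by field.
Qed.

(** A substitute for termwise differentiation: the difference quotients of [F n] tend to those of
    [p] and are close to [G n] uniformly in [n], so a single small [h] suffices for each
    tolerance. *)
Lemma diff_quot_cvg (F : nat -> R -> R) (G : nat -> R) (p : R -> R) x p' (C : R) :
  (\forall h \near (0 : R), F ^~ (x + h) @ \oo --> p (x + h)) ->
  is_derive x 1 p p' ->
  (\forall h \near (0 : R), forall n, `|F n (x + h) - F n x - h * G n| <= C * h ^+ 2) ->
  G @ \oo --> p'.
Proof.
move=> hF [dp1 dp2] hG.
have dp : (fun h => h^-1 *: (p (h *: 1 + x) - p x)) @ (0 : R)^' --> p' by rewrite -dp2; exact: dp1.
have Fx : F ^~ x @ \oo --> p x by rewrite -[x]addr0; exact: (nbhs_singleton hF).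
apply/cvgrPdist_le => e e0.
have e4 : 0 < e / 4 by rewrite divr_gt0.
have eC : 0 < e / 4 / (`|C| + 1) by rewrite divr_gt0 // ltr_wpDl.
have [h [h0 h1 h2 h3 h4]] : exists h : R, [/\ h != 0, F ^~ (x + h) @ \oo --> p (x + h),
    `|p' - h^-1 *: (p (h *: 1 + x) - p x)| <= e / 4,
    (forall n, `|F n (x + h) - F n x - h * G n| <= C * h ^+ 2) & `|h| <= e / 4 / (`|C| + 1)].
  near (0 : R)^' => h; exists h; split.
  - by near: h; exact: nbhs_dnbhs_neq.
  - by near: h; exact: (nbhs_dnbhs hF).
  - by near: h; move/cvgrPdist_le: dp; apply.
  - by near: h; exact: (nbhs_dnbhs hG).
  - by near: h; exact: dnbhs0_le.
have h0' : 0 < `|h| by rewrite normr_gt0.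
have eh : 0 < e / 4 * `|h| by rewrite mulr_gt0.
move/cvgrPdist_le/(_ _ eh): h1; move/cvgrPdist_le/(_ _ eh): Fx.
apply: filterS2 => n a1 a2.
have a3 : `|h * p' - (p (x + h) - p x)| <= e / 4 * `|h|.
  have -> : h * p' - (p (x + h) - p x) = h * (p' - h^-1 *: (p (h *: 1 + x) - p x)).
    rewrite -[h^-1 *: _]/(h^-1 * _) -[h *: 1]/(h * 1) mulr1 [h + x]addrC.
    by field.
  by rewrite normrM mulrC ler_wpM2r.
have a4 : `|F n (x + h) - F n x - h * G n| <= e / 4 * `|h|.
  apply: (le_trans (h3 n)); rewrite -real_normK ?num_real // expr2 mulrA ler_wpM2r //.
  apply: (@le_trans _ _ ((`|C| + 1) * `|h|)).
    by rewrite ler_wpM2r // (le_trans (ler_norm _)) // lerDl.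
  by rewrite mulrC -ler_pdivlMr // ltr_wpDl.
rewrite -(ler_pM2l h0') -normrM.
have -> : h * (p' - G n) = (h * p' - (p (x + h) - p x)) + (p (x + h) - F n (x + h))
    - (p x - F n x) + (F n (x + h) - F n x - h * G n) by ring.
apply: (@le_trans _ _ (e / 4 * `|h| + e / 4 * `|h| + e / 4 * `|h| + e / 4 * `|h|)); last first.
  by rewrite le_eqVlt; apply/orP; left; apply/eqP; field.
apply: (le_trans (ler_normD _ _)); apply: lerD => //.
apply: (le_trans (ler_normB _ _)); apply: lerD => //.
by apply: (le_trans (ler_normD _ _)); apply: lerD.
Unshelve. all: end_near. Qed.

Lemma expr_dist (u v h W : R) j : `|u| <= W -> `|v| <= W -> v - u = - (h * (u * v)) ->
  `|v ^+ j.+1 - u ^+ j.+1| <= j.+1%:R * `|h| * W ^+ j * `|u * v|.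
Proof.
move=> hu hv e; have W0 : 0 <= W by exact: le_trans hu.
elim: j => [|j IH]; first by rewrite !expr1 e normrN normrM expr0 mulr1 mul1r.
have -> : v ^+ j.+2 - u ^+ j.+2 = v * (v ^+ j.+1 - u ^+ j.+1) + (v - u) * u ^+ j.+1.
  by rewrite ![_ ^+ j.+2]exprS; ring.
apply: (le_trans (ler_normD _ _)).
apply: (@le_trans _ _ (W * (j.+1%:R * `|h| * W ^+ j * `|u * v|) + `|h| * `|u * v| * W ^+ j.+1)).
  apply: lerD; first by rewrite normrM ler_pM.
  rewrite e normrM normrN normrM normrX.
  by apply: ler_pM; rewrite ?mulr_ge0 ?lerXn2r ?nnegrE ?exprn_ge0 ?normr_ge0.
by rewrite -[j.+2%:R]natr1 [W ^+ j.+1]exprS le_eqVlt; apply/orP; left; apply/eqP; ring.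
Qed.

(** Meant for [u = 1 / (x + d)] and [v = 1 / (x + h + d)]. The remainder is quadratic in [h] and
    carries [u^2 + v^2], whose sum over [d] is bounded. *)
Lemma expr_taylor (u v h W : R) k : `|u| <= W -> `|v| <= W -> v - u = - (h * (u * v)) ->
  `|v ^+ k - u ^+ k + k%:R * h * u ^+ k.+1| <= k%:R ^+ 2 * h ^+ 2 * W ^+ k * (u ^+ 2 + v ^+ 2).
Proof.
move=> hu hv e; have W0 : 0 <= W by exact: le_trans hu.
have uv : `|u * v| <= u ^+ 2 + v ^+ 2.
  have := sqr_ge0 (`|u| - `|v|); rewrite normrM -[u ^+ 2]real_normK ?num_real //.
  rewrite -[v ^+ 2]real_normK ?num_real //.
  have := mulr_ge0 (normr_ge0 u) (normr_ge0 v); rewrite sqrrB; lra.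
suff : `|v ^+ k - u ^+ k + k%:R * h * u ^+ k.+1| <= k%:R ^+ 2 * h ^+ 2 * W ^+ k * `|u * v|.
  move/le_trans; apply; apply: ler_wpM2l => //.
  by apply: mulr_ge0; [apply: mulr_ge0; exact: sqr_ge0|exact: exprn_ge0].
elim: k => [|k IH]; first by rewrite !expr0 subrr !mul0r addr0 normr0 expr0n /= !mul0r.
have -> : v ^+ k.+1 - u ^+ k.+1 + k.+1%:R * h * u ^+ k.+2 =
   u * (v ^+ k - u ^+ k + k%:R * h * u ^+ k.+1) - h * u * (v ^+ k.+1 - u ^+ k.+1).
  have e0 : v - u + h * (u * v) = 0 by rewrite e addNr.
  apply/eqP; rewrite -subr_eq0; apply/eqP; rewrite -[RHS](mulr0 (v ^+ k)) -e0.
  by rewrite ![_ ^+ k.+2]exprS ![_ ^+ k.+1]exprS -natr1; ring.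
apply: (le_trans (ler_normB _ _)).
apply: (@le_trans _ _ (W * (k%:R ^+ 2 * h ^+ 2 * W ^+ k * `|u * v|) +
    `|h| * W * (k.+1%:R * `|h| * W ^+ k * `|u * v|))).
  apply: lerD; first by rewrite normrM ler_pM.
  rewrite 2!normrM ler_pM ?mulr_ge0 // ?ler_wpM2l //; exact: expr_dist.
have -> : `|h| * W * (k.+1%:R * `|h| * W ^+ k * `|u * v|) =
   k.+1%:R * h ^+ 2 * W ^+ k.+1 * `|u * v|.
  by rewrite -[h ^+ 2]real_normK ?num_real // [W ^+ k.+1]exprS; ring.
have -> : W * (k%:R ^+ 2 * h ^+ 2 * W ^+ k * `|u * v|) = k%:R ^+ 2 * (h ^+ 2 * W ^+ k.+1 * `|u * v|).
  by rewrite [W ^+ k.+1]exprS; ring.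
have cE (c : R) : c * h ^+ 2 * W ^+ k.+1 * `|u * v| = c * (h ^+ 2 * W ^+ k.+1 * `|u * v|) by ring.
rewrite !cE -mulrDl; apply: ler_wpM2r; first by apply: mulr_ge0 => //; apply: mulr_ge0; [exact: sqr_ge0|exact: exprn_ge0].
by rewrite -[k.+1%:R]natr1 sqrrD1; have := ler0n R k; lra.
Qed.

Lemma near_unit_itv x : 0 < x < 1 -> \forall h \near (0 : R), 0 < x + h < 1.
Proof.
move=> /andP[x0 x1].
have m0 : 0 < Num.min x (1 - x) by rewrite lt_min x0 subr_gt0.
near=> h; have : `|h| < Num.min x (1 - x).
  by near: h; apply/nbhs_ballP; exists (Num.min x (1 - x)) => // z; rewrite /ball /= sub0r normrN.
by rewrite lt_min !ltr_norml; lra.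
Unshelve. all: end_near. Qed.

Lemma shift_neq0 x M d : 0 < x < 1 -> d \in sint M -> x + d != 0.
Proof.
move=> /andP[x0 x1] /mapP[i _ ->]; rewrite addrA subr_eq0.
apply/eqP => e; have [im|mi] := ltnP i M.
  by move: im; rewrite -(ler_nat R) -natr1; lra.
by move: mi; rewrite -(ler_nat R); lra.
Qed.

(** From [s <= s^2 + 1], the square being one term of a sum bounded by [eis2 y], uniformly in [d]
    and [M]. *)
Lemma shift_inv_le y M d : 0 < y < 1 -> d \in sint M -> `|(y + d)^-1| <= eis2 y + 1.
Proof.
move=> y01 dM; apply: (@le_trans _ _ ((y + d)^-1 ^+ 2 + 1)); last first.
  rewrite lerD2r; apply: le_trans (eis2_le M y01).
  by rewrite /eis (big_rem d) //= lerDl sumr_ge0 // => i _; exact: sqr_ge0.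
rewrite -[_ ^+ 2]real_normK ?num_real //.
by have := sqr_ge0 (`|(y + d)^-1| - 1); have := normr_ge0 (y + d)^-1; rewrite sqrrB expr1n; lra.
Qed.

(** Each exponent follows from the previous one by differentiation. The remainders are uniform in
    [M], because [eis 2 M] is at most [eis2], which continuity bounds near [x]. *)
Lemma eis_cvg a x : 0 < x < 1 -> eis a.+2 ^~ x @ \oo --> (pP (pi ^+ 2) a).[tau x].
Proof.
elim: a x => [|a IH] x x01; first by rewrite -eis2E //; exact: eis2_cvg.
have dtau := is_derive_tau x01.
have dp : is_derive x 1 (fun y => (pP (pi ^+ 2) a).[tau y])
    ((pP (pi ^+ 2) a)^`().[tau x] * - (tau x ^+ 2 + pi ^+ 2)).
  exact: (@is_derive1_comp R (horner (pP (pi ^+ 2) a)) tau).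
have cont : {for x, continuous (fun y => ('X^2 + (pi ^+ 2)%:P).[tau y])}.
  apply: differentiable_continuous; apply/derivable1_diffP.
  by have [] := @is_derive1_comp R (horner ('X^2 + (pi ^+ 2)%:P)) tau x _ _ _ dtau.
have nB : \forall h \near (0 : R), eis2 (x + h) <= eis2 x + 1.
  have : \forall y \near x, `|('X^2 + (pi ^+ 2)%:P).[tau x] - ('X^2 + (pi ^+ 2)%:P).[tau y]| <= 1.
    by move/cvgrPdist_le: cont; apply.
  move=> /nbhs0P H; near=> h.
  have h01 : 0 < x + h < 1 by near: h; exact: near_unit_itv.
  rewrite !eis2E //.
  have : `|('X^2 + (pi ^+ 2)%:P).[tau x] - ('X^2 + (pi ^+ 2)%:P).[tau (x + h)]| <= 1 by near: h.
  by rewrite ler_norml; lra.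
set B := eis2 x + 1; set k := a.+2.
have term M y d : 0 < y < 1 -> d \in sint M -> eis2 y <= B -> `|(y + d)^-1| <= B + 1.
  by move=> y01 dM yB; apply: (le_trans (shift_inv_le y01 dM)); rewrite lerD2r.
have bound : \forall h \near (0 : R), forall M,
   `|eis k M (x + h) - eis k M x - h * (- k%:R * eis k.+1 M x)| <=
     k%:R ^+ 2 * (B + 1) ^+ k * (B + B) * h ^+ 2.
  near=> h => M.
  have h01 : 0 < x + h < 1 by near: h; exact: near_unit_itv.
  have hB : eis2 (x + h) <= B by near: h.
  have xB : eis2 x <= B by rewrite lerDl.
  have -> : eis k M (x + h) - eis k M x - h * (- k%:R * eis k.+1 M x) =
    \sum_(d <- sint M) ((x + h + d)^-1 ^+ k - (x + d)^-1 ^+ k + k%:R * h * (x + d)^-1 ^+ k.+1).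
    rewrite big_split sumrB /= -mulr_sumr /eis; congr (_ - _ + _); ring.
  apply: (le_trans (ler_norm_sum _ _ _)).
  apply: (@le_trans _ _ (\sum_(d <- sint M) k%:R ^+ 2 * h ^+ 2 * (B + 1) ^+ k *
     ((x + d)^-1 ^+ 2 + (x + h + d)^-1 ^+ 2))).
    rewrite big_seq [leRHS]big_seq; apply: ler_sum => d dM.
    apply: expr_taylor; [exact: term dM _|exact: term dM _|].
    have n1 := shift_neq0 x01 dM; have n2 := shift_neq0 h01 dM.
    by field; rewrite n1 n2.
  rewrite -mulr_sumr big_split /= -/(eis 2 M x) -/(eis 2 M (x + h)).
  have -> : k%:R ^+ 2 * (B + 1) ^+ k * (B + B) * h ^+ 2 = k%:R ^+ 2 * h ^+ 2 * (B + 1) ^+ k * (B + B) by ring.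
  apply: ler_wpM2l; last first.
    by apply: lerD; [exact: le_trans (eis2_le M x01) xB | exact: le_trans (eis2_le M h01) hB].
  apply: mulr_ge0; first by apply: mulr_ge0; exact: sqr_ge0.
  apply: exprn_ge0; rewrite addr_ge0 // (le_trans _ xB) // mulr_ge0 ?sqr_ge0 //.
  by rewrite invr_ge0 sqr_ge0.
have := diff_quot_cvg (F := eis k) (p := fun y => (pP (pi ^+ 2) a).[tau y]) _ dp bound.
move=> H; have {}H : (fun M => - k%:R * eis k.+1 M x) @ \oo -->
   (pP (pi ^+ 2) a)^`().[tau x] * - (tau x ^+ 2 + pi ^+ 2).
  apply: H; near=> h; apply: IH; near: h; exact: near_unit_itv.
have k0 : - k%:R != 0 :> R by rewrite oppr_eq0 pnatr_eq0.
rewrite (_ : eis a.+3 ^~ x = fun M => (- k%:R)^-1 * (- k%:R * eis k.+1 M x)); last first.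
  by apply/funext => M; rewrite mulKf.
have -> : (pP (pi ^+ 2) a.+1).[tau x] =
   (- k%:R)^-1 * ((pP (pi ^+ 2) a)^`().[tau x] * - (tau x ^+ 2 + pi ^+ 2)).
  rewrite /= !hornerE /= -/k invrN; ring.
exact: cvgMr.
Unshelve. all: end_near. Qed.

End Eisenstein.

(** * Ordered sums of inverse powers as limits *)

Lemma ssum_iota (V : nmodType) (T : Type) (f : nat -> T) (F : seq T -> T -> seq T -> V) b n :
  ssum [seq f j | j <- iota b n] F =
  \sum_(i < n) F [seq f j | j <- iota b i] (f (b + i)%N) [seq f j | j <- iota (b + i).+1 (n - i.+1)].
Proof.
elim: n b F => [|n IH] b F; first by rewrite big_ord0.
rewrite big_ord_recl /= addn0 subn1 IH; congr (_ + _); apply: eq_bigr => i _.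
by rewrite /bump leq0n add0n !add1n addSnnS subSS.
Qed.

Lemma big_iota_ord (V : nmodType) n (F : nat -> V) : \sum_(i <- iota 0 n) F i = \sum_(i < n) F i.
Proof. by rewrite -(big_mkord xpredT F) /index_iota subn0. Qed.

Lemma ssum_sum (V : nmodType) (T I : Type) (l : seq T) (r : seq I) (F : I -> seq T -> T -> seq T -> V) :
  ssum l (fun p a q => \sum_(i <- r) F i p a q) = \sum_(i <- r) ssum l (F i).
Proof.
elim: r => [|i r IH].
  rewrite big_nil -[RHS](ssum_zero V l); apply: eq_ssum => p a q _; exact: big_nil.
by rewrite big_cons -IH -ssumD; apply: eq_ssum => p a q _; rewrite big_cons.
Qed.

Section Rates.
Variables (R : realType) (T : Type) (r : T -> R).
Hypothesis r_itv : forall t, 0 <= r t <= 2.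

(** Mere convergence does not suffice, since the errors at all poles are added up later. *)
Definition rate (u : T -> R) (l : R) := exists2 C, 0 <= C & forall t, `|u t - l| <= C * r t.

Let r_ge0 t : 0 <= r t. Proof. by have /andP[] := r_itv t. Qed.

Lemma rate_cst c : rate (fun=> c) c.
Proof. by exists 0 => // t; rewrite subrr normr0 mul0r. Qed.

Lemma rate_ext u v l : (forall t, u t = v t) -> rate u l -> rate v l.
Proof. by move=> e [C C0 h]; exists C => // t; rewrite -e. Qed.

Lemma rateD u v l l' : rate u l -> rate v l' -> rate (fun t => u t + v t) (l + l').
Proof.
move=> [C C0 h] [C' C0' h']; exists (C + C'); first exact: addr_ge0.
by move=> t; rewrite opprD addrACA mulrDl (le_trans (ler_normD _ _)) // lerD.
Qed.

Lemma rateM u v l l' : rate u l -> rate v l' -> rate (fun t => u t * v t) (l * l').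
Proof.
move=> [C C0 h] [C' C0' h']; exists (C * (`|l'| + C' * 2) + `|l| * C').
  by rewrite addr_ge0 ?mulr_ge0 ?addr_ge0 ?mulr_ge0.
move=> t; have -> : u t * v t - l * l' = (u t - l) * v t + l * (v t - l') by ring.
apply: (le_trans (ler_normD _ _)); rewrite [leRHS]mulrDl; apply: lerD; last first.
  by rewrite normrM -mulrA ler_wpM2l.
rewrite normrM mulrAC; apply: ler_pM => //.
have -> : v t = l' + (v t - l') by ring.
apply: (le_trans (ler_normD _ _)); rewrite lerD2l (le_trans (h' t)) //.
by rewrite ler_wpM2l //; have /andP[] := r_itv t.
Qed.

Lemma rateZ c u l : rate u l -> rate (fun t => c * u t) (c * l).
Proof. by apply: rateM; exact: rate_cst. Qed.

Lemma rate_sum (I : Type) (s : seq I) (P : pred I) (F : I -> T -> R) G :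
  (forall i, P i -> rate (F i) (G i)) ->
  rate (fun t => \sum_(i <- s | P i) F i t) (\sum_(i <- s | P i) G i).
Proof.
move=> h; elim: s => [|i s IH].
  by apply: rate_ext (rate_cst _) => t; rewrite !big_nil.
rewrite big_cons; case: (boolP (P i)) => hi.
  by apply: rate_ext (rateD (h i hi) IH) => t; rewrite big_cons hi.
by apply: rate_ext IH => t; rewrite big_cons (negPf hi).
Qed.

Lemma rate_ssum (X : Type) (l : seq X) (F : T -> seq X -> X -> seq X -> R) G :
  (forall p a q, l = p ++ a :: q -> rate (fun t => F t p a q) (G p a q)) ->
  rate (fun t => ssum l (F t)) (ssum l G).
Proof.
elim: l F G => [|a l IH] F G h /=; first exact: rate_cst.
apply: rateD; first exact: (h [::] a l).
by apply: (IH (fun t p => F t (a :: p))) => p b q e; apply: h; rewrite e.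
Qed.

Lemma rate_wder (f : T -> seq nat -> R) (g : seq nat -> R) m :
  (forall m, rate (f ^~ m) (g m)) -> rate (fun t => wder (f t) m) (wder g m).
Proof.
elim: m f g => [|a m IH] f g h /=; first exact: rate_cst.
apply: rateD; last by apply: (IH (fun t v => f t (a :: v))) => m'; exact: h.
rewrite -mulr_natl; apply: rate_ext (rateZ a.+2%:R (h (a.+1 :: m))) => t.
by rewrite mulr_natl.
Qed.

End Rates.

(** * Rates of convergence for ordered sums over positive integers *)

Section ZetaRates.
Variable R : realType.
Local Open Scope classical_set_scope.

Definition inv1 B : seq R := [seq j%:R^-1 | j <- iota 1 B].

Lemma hs_subs (A : comNzRingType) (y : nat -> A) l m :
  hs [seq y j | j <- l] m =
  \sum_(s <- subs (size m) l) \prod_(j < size m) y (nth 0%N s j) ^+ (nth 0%N m j).+2.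
Proof.
elim: l m => [|x l IH] [|a m] /=.
- by rewrite hs0 big_seq1 big_ord0.
- by rewrite hs0 big_nil.
- by rewrite hs_nil big_seq1 big_ord0.
rewrite hs_cons big_cat /= big_map addrC !IH; congr (_ + _).
by rewrite mulr_sumr; apply: eq_bigr => s _; rewrite big_ord_recl.
Qed.

Lemma zeta_partial_hs m B : zeta_partial R [seq a.+2 | a <- m] B.+1 = hs (inv1 B) m.
Proof.
rewrite /inv1 hs_subs -sum_incr /zeta_partial size_map; apply: eq_bigr => u _.
apply: eq_bigr => j _; rewrite (nth_map 0%N) // exprVn; congr (_ ^- _).
by rewrite (nth_map j) ?size_enum_ord // nth_ord_enum.
Qed.

Definition inv_succ (B : nat) : R := B.+1%:R^-1.

Lemma inv_succ_itv B : 0 <= inv_succ B <= 2.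
Proof.
rewrite /inv_succ invr_ge0 ler0n /= (@le_trans _ _ 1) ?ler1n //.
by rewrite invf_le1 ?ltr0n // ler1n.
Qed.

Lemma inv_succ_diff B : inv_succ B ^+ 2 <= 2 * (inv_succ B - inv_succ B.+1).
Proof.
have b0 : 0 <= B%:R :> R := ler0n R B.
rewrite /inv_succ -subr_ge0 -[B.+2%:R]natr1 -[B.+1%:R]natr1.
have n1 : B%:R + 1 != 0 :> R by rewrite gt_eqF // ltr_wpDl.
have n2 : B%:R + 1 + 1 != 0 :> R by rewrite gt_eqF // ltr_wpDl // addr_ge0.
have -> : 2 * ((B%:R + 1)^-1 - (B%:R + 1 + 1)^-1) - (B%:R + 1)^-1 ^+ 2 =
    B%:R / ((B%:R + 1) ^+ 2 * (B%:R + 1 + 1)) :> R by field; rewrite n1 n2.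
by rewrite divr_ge0 // mulr_ge0 ?sqr_ge0 // !addr_ge0.
Qed.

(** The new item adds a bounded value times a power of [inv_succ B] with exponent at least 2, and
    this telescopes by [inv_succ_diff]. *)
Lemma hs_inv1_growth m : exists2 C, 0 <= C & forall B B', (B <= B')%N ->
  0 <= hs (inv1 B') m - hs (inv1 B) m <= C * (inv_succ B - inv_succ B').
Proof.
elim/last_ind: m => [|m a [C C0 IH]].
  by exists 0 => // B B' _; rewrite !hs_nil subrr mul0r lexx.
have inv1S B : inv1 B.+1 = rcons (inv1 B) (inv_succ B).
  have e : iota 1 B.+1 = rcons (iota 1 B) B.+1 by rewrite -cats1 -[B.+1 in LHS]addn1 iotaD add1n.
  by rewrite /inv1 e map_rcons.
have ge0 B : 0 <= hs (inv1 B) m.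
  have /andP[+ _] := IH 0%N B (leq0n _); rewrite subr_ge0; apply: le_trans.
  by rewrite /inv1 hs0; case: (m).
have le1 B : hs (inv1 B) m <= 1 + C.
  have /andP[_] := IH 0%N B (leq0n _); rewrite lerBlDl => /le_trans; apply; apply: lerD.
    by rewrite /inv1 hs0; case: (m).
  rewrite -[leRHS]mulr1 ler_wpM2l // /inv_succ invr1 gerBl invr_ge0 //.
have step B : 0 <= hs (inv1 B.+1) (rcons m a) - hs (inv1 B) (rcons m a) <=
    (1 + C) * 2 * (inv_succ B - inv_succ B.+1).
  rewrite inv1S hs_rcons addrAC subrr add0r; have /andP[i0 i2] := inv_succ_itv B.
  rewrite mulr_ge0 ?exprn_ge0 //= -mulrA ler_pM ?exprn_ge0 //.
  apply: le_trans (inv_succ_diff B).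
  have i1 : inv_succ B <= 1 by rewrite /inv_succ invf_le1 ?ltr0n // ler1n.
  by rewrite -addn2 exprD ler_piMl ?sqr_ge0 // exprn_ile1.
exists ((1 + C) * 2); first by rewrite mulr_ge0 // addr_ge0.
move=> B; elim=> [|B' IHB]; first by rewrite leqn0 => /eqP ->; rewrite !subrr mulr0 lexx.
rewrite leq_eqVlt => /predU1P[->|]; first by rewrite !subrr mulr0 lexx.
rewrite ltnS => /IHB /andP[h1 h2]; have /andP[s1 s2] := step B'.
have -> : hs (inv1 B'.+1) (rcons m a) - hs (inv1 B) (rcons m a) =
   (hs (inv1 B'.+1) (rcons m a) - hs (inv1 B') (rcons m a)) +
   (hs (inv1 B') (rcons m a) - hs (inv1 B) (rcons m a)) by ring.
rewrite addr_ge0 //=; apply: (le_trans (lerD s2 h2)).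
by rewrite -mulrDr ler_wpM2l ?mulr_ge0 ?addr_ge0 //; lra.
Qed.

Lemma zeta_cvg m : (fun B => hs (inv1 B) m) @ \oo --> zeta R [seq a.+2 | a <- m].
Proof.
have [C C0 h] := hs_inv1_growth m.
have cv : (fun B => hs (inv1 B) m) @ \oo --> limn (fun B => hs (inv1 B) m).
  apply: nondecreasing_is_cvgn.
    by move=> B B' BB'; have /andP[+ _] := h _ _ BB'; rewrite subr_ge0.
  exists (hs (inv1 0) m + C) => _ [B _ <-]; have /andP[_] := h _ _ (leq0n B).
  rewrite lerBlDl => /le_trans; apply; rewrite lerD2l -[leRHS]mulr1 ler_wpM2l //.
  by rewrite /inv_succ invr1 gerBl invr_ge0.
have e : (fun B => hs (inv1 B) m) = [sequence zeta_partial R [seq a.+2 | a <- m] n.+1]_n.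
  by apply/funext => B; rewrite /= zeta_partial_hs.
suff -> : zeta R [seq a.+2 | a <- m] = limn (fun B => hs (inv1 B) m) by [].
apply: (cvg_lim (@Rhausdorff R)); move: cv.
by rewrite {1}e cvg_shiftS.
Qed.

Lemma zeta_rate m : rate inv_succ (fun B => hs (inv1 B) m) (zeta R [seq a.+2 | a <- m]).
Proof.
have [C C0 h] := hs_inv1_growth m; have zc := @zeta_cvg m.
exists C => // B; rewrite distrC ger0_norm.
  rewrite -(cvg_lim (@Rhausdorff R) zc) lerBlDr; apply: limr_le; first by apply/cvg_ex; exists (zeta R [seq a.+2 | a <- m]).
  near=> B'; have BB' : (B <= B')%N by near: B'; exact: nbhs_infty_ge.
  have /andP[_] := h _ _ BB'; rewrite lerBlDr => /le_trans; apply.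
  by rewrite lerD2r ler_wpM2l // gerBl invr_ge0.
rewrite subr_ge0 -(cvg_lim (@Rhausdorff R) zc); apply: limr_ge; first by apply/cvg_ex; exists (zeta R [seq a.+2 | a <- m]).
near=> B'; have BB' : (B <= B')%N by near: B'; exact: nbhs_infty_ge.
by have /andP[] := h _ _ BB'; rewrite subr_ge0.
Unshelve. all: end_near. Qed.

(** A factor [1 / M] splits off each term and leaves inverses whose squares have bounded sums. By
    [|t| <= d + t^2 / d] the inverses sum to at most a small multiple of [M] plus a constant. *)
Lemma near_sum_cvg0 x : 0 < x < 1 ->
  (fun M : nat => \sum_(i < M + M.+1) `|(x + (i%:R - M%:R))^-1| * (inv_succ i + inv_succ (M + M - i)))
  @ \oo --> (0 : R).
Proof.
move=> x01; have [x0 x1] := andP x01; set B := eis2 x.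
have rsum n : \sum_(i < n) inv_succ i ^+ 2 <= 2.
  apply: (@le_trans _ _ (2 * (inv_succ 0 - inv_succ n))); last first.
    by rewrite -[leRHS]mulr1 ler_wpM2l // /inv_succ invr1 gerBl invr_ge0.
  elim: n => [|n IH]; first by rewrite big_ord0 subrr mulr0.
  rewrite big_ord_recr /=; apply: (le_trans (lerD IH (inv_succ_diff n))).
  by rewrite -mulrDr ler_wpM2l //; lra.
have B0 : 0 <= B by rewrite /B /eis2 mulr_ge0 ?sqr_ge0 // invr_ge0 sqr_ge0.
have yE M (i : 'I_(M + M.+1)) : x + (i%:R - M%:R) != 0.
  apply: (@shift_neq0 _ x M _ x01); apply/mapP; exists (i : nat) => //.
  by rewrite mem_iota add0n ltn_ord.
(* [1/(y s) = (1/y + 1/s) / (y + s)] *)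
have prodB (y s m : R) : y != 0 -> 0 < s -> 0 < m -> m <= `|y| + s ->
    `|y^-1| * s^-1 <= m^-1 * (`|y^-1| + s^-1).
  move=> y0 s0 m0 h; have y0' : 0 < `|y| by rewrite normr_gt0.
  rewrite normfV; have -> : `|y|^-1 + s^-1 = (`|y| + s) * (`|y|^-1 * s^-1).
    by field; rewrite gt_eqF // gt_eqF.
  rewrite mulrA ler_peMl ?mulr_ge0 ?invr_ge0 ?(ltW s0) //.
  by rewrite mulrC ler_pdivlMr // mul1r.
have amgm (t d : R) : 0 < d -> `|t| <= d + t ^+ 2 / d.
  move=> d0; have -> : d + t ^+ 2 / d = (d ^+ 2 + t ^+ 2) / d by field; rewrite gt_eqF.
  rewrite ler_pdivlMr // -[t ^+ 2]real_normK ?num_real //.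
  have := sqr_ge0 (`|t| - d); have := mulr_ge0 (normr_ge0 t) (ltW d0); rewrite sqrrB; lra.
have bnd M d : (0 < M)%N -> 0 < d ->
   \sum_(i < M + M.+1) `|(x + (i%:R - M%:R))^-1| * (inv_succ i + inv_succ (M + M - i)) <=
   M%:R^-1 * (4 * (M + M.+1)%:R * d + (2 * B + 4) / d).
  move=> M0 d0; have M0' : 0 < M%:R :> R by rewrite ltr0n.
  apply: (@le_trans _ _ (\sum_(i < M + M.+1) M%:R^-1 * (2 * `|(x + (i%:R - M%:R))^-1| +
      (`|inv_succ i| + `|inv_succ (M + M - i)|)))).
    apply: ler_sum => i _.
    have i1 : 0 < i.+1%:R :> R by rewrite ltr0n.
    have i2 : 0 < (M + M - i).+1%:R :> R by rewrite ltr0n.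
    have -> : `|inv_succ i| = inv_succ i by rewrite ger0_norm // invr_ge0.
    have -> : `|inv_succ (M + M - i)| = inv_succ (M + M - i) by rewrite ger0_norm // invr_ge0.
    have h1 : M%:R <= `|x + (i%:R - M%:R)| + i.+1%:R.
      by rewrite -natr1; have := ler_norm (- (x + (i%:R - M%:R))); rewrite normrN; lra.
    have h2 : M%:R <= `|x + (i%:R - M%:R)| + (M + M - i).+1%:R.
      rewrite -natr1 natrB; last by have := ltn_ord i; lia.
      by rewrite natrD; have := ler_norm (x + (i%:R - M%:R)); lra.
    rewrite mulrDr.
    have := prodB _ _ _ (yE M i) i1 M0' h1; have := prodB _ _ _ (yE M i) i2 M0' h2.
    rewrite -/(inv_succ i) -/(inv_succ (M + M - i)) !mulrDr; lra.
  rewrite -mulr_sumr ler_pM2l ?invr_gt0 // big_split big_split /= -mulr_sumr.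
  have S (u : 'I_(M + M.+1) -> R) D : \sum_i u i ^+ 2 <= D ->
      \sum_i `|u i| <= (M + M.+1)%:R * d + D / d.
    move=> h; apply: (@le_trans _ _ (\sum_i (d + u i ^+ 2 / d))); first by apply: ler_sum => i _; exact: amgm.
    rewrite big_split /= sumr_const card_ord mulr_natl lerD2l -mulr_suml.
    by rewrite ler_wpM2r // invr_ge0 ltW.
  have s1 := S (fun i => (x + (i%:R - M%:R))^-1) B.
  have s2 := S (fun i => inv_succ i) 2 (rsum _).
  have s3 := S (fun i => inv_succ (M + M - i)) 2.
  have {}s1 : \sum_(i < M + M.+1) `|(x + (i%:R - M%:R))^-1| <= (M + M.+1)%:R * d + B / d.
    apply: s1; apply: le_trans (eis2_le M x01); rewrite /eis /sint big_map.
    by rewrite big_iota_ord.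
  have {}s3 : \sum_(i < M + M.+1) `|inv_succ (M + M - i)| <= (M + M.+1)%:R * d + 2 / d.
    apply: s3; rewrite (reindex_inj rev_ord_inj) /=; apply: le_trans (rsum (M + M.+1)).
    apply: ler_sum => i _.
    by have -> : (M + M - (M + M.+1 - i.+1) = i)%N by (have := ltn_ord i; lia).
  have -> : 4 * (M + M.+1)%:R * d + (2 * B + 4) / d = 2 * ((M + M.+1)%:R * d + B / d) +
     (((M + M.+1)%:R * d + 2 / d) + ((M + M.+1)%:R * d + 2 / d)) by field; rewrite gt_eqF.
  by apply: lerD; [rewrite ler_wpM2l | apply: lerD].
apply/cvgrPdist_le => e e0.
(* Since [2 M + 1 <= 3 M], this choice gives [4 (2 M + 1) d <= M e / 2]. *)
pose d := e / 24; have d0 : 0 < d by rewrite divr_gt0.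
pose n := Num.bound ((2 * B + 4) / d / (e / 2)).
have nh : (2 * B + 4) / d / (e / 2) <= n%:R.
  rewrite ltW // archi_boundP //; apply: divr_ge0; last by apply: divr_ge0 => //; exact: ltW.
  by apply: divr_ge0; [apply: addr_ge0 => //; apply: mulr_ge0 | exact: ltW].
exists n.+1 => // M /= hM.
have M0' : 0 < M%:R :> R by rewrite ltr0n; apply: leq_trans hM.
rewrite sub0r normrN ger0_norm; last first.
  by apply: sumr_ge0 => i _; rewrite mulr_ge0 // addr_ge0 // invr_ge0.
apply: (le_trans (bnd M d _ d0)); first exact: leq_trans hM.
rewrite mulrC ler_pdivrMr //.
have M1 : 1 <= M%:R :> R by rewrite ler1n; apply: leq_trans hM.
have nM : n%:R <= M%:R :> R by rewrite ler_nat ltnW.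
have k1 : (2 * B + 4) / d <= e / 2 * M%:R.
  by rewrite [leRHS]mulrC -ler_pdivrMr ?divr_gt0 //; exact: le_trans nM.
have k2 : 4 * (M + M.+1)%:R * d <= e / 2 * M%:R.
  have -> : (M + M.+1)%:R = 2 * M%:R + 1 :> R by rewrite natrD -natr1; ring.
  have := ler_wpM2r (ltW d0) M1; rewrite /d; lra.
lra.
Qed.

End ZetaRates.

(** * Limits of the Taylor coefficients at a pole *)

Section TaylorLimits.
Variables (R : realType) (Phi Phi' : ncs bool R).
Hypothesis PhiG : grouplike (fun _ _ => [::]) Phi.
Hypothesis Phi_nil : Phi [::] = 1.
Hypothesis PhiK : Phi' * Phi = 1.
Hypothesis Phi_0 : Phi [:: false] = 0.
Hypothesis Phi_zeta : forall m, Phi (yword m) = zeta R [seq a.+2 | a <- m].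
Variable N : nat.
Local Open Scope classical_set_scope.

Lemma tcf0_hs (ds : seq R) m : tcf 0 (hs [seq einv N d | d <- ds] m) = hs [seq d^-1 | d <- ds] m.
Proof.
elim: ds m => [|d ds IH] m /=.
  by rewrite !hs0; case: m => [|a m]; rewrite ?tcf0 ?tcf1.
case: m => [|a m]; first by rewrite !hs_nil tcf1.
rewrite !hs_cons tcfD IH tcfM // big_ord1 IH; congr (_ + _ * _).
elim: a.+2 => [|k IHk]; first by rewrite !expr0 tcf1.
by rewrite !exprS tcfM // big_ord1 IHk tcf_einv // expr0 mul1r expr1.
Qed.

Lemma tcf_wder s (f : seq nat -> tq R N) m : tcf s (wder f m) = wder (fun v => tcf s (f v)) m.
Proof. by elim: m f => [|a m IH] f /=; rewrite ?tcf0 // tcfD tcfMn IH. Qed.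

Lemma hs_revl (A : comNzRingType) (s : seq A) m : hs (rev s) m = hs s (rev m).
Proof. by rewrite -{1}(revK m) hs_rev. Qed.

Definition posH B : ncs nat (tq R N) := hs [seq einv N d | d <- [seq j%:R | j <- iota 1 B]].
Definition negH A : ncs nat (tq R N) :=
  hs [seq einv N (- d) | d <- [seq j%:R | j <- rev (iota 1 A)]].

(** Both sides satisfy the same recursion in [s], by [hs_taylor] and [Phi_zeros_rec], and start from
    zeta values. *)
Lemma posH_rate s m : (s <= N)%N ->
  rate (@inv_succ R) (fun B => tcf s (posH B m)) (Phi (nseq s false ++ yword m)).
Proof.
elim: s m => [|s IH] m sN.
  rewrite /= Phi_zeta; apply: rate_ext (zeta_rate R m) => B.
  by rewrite /posH tcf0_hs -map_comp.
have s0 : s.+1%:R != 0 :> R by rewrite pnatr_eq0.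
have -> : Phi (nseq s.+1 false ++ yword m) =
    - (s.+1%:R)^-1 * wder (fun v => Phi (nseq s false ++ yword v)) m.
  rewrite mulNr -mulrN -(Phi_zeros_rec PhiG Phi_0) -[Phi _ *+ _]mulr_natl mulKf //.
have := rate_wder (@inv_succ_itv R) m (fun m' => IH m' (ltnW sN)).
move=> /(rateZ (@inv_succ_itv R) (- (s.+1%:R)^-1)); apply: rate_ext => B.
by rewrite -tcf_wder mulNr -mulrN -(hs_taylor _ m sN) mulKf.
Qed.

Lemma weight_rev m : weight (rev m) = weight m.
Proof. by rewrite /weight map_rev sumn_rev. Qed.

Lemma size_yword m : size (yword m) = weight m.
Proof.
elim: m => [|a m IH]; first by [].
by rewrite yword_cons /= size_cat size_nseq IH /weight /= !addSn.
Qed.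

Lemma size_negw m s : size (negw m s) = (weight m + s)%N.
Proof. by rewrite -size_rev negw_rev size_cat size_nseq size_yword weight_rev addnC. Qed.

(** Reflection turns sums over negative integers into sums over positive ones, with the reversal and
    the sign of the antipode. *)
Lemma negH_rate s m : (s <= N)%N ->
  rate (@inv_succ R) (fun A => tcf s (negH A m)) (Phi' (negw m s)).
Proof.
move=> sN; rewrite (antipode PhiG PhiK Phi_nil) size_negw negw_rev.
apply: rate_ext (rateZ (@inv_succ_itv R) ((-1) ^+ (weight m + s)) (posH_rate (rev m) sN)) => A.
rewrite /negH hs_reflected // /posH !map_rev hs_revl addnC exprD -mulrA.
congr (_ * _); rewrite -[(-1) ^+ weight m]signr_odd -[(-1) ^+ weight m]signr_odd.
by case: (odd _); rewrite ?expr0 ?mul1r // !expr1 !mulN1r tcfN.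
Qed.

Definition pair_inv (AB : nat * nat) : R := inv_succ R AB.1 + inv_succ R AB.2.

Definition rate2 := @rate R (nat * nat) (fun AB => pair_inv AB / 2).

Lemma pair_inv_itv AB : 0 <= pair_inv AB / 2 <= 2.
Proof.
have /andP[h1 h2] := inv_succ_itv R AB.1; have /andP[h3 h4] := inv_succ_itv R AB.2.
by rewrite /pair_inv; apply/andP; split; lra.
Qed.

Lemma rate_fst u l : rate (@inv_succ R) u l -> rate2 (fun AB => u AB.1) l.
Proof.
move=> [C C0 h]; exists (C * 2); first exact: mulr_ge0.
move=> AB; apply: (le_trans (h _)); rewrite -mulrA ler_wpM2l // /pair_inv.
by have /andP[h3 h4] := inv_succ_itv R AB.2; lra.
Qed.

Lemma rate_snd u l : rate (@inv_succ R) u l -> rate2 (fun AB => u AB.2) l.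
Proof.
move=> [C C0 h]; exists (C * 2); first exact: mulr_ge0.
move=> AB; apply: (le_trans (h _)); rewrite -mulrA ler_wpM2l // /pair_inv.
by have /andP[h3 h4] := inv_succ_itv R AB.1; lra.
Qed.

(** The coefficient of the pole of order [k + 1] in the finite sum, for a pole with [A] items before
    it and [B] after it. *)
Definition kapH (A B : nat) (m : seq nat) (k : nat) : R :=
  ssum m (fun m' a m'' =>
    if (k <= a.+1)%N then tcf (a.+1 - k) (negH A m' * posH B m'') else 0).

Lemma kapH_rate m k : m != [::] -> (weight m <= N)%N ->
  rate2 (fun AB => kapH AB.1 AB.2 m k) (kap Phi Phi' m k).
Proof.
move=> m0 mN; rewrite kapE //; apply: rate_ssum => p a q e.
have aN : (a.+2 <= N)%N.
  by move: mN; rewrite e /weight map_cat sumn_cat /=; lia.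
have -> : \sum_(s < a.+2 | (s + k <= a.+1)%N)
     Phi' (negw p s) * Phi (nseq (a.+1 - s - k) false ++ yword q) =
   if (k <= a.+1)%N then \sum_(s < (a.+1 - k).+1)
     Phi' (negw p s) * Phi (nseq (a.+1 - k - s) false ++ yword q) else 0.
  case: ifP => ka; last first.
    by rewrite big_pred0 // => s; apply/negP => h; move/negP: ka; apply; apply: leq_trans h; rewrite leq_addl.
  rewrite -(big_mkord (fun s => (s + k <= a.+1)%N)
     (fun s => Phi' (negw p s) * Phi (nseq (a.+1 - s - k) false ++ yword q))).
  rewrite -(big_mkord xpredT (fun s => Phi' (negw p s) * Phi (nseq (a.+1 - k - s) false ++ yword q))).
  rewrite [RHS](big_nat_widen 0 (a.+1 - k).+1 a.+2) /=; last by lia.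
  by apply: eq_big => [s|s _]; [rewrite ltnS leq_subRL // addnC | rewrite subnAC].
case: ifP => ka; last exact: rate_cst.
apply: (rate_ext (u := fun AB => \sum_(s < (a.+1 - k).+1)
   tcf s (negH AB.1 p) * tcf (a.+1 - k - s) (posH AB.2 q))).
  by move=> AB; rewrite tcfM //; lia.
apply: rate_sum => // s _; apply: (rateM pair_inv_itv).
  by apply: (rate_fst (u := fun A => tcf s (negH A p))); apply: negH_rate; have := ltn_ord s; lia.
apply: (rate_snd (u := fun B => tcf (a.+1 - k - s) (posH B q))); apply: posH_rate; lia.
Qed.

Lemma Hl_neg M i : Hl N [seq j%:R - M%:R | j <- iota 0 i] (i%:R - M%:R) = negH i.
Proof.
rewrite /Hl /negH; congr hs; rewrite -!map_comp.
have -> : rev (iota 1 i) = [seq (i - j)%N | j <- iota 0 i].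
  elim: i => [|i IH] //; rewrite -{1}[i.+1]addn1 iotaD rev_cat add1n IH /= subn0; congr (_ :: _).
  by rewrite -[1%N]addn0 iotaDl -map_comp; apply: eq_map.
rewrite -map_comp; apply/eq_in_map => j; rewrite mem_iota add0n => /andP[_ ji] /=.
by rewrite natrB ?(ltnW ji) //; congr einv; ring.
Qed.

Lemma Hl_pos M i n : Hl N [seq j%:R - M%:R | j <- iota i.+1 n] (i%:R - M%:R) = posH n.
Proof.
rewrite /Hl /posH; congr hs; rewrite -addn1 iotaDl -!map_comp; apply: eq_map => j /=.
by rewrite natrD; congr einv; ring.
Qed.

Lemma hs_sint M x m : 0 < x < 1 -> m != [::] -> (weight m <= N)%N ->
  hs [seq (x + d)^-1 | d <- sint R M] m =
  \sum_(k < N) \sum_(i < M + M.+1)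
    kapH i (M + M - i) m k * (x + (i%:R - M%:R))^-1 ^+ k.+1.
Proof.
move=> x01 m0 mN.
rewrite (@partial_fractions R N R idfun x (fun d => (x + d)^-1)) //; first last.
- apply/allP => a am; move: mN; move: am => /splitPr[p q].
  by rewrite /weight map_cat sumn_cat /=; lia.
- by move=> d dM; rewrite mulfV //; exact: shift_neq0 dM.
- rewrite map_inj_uniq ?iota_uniq // => i j /eqP.
  by rewrite (inj_eq (addIr _)) eqr_nat => /eqP.
rewrite exchange_big /= /sint ssum_iota; apply: eq_bigr => i _.
rewrite add0n Hl_neg Hl_pos.
have -> : (M + M.+1 - i.+1 = M + M - i)%N by lia.
have -> : \sum_(k < N) kapH i (M + M - i) m k * (x + (i%:R - M%:R))^-1 ^+ k.+1 =
   ssum m (fun p a q => \sum_(k < N) (if (k <= a.+1)%N then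
     tcf (a.+1 - k) (negH i p * posH (M + M - i) q) else 0) * (x + (i%:R - M%:R))^-1 ^+ k.+1).
  rewrite ssum_sum; apply: eq_bigr => k _.
  rewrite (ssum_morph (f := fun y => y * (x + (i%:R - M%:R))^-1 ^+ k.+1)) ?mul0r //.
  by move=> y y'; rewrite mulrDl.
apply: eq_ssum => p a q e.
have aN : (a.+2 <= N)%N by move: mN; rewrite e /weight map_cat sumn_cat /=; lia.
rewrite /pol (reindex_inj rev_ord_inj) /=.
rewrite -(big_mkord xpredT (fun k => tcf (a.+2 - k.+1) (negH i p * posH (M + M - i) q) *
   (x + (i%:R - M%:R))^-1 ^+ (a.+2 - (a.+2 - k.+1)))).
rewrite -(big_mkord xpredT (fun k => (if (k <= a.+1)%N then
     tcf (a.+1 - k) (negH i p * posH (M + M - i) q) else 0) * (x + (i%:R - M%:R))^-1 ^+ k.+1)).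
rewrite (big_nat_widen 0 a.+2 N) //= big_mkcond /=; apply: eq_big_nat => k _.
rewrite ltnS; case: ifP => ka; last by rewrite mul0r.
by rewrite subKn.
Qed.

(** [pP k] represents the sum of the [(x + n)^-(k + 2)], the poles of order [k + 2]; the shift to
    [kap m k.+1] passes over the absent simple poles. *)
Definition Fp (m : seq nat) : {poly R} :=
  (m == [::])%:R + \sum_(k < (weight m).-1) kap Phi Phi' m k.+1 *: pP (pi ^+ 2) k.

End TaylorLimits.

(** * The polynomials in the cotangent and their harmonic product *)

Section HarmonicPolynomials.
Variables (R : realType) (Phi Phi' : ncs bool R).
Hypothesis PhiG : grouplike (fun _ _ => [::]) Phi.
Hypothesis Phi_nil : Phi [::] = 1.
Hypothesis PhiK : Phi' * Phi = 1.
Hypothesis Phi_0 : Phi [:: false] = 0.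
Hypothesis Phi_zeta : forall m, Phi (yword m) = zeta R [seq a.+2 | a <- m].
Local Open Scope classical_set_scope.
Local Notation F := (Fp Phi Phi').

Lemma hs_sint_cvg x m : 0 < x < 1 ->
  (fun M => hs [seq (x + d)^-1 | d <- sint R M] m) @ \oo --> (F m).[tau x].
Proof.
move=> x01; case: (eqVneq m [::]) => [->|m0].
  rewrite (_ : (fun M => _) = fun=> 1); last by apply/funext => M; rewrite hs_nil.
  rewrite /Fp /weight /= big_ord0 addr0 hornerE; exact: cvg_cst.
pose N := weight m.
have [n nN] : exists n, N = n.+1.
  by case: m m0 @N => // a m _; exists (a.+1 + weight m)%N; rewrite /weight.
have key k : (fun M : nat => \sum_(i < M + M.+1)
    @kapH R N i (M + M - i) m k * (x + (i%:R - M%:R))^-1 ^+ k.+1) @ \oo -->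
    (if k is k'.+1 then kap Phi Phi' m k * (pP (pi ^+ 2) k').[tau x] else 0).
  have [C C0 h] := kapH_rate PhiG Phi_nil PhiK Phi_0 Phi_zeta k m0 (leqnn N).
  have eE M : eis k.+1 M x = \sum_(i < M + M.+1) (x + (i%:R - M%:R))^-1 ^+ k.+1.
    by rewrite /eis /sint big_map big_iota_ord.
  (* The coefficient at each pole is its limit plus an error. The limit leaves [eis]; the error is
     handled by [near_sum_cvg0], the other inverse powers being bounded. *)
  have -> : (fun M : nat => \sum_(i < M + M.+1)
      @kapH R N i (M + M - i) m k * (x + (i%:R - M%:R))^-1 ^+ k.+1) =
    (fun M => \sum_(i < M + M.+1) (@kapH R N i (M + M - i) m k - kap Phi Phi' m k) *
      (x + (i%:R - M%:R))^-1 ^+ k.+1) \+ (fun M => kap Phi Phi' m k * eis k.+1 M x).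
    apply/funext => M /=; rewrite eE mulr_sumr -big_split /=; apply: eq_bigr => i _; ring.
  rewrite -[if _ is _.+1 then _ else _]add0r; apply: cvgD; last first.
    case: (k) => [|k'].
      rewrite (_ : (fun M => _) = fun=> 0); first exact: cvg_cst.
      by apply/funext => M; rewrite kap_0 ?mul0r.
    by apply: cvgMr; exact: eis_cvg.
  have c1 := near_sum_cvg0 x01.
  have {c1} : (fun M => C / 2 * (eis2 x + 1) ^+ k * \sum_(i < M + M.+1)
     `|(x + (i%:R - M%:R))^-1| * (inv_succ R i + inv_succ R (M + M - i))) @ \oo --> (0 : R).
    by rewrite -[X in _ --> X](mulr0 (C / 2 * (eis2 x + 1) ^+ k)); exact: cvgMr c1.
  move=> c1; apply: norm_cvg0; apply: (squeeze_cvgr _ (cvg_cst 0) c1).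
  near=> M; rewrite normr_ge0 /=; apply: (le_trans (ler_norm_sum _ _ _)).
  rewrite mulr_sumr; apply: ler_sum => i _.
  have dM : i%:R - M%:R \in sint R M.
    by apply/mapP; exists (i : nat) => //; rewrite mem_iota add0n ltn_ord.
  have yW := shift_inv_le x01 dM.
  have hi := h (nat_of_ord i, (M + M - i)%N).
  rewrite normrM normrX exprS.
  apply: (@le_trans _ _ (C * (pair_inv R (nat_of_ord i, (M + M - i)%N) / 2) *
     (`|(x + (i%:R - M%:R))^-1| * (eis2 x + 1) ^+ k))).
    apply: ler_pM; [exact: normr_ge0|by rewrite mulr_ge0 ?exprn_ge0 ?normr_ge0|exact: hi|].
    rewrite ler_wpM2l ?normr_ge0 // lerXn2r ?nnegrE ?normr_ge0 //.
    exact: (le_trans (normr_ge0 _) yW).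
  by rewrite /pair_inv le_eqVlt; apply/orP; left; apply/eqP => /=; ring.
rewrite (_ : (fun M => hs _ m) = fun M => \sum_(k < N) \sum_(i < M + M.+1)
    @kapH R N i (M + M - i) m k * (x + (i%:R - M%:R))^-1 ^+ k.+1); last first.
  by apply/funext => M; exact: hs_sint.
have -> : (F m).[tau x] = \sum_(k < N)
   (if (k : nat) is k'.+1 then kap Phi Phi' m k * (pP (pi ^+ 2) k').[tau x] else 0).
  rewrite /Fp -/N nN big_ord_recl /= (negPf m0) !add0r horner_sum; apply: eq_bigr => k _.
  by rewrite hornerZ.
by apply: cvg_big => [|k _]; [exact: add_continuous | exact: key].
Unshelve. all: end_near. Qed.

Lemma tau_inj (x y : R) : 0 < x < 1 -> 0 < y < 1 -> tau x = tau y -> x = y.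
Proof.
wlog xy : x y / x < y => [H|x01 y01].
  by case: (ltgtP x y) => // h x01 y01 e; [exact: H|apply/esym; exact: H].
have sx := sin_pi_neq0 x01; have sy := sin_pi_neq0 y01.
rewrite /tau => e; exfalso.
have d01 : 0 < y - x < 1 by lra.
have := sin_pi_neq0 d01; rewrite mulrBr sinB.
suff -> : sin (pi * y) * cos (pi * x) - cos (pi * y) * sin (pi * x) = 0 by rewrite ltxx.
have pn : pi != 0 :> R by rewrite gt_eqF ?pi_gt0.
have e' : pi * (cos (pi * x) * sin (pi * y)) = pi * (cos (pi * y) * sin (pi * x)).
  have sx0 : sin (pi * x) != 0 by rewrite gt_eqF.
  have sy0 : sin (pi * y) != 0 by rewrite gt_eqF.
  by rewrite !mulrA; apply/eqP; rewrite -(eqr_div _ _ sx0 sy0) e.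
by rewrite mulrC (mulfI pn e') subrr.
Qed.

(** The cotangent takes infinitely many values, so an identity between limits at real [x] can be
    evaluated in any commutative algebra over the reals. *)
Lemma poly_eq_tau (p q : {poly R}) : (forall x, 0 < x < 1 -> p.[tau x] = q.[tau x]) -> p = q.
Proof.
move=> h; apply/eqP; rewrite -subr_eq0; apply/negPn/negP => pq0.
pose s := [seq tau (i.+2%:R^-1 : R) | i <- iota 0 (size (p - q))].
have i01 (i : nat) : 0 < (i.+2%:R^-1 : R) < 1.
  by rewrite invr_gt0 ltr0n /= invf_lt1 ?ltr0n // ltr1n.
have := @max_poly_roots R (p - q) s pq0.
rewrite size_map size_iota ltnn => H; suff : false by []; apply: H.
  by apply/allP => _ /mapP[i _ ->]; rewrite /root hornerD hornerN h ?subrr.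
rewrite map_inj_uniq ?iota_uniq // => i j /(tau_inj (i01 i) (i01 j)) /invr_inj /eqP.
by rewrite eqr_nat => /eqP [].
Qed.

Theorem Fp_harmonic u v : F u * F v = \sum_(w <- qsh harm_merge u v) F w.
Proof.
apply: poly_eq_tau => x x01; rewrite hornerM horner_sum.
have c1 : (fun M => hs [seq (x + d)^-1 | d <- sint R M] u) \*
   (fun M => hs [seq (x + d)^-1 | d <- sint R M] v) @ \oo --> (F u).[tau x] * (F v).[tau x].
  by apply: cvgM; exact: hs_sint_cvg.
have c2 : (fun M => \sum_(w <- qsh harm_merge u v) hs [seq (x + d)^-1 | d <- sint R M] w) @ \oo -->
   \sum_(w <- qsh harm_merge u v) (F w).[tau x].
  by apply: cvg_big => [|w _]; [exact: add_continuous | exact: hs_sint_cvg].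
have e : (fun M => \sum_(w <- qsh harm_merge u v) hs [seq (x + d)^-1 | d <- sint R M] w) =
   (fun M => hs [seq (x + d)^-1 | d <- sint R M] u) \* (fun M => hs [seq (x + d)^-1 | d <- sint R M] v).
  by apply/funext => M; exact: (grouplikeE u v (hs_grouplike _)).
by rewrite -(cvg_lim (@Rhausdorff R) c1) -(cvg_lim (@Rhausdorff R) c2) e.
Qed.

End HarmonicPolynomials.

(** * The cotangent as a [q]-series *)

Section CotangentSeries.
Variables (R : realType) (t : nat).
Local Notation K := R[i].
Local Notation C := (tq K t).
Local Notation tin := (tin K t).
Local Notation iota := (tconst K t).
Local Notation c := (cpi R).
Local Notation rc := (real_complex R).

Lemma cpi_sq : c ^+ 2 = - (4 * rc (pi ^+ 2)).
Proof.
rewrite /cpi /= expr2; apply/eqP; rewrite eq_complex /=; apply/andP; split; apply/eqP; ring.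
Qed.

Lemma tinE (p p' : {poly K}) : tin p = tin p' <-> (forall s, (s <= t)%N -> p`_s = p'`_s).
Proof.
split=> [e s st|h]; first by rewrite -(tcf_tin _ st) e tcf_tin.
by apply: tcf_ext => s st; rewrite !tcf_tin // h.
Qed.

(** Unlike [d/dq], the operator [q d/dq] is defined modulo [q^(t+1)]. *)
Lemma tin_deriv (p p' : {poly K}) : tin p = tin p' -> tin ('X * p^`()) = tin ('X * p'^`()).
Proof.
move=> /tinE h; apply/tinE => -[|s] st; rewrite !coefXM //= !coef_deriv h //.
Qed.

Lemma tinZ a (p : {poly K}) : tin (a *: p) = iota a * tin p.
Proof. by rewrite -mul_polyC rmorphM. Qed.

Lemma tin_cancel (p p' : {poly K}) : tin ((1 - 'X) * p) = tin ((1 - 'X) * p') -> tin p = tin p'.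
Proof.
have inv : (\sum_(i < t.+1) tin 'X ^+ i) * tin (1 - 'X) = 1.
  rewrite rmorphB rmorph1 -opprB mulrN mulrC -subrX1 tinX sub0r opprK //.
by rewrite !rmorphM => e; rewrite -[LHS]mul1r -[RHS]mul1r -inv -!mulrA e.
Qed.

Lemma deriv_bigsum (I : Type) (r : seq I) (F : I -> {poly K}) :
  (\sum_(i <- r) F i)^`() = \sum_(i <- r) (F i)^`().
Proof. by elim/big_rec2: _ => [|i x y _ <-]; rewrite ?derivD // -polyC0 derivC. Qed.

Lemma X_deriv_sum (a : nat -> K) :
  'X * (\sum_(1 <= v < t.+1) a v *: 'X^v)^`() = \sum_(1 <= v < t.+1) (a v * v%:R) *: 'X^v.
Proof.
rewrite deriv_bigsum mulr_sumr; apply: eq_big_nat => v /andP[v0 _].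
apply/polyP => -[|s]; rewrite coefXM ?coef_deriv !coefZ !coefXn /=.
  by case: v v0 => // v _; rewrite mulr0.
by case: eqP => [<-|_]; rewrite ?mulr0 ?mul0rn // !mulr1 mulr_natr.
Qed.

Definition geo : {poly K} := \sum_(1 <= v < t.+1) 1 *: 'X^v.
(** The expansion of [pi cot (pi x)] in [q = e^(2 pi i x)]. *)
Definition tauq : {poly K} := c *: (2^-1%:P + geo).
(** The right-hand side of Lipschitz's formula for the sum of the [(x + n)^-(b + 2)] over the
    integers [n]. *)
Definition divs (b : nat) : {poly K} :=
  (c ^+ b.+2 / b.+1`!%:R) *: \sum_(1 <= v < t.+1) v%:R ^+ b.+1 *: 'X^v.

Lemma geo_mul : (1 - 'X) * geo = 'X - 'X^(t.+1).
Proof.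
rewrite /geo; elim: t => [|n IH]; first by rewrite big_nil mulr0 subrr.
by rewrite big_nat_recr //= mulrDr IH scale1r [in RHS]exprS; ring.
Qed.

(** Apply [q d/dq] to [(1 - q) geo = q], then cancel [1 - q]. *)
Lemma tin_geo_sq : tin (geo + geo ^+ 2) = tin ('X * geo^`()).
Proof.
have gX : tin ((1 - 'X) * geo) = tin 'X.
  by rewrite geo_mul rmorphB /= rmorphXn tinX subr0.
apply: tin_cancel.
have -> : (1 - 'X) * (geo + geo ^+ 2) = (1 - 'X) * geo * (1 + geo) by ring.
rewrite rmorphM gX -rmorphM.
have := tin_deriv gX; rewrite derivM derivB derivX derivC mulr1.
have -> : 'X * ((0 - 1) * geo + (1 - 'X) * geo^`()) = (1 - 'X) * ('X * geo^`()) - 'X * geo by ring.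
rewrite rmorphB => /eqP; rewrite subr_eq => /eqP ->.
by rewrite -rmorphD; congr (tin _); ring.
Qed.

(** The differential equation [y' = - (y^2 + pi^2)] of the cotangent, where [d/dx = - c q d/dq]. *)
Lemma tauq_sq : tin (tauq ^+ 2 + (rc (pi ^+ 2))%:P) = tin (divs 0).
Proof.
have -> : tauq ^+ 2 + (rc (pi ^+ 2))%:P = c ^+ 2 *: (geo + geo ^+ 2).
  have -> : rc (pi ^+ 2) = - (c ^+ 2 / 4) by rewrite cpi_sq; field.
  rewrite /tauq -!mul_polyC polyCN polyCM !polyC_exp.
  have -> : (4^-1)%:P = (2^-1)%:P * (2^-1)%:P :> {poly K} by rewrite -polyCM; congr polyC; field.
  have e2 : (2^-1)%:P + (2^-1)%:P = 1 :> {poly K} by rewrite -polyCD (_ : 2^-1 + 2^-1 = 1 :> K) //; field.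
  transitivity (c%:P ^+ 2 * (((2^-1)%:P + (2^-1)%:P) * geo + geo ^+ 2)); first by ring.
  by rewrite e2 mul1r.
have -> : divs 0 = c ^+ 2 *: ('X * geo^`()).
  rewrite /divs /geo X_deriv_sum -[1`!]/1%N divr1; congr (_ *: _).
  by apply: eq_bigr => v _; rewrite mul1r expr1.
by rewrite !tinZ tin_geo_sq.
Qed.

Lemma pP_tauq b : tin (map_poly rc (pP (pi ^+ 2) b) \Po tauq) = tin (divs b).
Proof.
have m0 : map_poly rc ('X^2 + (pi ^+ 2)%:P) \Po tauq = tauq ^+ 2 + (rc (pi ^+ 2))%:P.
  by rewrite rmorphD /= map_polyXn map_polyC comp_polyD comp_polyC comp_Xn_poly.
elim: b => [|b IH]; first by rewrite [pP _ _]/= m0 tauq_sq.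
set Q := map_poly rc (pP (pi ^+ 2) b) in IH *.
rewrite [pP _ _]/= map_polyZ rmorphM /= -deriv_map -/Q comp_polyZ comp_polyM m0 tinZ rmorphM tauq_sq.
have -> : divs 0 = c *: ('X * tauq^`()).
  rewrite /tauq derivZ derivD derivC add0r -scalerAr scalerA -expr2.
  rewrite /divs /geo X_deriv_sum -[1`!]/1%N divr1; congr (_ *: _).
  by apply: eq_bigr => v _; rewrite mul1r expr1.
have := tin_deriv IH; rewrite deriv_comp => e.
rewrite -rmorphM -scalerAl -mulrA [tauq^`() * _]mulrC tinZ e -!tinZ.
congr (tin _); rewrite /divs derivZ -!scalerAr X_deriv_sum !scalerA; congr (_ *: _); last first.
  by apply: eq_bigr => v _; rewrite -exprSr.
rewrite fmorphV rmorph_nat [c ^+ b.+3]exprS (factS b.+1) natrM.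
by rewrite invfM; ring.
Qed.

(** The substitution [q |-> q^k]; by [subk_eq] it depends, for [k > 0], on its argument modulo
    [q^(t+1)] only. *)
Definition subk (k : nat) : {rmorphism {poly K} -> C} := tin \o comp_poly 'X^k.

Lemma subkC k a : subk k a%:P = iota a.
Proof. by rewrite /subk /= comp_polyC. Qed.

Lemma subkX k : subk k 'X = tin 'X ^+ k.
Proof. by rewrite /subk /= comp_polyX rmorphXn. Qed.

Lemma subk_eq k (p p' : {poly K}) : (0 < k)%N -> tin p = tin p' -> subk k p = subk k p'.
Proof.
move=> k0 /tinE h; apply/eqP; rewrite -subr_eq0 -rmorphB.
have -> : p - p' = drop_poly t.+1 (p - p') * 'X^(t.+1).
  rewrite -[LHS](poly_take_drop t.+1) [take_poly _ _](_ : _ = 0) ?add0r //.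
  apply/polyP => s; rewrite coef_take_poly coef0 coefB; case: ifP => // st.
  by rewrite h ?subrr.
rewrite rmorphM rmorphXn subkX -exprM mulnC exprM tinX expr0n.
by rewrite eqn0Ngt k0 mulr0.
Qed.

Lemma subk_comp k (Q f : {poly K}) : subk k (Q \Po f) = (map_poly iota Q).[subk k f].
Proof.
rewrite [Q \Po f]/comp_poly -horner_map -map_poly_comp; congr (_.[_]).
by apply: eq_map_poly => a; exact: subkC.
Qed.

Definition Ev (k : nat) (p : {poly R}) : C := (map_poly (iota \o rc) p).[subk k tauq].

Lemma EvM k p p' : Ev k (p * p') = Ev k p * Ev k p'.
Proof. by rewrite /Ev rmorphM hornerM. Qed.

Lemma Ev_sum k I (r : seq I) (F : I -> {poly R}) :
  Ev k (\sum_(i <- r) F i) = \sum_(i <- r) Ev k (F i).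
Proof. by rewrite /Ev rmorph_sum horner_sum. Qed.

Lemma Ev_pP k b : (0 < k)%N -> Ev k (pP (pi ^+ 2) b) =
  iota (c ^+ b.+2 / b.+1`!%:R) * \sum_(1 <= v < t.+1) v%:R ^+ b.+1 * tin 'X ^+ (k * v).
Proof.
move=> k0; rewrite /Ev map_poly_comp -subk_comp (subk_eq k0 (pP_tauq b)).
rewrite /divs -mul_polyC rmorphM subkC; congr (_ * _).
rewrite rmorph_sum; apply: eq_bigr => v _.
by rewrite -mul_polyC rmorphM subkC !rmorphXn subkX -exprM rmorph_nat.
Qed.

End CotangentSeries.

Section Coefficients.
Variables (A B : comNzRingType) (f : {rmorphism A -> B}).

Definition ncs_map (F : ncs bool A) : ncs bool B := fun w => f (F w).

Lemma ncs_mapM F G : ncs_map (F * G) = ncs_map F * ncs_map G.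
Proof.
apply/funext => w; rewrite /ncs_map !ncsME rmorph_sum.
by apply: eq_bigr => k _; rewrite rmorphM.
Qed.

Lemma ncs_map1 : ncs_map 1 = 1.
Proof. by apply/funext => -[|a w]; rewrite /ncs_map ?rmorph1 ?rmorph0. Qed.

Lemma ncs_map_lett a : ncs_map (lett a) = lett a.
Proof. by apply/funext => w; rewrite /ncs_map /lett rmorph_nat. Qed.

Lemma ncs_mapX F k : ncs_map (F ^+ k) = ncs_map F ^+ k.
Proof. by elim: k => [|k IH]; rewrite ?expr0 ?ncs_map1 // !exprS ncs_mapM IH. Qed.

Lemma kap_map Phi Phi' m k :
  kap (ncs_map Phi) (ncs_map Phi') m k = f (kap Phi Phi' m k).
Proof. by rewrite /kap -!ncs_map_lett -ncs_mapX -!ncs_mapM. Qed.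

Lemma ncs_map_grouplike (merge : bool -> bool -> seq bool) F :
  grouplike merge F -> grouplike merge (ncs_map F).
Proof.
move=> h; apply/funext => u; apply/funext => v; rewrite /dl /tns /ncs_map.
by rewrite -rmorphM -(grouplikeE u v h) rmorph_sum.
Qed.

End Coefficients.

Section TruncatedExp.
Variables (K : numFieldType) (C : comNzRingType) (iota : {rmorphism K -> C}).
Local Notation e0 := (lett false : ncs bool C).

Lemma lettX k v : (e0 ^+ k) v = (v == nseq k false)%:R.
Proof.
elim: k v => [|k IH] v; first by case: v.
rewrite exprS; case: v => [|a v]; first by rewrite lettM_nil.
rewrite lettM_cons IH -natrM mulnb eqseq_cons //.
Qed.

Lemma exs_trunc y n v : (size v < n)%N ->
  exs iota false 0 y v = (\sum_(a < n) (iota (a`!%:R^-1) * y ^+ a) *: e0 ^+ a) v.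
Proof.
move=> sv; rewrite ncs_sum (bigD1 (Ordinal sv)) //= big1 ?addr0; last first.
  move=> a /eqP av; rewrite ncsZ lettX; case: eqP => [e|_]; last by rewrite mulr0.
  by case: av; apply: val_inj; rewrite /= e size_nseq.
rewrite ncsZ lettX /exs addn0; have -> : (v == nseq (size v) false) = all (pred1 false) v.
  by apply/eqP/all_pred1P.
by case: all; rewrite ?mulr1 ?mulr0.
Qed.

(** The word without its leading [1] has fewer than [weight m] letters, so higher powers of [e0] do
    not fit into it. *)
Lemma Mser_kap (Phi Phi' : ncs bool C) x j m : Mser iota Phi Phi' x j m =
  \sum_(a < weight m) iota (a`!%:R^-1) * (j%:R * x) ^+ a * kap Phi Phi' m a.
Proof.
case: m => [|b m]; first by rewrite /Mser /rho lettM_nil big_ord0.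
rewrite /Mser /rho /kap yword_cons lettM_eq.
set w := nseq b.+1 false ++ yword m.
have sw : (size w < weight (b :: m))%N.
  by rewrite size_cat size_nseq size_yword /weight /= !addSn.
set n := weight _ in sw *.
have eE : eqn (size w) (exs iota false 0 (j%:R * x))
    (\sum_(a < n) (iota (a`!%:R^-1) * (j%:R * x) ^+ a) *: e0 ^+ a).
  by move=> v sv; apply: exs_trunc; exact: leq_ltn_trans sw.
have eqnn (h : ncs bool C) : eqn (size w) h h by [].
rewrite (eqnM (eqnM (eqnn Phi') eE) (eqnn Phi) (leqnn _)).
rewrite mulr_sumr mulr_suml ncs_sum; apply: eq_bigr => a _.
by rewrite -scalerAr -scalerAl ncsZ -[Phi' * _ * Phi]mulrA lettM_eq.
Qed.

End TruncatedExp.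

(** * The factors [1 + Psi_k] as values of polynomials *)

Section PsiHarmonic.
Variables (R : realType) (t : nat).
Local Notation K := R[i].
Local Notation C := (tq K t).
Local Notation iota := (tconst K t).
Local Notation rc := (real_complex R).
Local Notation f := (iota \o rc : {rmorphism R -> C}).
Local Notation c := (iota (cpi R)).
Local Notation q := (tin K t 'X).
Variables (Phi Phi' : ncs bool R).
Hypothesis PhiG : grouplike (fun _ _ => [::]) Phi.
Hypothesis Phi_nil : Phi [::] = 1.
Hypothesis PhiK : Phi' * Phi = 1.
Hypothesis Phi_0 : Phi [:: false] = 0.
Hypothesis Phi_zeta : forall m, Phi (yword m) = zeta R [seq a.+2 | a <- m].

(** The term [a = b + 1] of the conjugated exponentials, summed over [v] against [q ^+ (k * v)], is
    a Lipschitz series, hence the value of [pP b]; the term [a = 0] vanishes by [kap_0]. *)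
Lemma Psi_Ev k m : (0 < k)%N ->
  (1 + Psi q c t (Mser iota (ncs_map f Phi) (ncs_map f Phi') c) k) m = Ev t k (Fp Phi Phi' m).
Proof.
move=> k0; rewrite ncsD (_ : (1 : ncs nat C) m = (m == [::])%:R); last by case: (m).
rewrite /Fp /Ev rmorphD hornerD rmorph_nat -polyC_natr hornerC; congr (_ + _).
rewrite rmorph_sum horner_sum /Psi ncsZ ncs_sum.
rewrite (eq_bigr (fun v => \sum_(a < weight m) q ^+ (k * v) *
   (iota (a`!%:R^-1) * (v%:R * c) ^+ a * f (kap Phi Phi' m a)))); last first.
  by move=> v _; rewrite ncsZ Mser_kap mulr_sumr; apply: eq_bigr => a _; rewrite kap_map.
rewrite exchange_big /=; case: (weight m) => [|n]; first by rewrite !big_ord0 mulr0.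
have z : kap Phi Phi' m (ord0 : 'I_n.+1) = 0 by exact: kap_0.
rewrite (big_ord_recl n) big1 ?add0r; last by move=> v _; rewrite z rmorph0 !mulr0.
rewrite mulr_sumr; apply: eq_bigr => b _; rewrite lift0 map_polyZ hornerZ -/(Ev t k _) Ev_pP //.
rewrite !mulr_sumr; apply: eq_bigr => v _.
have -> : iota (cpi R ^+ b.+2 / b.+1`!%:R) = c * c ^+ b.+1 * iota (b.+1`!%:R^-1).
  by rewrite rmorphM rmorphXn exprS.
have rearrange (x1 x2 x3 x4 x5 x6 : C) :
   x1 * (x2 * (x3 * (x4 * x5) * x6)) = x6 * (x1 * x5 * x3 * (x4 * x2)) by ring.
by rewrite exprMn; exact: rearrange.
Qed.

Lemma Psi_grouplike k : (0 < k)%N ->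
  grouplike harm_merge (1 + Psi q c t (Mser iota (ncs_map f Phi) (ncs_map f Phi') c) k).
Proof.
move=> k0; apply/funext => u; apply/funext => v; rewrite /dl /tns !Psi_Ev // -EvM Fp_harmonic //.
by rewrite Ev_sum; apply: eq_bigr => w _; rewrite Psi_Ev.
Qed.

End PsiHarmonic.

Section ZetaHarmonic.
Variable R : realType.
Local Open Scope classical_set_scope.

Lemma zeta_harmonic u v : zeta R [seq a.+2 | a <- u] * zeta R [seq a.+2 | a <- v] =
  \sum_(w <- qsh harm_merge u v) zeta R [seq a.+2 | a <- w].
Proof.
have c1 : (fun B => hs (inv1 R B) u) \* (fun B => hs (inv1 R B) v) @ \oo -->
    zeta R [seq a.+2 | a <- u] * zeta R [seq a.+2 | a <- v].
  by apply: cvgM; exact: zeta_cvg.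
have c2 : (fun B => \sum_(w <- qsh harm_merge u v) hs (inv1 R B) w) @ \oo -->
   \sum_(w <- qsh harm_merge u v) zeta R [seq a.+2 | a <- w].
  by apply: cvg_big => [|w _]; [exact: add_continuous | exact: zeta_cvg].
have e : (fun B => \sum_(w <- qsh harm_merge u v) hs (inv1 R B) w) =
   (fun B => hs (inv1 R B) u) \* (fun B => hs (inv1 R B) v).
  by apply/funext => B; exact: (grouplikeE u v (hs_grouplike _)).
by rewrite -(cvg_lim (@Rhausdorff R) c1) -(cvg_lim (@Rhausdorff R) c2) e.
Qed.

End ZetaHarmonic.

Lemma map_shift_harmonic u v :
  harmonic [seq a.+2 | a <- u] [seq a.+2 | a <- v] =
  [seq [seq a.+2 | a <- w] | w <- qsh harm_merge u v].
Proof.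
elim: u v => [|a u IHu] v //; elim: v => [|b v IHv] //.
rewrite -[LHS]/([seq a.+2 :: w | w <- harmonic [seq a.+2 | a <- u] [seq a.+2 | a <- b :: v]] ++
  [seq b.+2 :: w | w <- harmonic [seq a.+2 | a <- a :: u] [seq a.+2 | a <- v]] ++
  [seq (a.+2 + b.+2)%N :: w | w <- harmonic [seq a.+2 | a <- u] [seq a.+2 | a <- v]]).
rewrite -[qsh _ _ _]/([seq a :: w | w <- qsh harm_merge u (b :: v)] ++
  [seq b :: w | w <- qsh harm_merge (a :: u) v] ++
  ([seq (a + b).+2 :: w | w <- qsh harm_merge u v] ++ [::])).
rewrite cats0 !map_cat !IHu IHv -!map_comp; congr (_ ++ (_ ++ _)).
by apply: eq_map => w /=; rewrite addSn addnS addnS !addSn.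
Qed.

(** * Comparison of the harmonic and the shuffle product *)

Section DoubleShuffle.
Variables (R : realType) (Delta : {linear I1 -> tensor I1 I1}).
Hypothesis Delta_goncharov : is_goncharov_coproduct Delta.
Variable Zsh : {linear HH -> {poly R} | ratr \; *:%R}.
Hypothesis hZ : is_shuffle_regularisation Zsh.
Variable z : {linear I1 -> R | ratr \; *%R}.
Hypothesis z_words : forall n : seq nat, is_index n -> z (Iw n) = zeta_sh Zsh n.
Variable g : {linear I1 -> (nat -> R[i]^o) | ratr \; *:%R}.
Hypothesis g_words : forall n : seq nat, is_index n -> g (Iw n) = g_sh R n.
Variable t : nat.
Local Notation K := R[i].
Local Notation C := (tq K t).
Local Notation iota := (tconst K t).
Local Notation f := (iota \o real_complex R : {rmorphism R -> C}).
Local Notation c := (iota (cpi R)).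
Local Notation q := (tin K t 'X).
Let Phi := Zser z false true.
Let Phi' := Zser z true false.

Let PhiG : grouplike (fun _ _ => [::]) Phi. Proof. exact: (Zser_grouplike hZ z_words). Qed.
Let Phi'G : grouplike (fun _ _ => [::]) Phi'. Proof. exact: (Zser_grouplike hZ z_words). Qed.
Let PhiK : Phi * Phi' = 1. Proof. exact: (ZserK hZ z_words). Qed.
Let PhiK' : Phi' * Phi = 1. Proof. exact: (ZserK hZ z_words). Qed.

Let Phi_zeta m : Phi (yword m) = zeta R [seq a.+2 | a <- m].
Proof.
apply: (Zser_zeta hZ z_words); rewrite /admissible; apply/andP; split.
  by apply/allP => _ /mapP[a _ ->].
by case/lastP: m => // m a; rewrite map_rcons last_rcons.
Qed.

Definition Sser : ncs bool C :=
  Sprod iota (ncs_map f Phi) (ncs_map f Phi') q c t c t * ncs_map f Phi.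

Lemma coproduct_Sser w :
  tens_map z g (Delta (Iint false w true)) t = tcf t (Sser w).
Proof.
have ZCE a b : ZC z iota a b = ncs_map f (Zser z a b) by [].
rewrite (@coproduct_formula _ _ Delta_goncharov _ hZ _ z_words _ _ iota (tcf t) _ _ _ (Pt R t)).
- rewrite /Pt sigma_Pprod //.
  + by move=> a x b; rewrite !ZCE -ncs_mapM -(Zser_path hZ z_words).
  + by move=> a; rewrite ZCE -(ncs_map1 f) -(Zser_diag hZ z_words a).
- exact: tcfD.
- by move=> a x; exact: tcfZ.
- exact: g_Pt.
Qed.

Lemma Sser_grouplike : grouplike (fun _ _ => [::]) Sser.
Proof.
apply: (@Sprod_grouplike _ _ iota (fun a b => ncs_map f (Zser z a b))); exact: ncs_map_grouplike.
Qed.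

Lemma rho_Sser_grouplike : grouplike harm_merge (rho Sser).
Proof.
rewrite /Sser rho_Sprod -?ncs_mapM ?PhiK ?PhiK' ?ncs_map1 ?tinX //.
apply: grouplikeM.
  apply/funext => u; apply/funext => v; rewrite /dl /tns /rho /ncs_map !Phi_zeta -rmorphM zeta_harmonic.
  by rewrite rmorph_sum; apply: eq_bigr => w _; rewrite Phi_zeta.
rewrite big_add1; apply: grouplike_prod => k; apply: (Psi_grouplike t PhiG _ PhiK') => //.
  exact: (Zser_nil hZ z_words).
exact: Zser_0.
Qed.

Lemma tens_map_Delta_sum (I : Type) (r : seq I) (F : I -> word) :
  tens_map z g (Delta (\sum_(i <- r) Iint false (F i) true)) t = tcf t (\sum_(i <- r) Sser (F i)).
Proof.
rewrite linear_sum tens_map_sum tcf_sum; apply: eq_bigr => i _; exact: coproduct_Sser.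
Qed.

(** Both sides are the coefficient of [q^t] in [Sser (yword u) * Sser (yword v)]. *)
Lemma harmonic_shuffle_Delta u v :
  tens_map z g (Delta (\sum_(w <- qsh harm_merge u v) Iint false (yword w) true)) t =
  tens_map z g (Delta (Iint false (yword u) true * Iint false (yword v) true)) t.
Proof.
rewrite Iint_qsh !tens_map_Delta_sum (grouplikeE _ _ Sser_grouplike).
by rewrite -[\sum_(w <- _) _]/(\sum_(w <- qsh harm_merge u v) rho Sser w) (grouplikeE _ _ rho_Sser_grouplike).
Qed.

End DoubleShuffle.

Theorem theorem4p4 (R : realType)
  (Delta : {linear I1 -> tensor I1 I1})
  (Delta_goncharov : is_goncharov_coproduct Delta)
  (har : {bilinear I1 -> I1 -> I1})
  (har_words : is_har har)
  (Zsh : {linear HH -> {poly R} | ratr \; *:%R})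
  (Zsh_regularisation : is_shuffle_regularisation Zsh)
  (z : {linear I1 -> R | ratr \; *%R})
  (z_words : forall n : seq nat, is_index n -> z (Iw n) = zeta_sh Zsh n)
  (g : {linear I1 -> (nat -> R[i]^o) | ratr \; *:%R})
  (g_words : forall n : seq nat, is_index n -> g (Iw n) = g_sh R n)
  (w1 w2 : seq nat) (w1_ge2 : all (leq 2) w1) (w2_ge2 : all (leq 2) w2) :
  forall t : nat, tens_map z g (Delta (har (Iw w1) (Iw w2) - Iw w1 * Iw w2)) t = 0.
Proof.
move=> t.
have shift w : all (leq 2) w -> exists u, w = [seq a.+2 | a <- u].
  elim: w => [|[|[|a]] w IH] //= h; first by exists [::].
  by have [u ->] := IH h; exists (a :: u).
have index u : is_index [seq a.+2 | a <- u] by apply/allP => _ /mapP[a _ ->].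
have [[u ->] [v ->]] := (shift _ w1_ge2, shift _ w2_ge2).
rewrite har_words //.
have -> (s : seq (seq nat)) : \sum_(w <- undup s) (count_mem w s)%:R *: Iw w = \sum_(w <- s) Iw w.
  by rewrite -[RHS]big_undup_iterop_count; apply: eq_bigr => w _; rewrite scaler_nat.
rewrite map_shift_harmonic big_map linearB.
have tensB (x y : tensor I1 I1) : tens_map z g x t = tens_map z g y t -> tens_map z g (x - y) t = 0.
  move=> e; have := tens_mapD z g (x - y) y t; rewrite subrK e => /eqP.
  by rewrite eq_sym -subr_eq0 addrK => /eqP.
apply: tensB.
exact: (harmonic_shuffle_Delta Delta_goncharov Zsh_regularisation z_words g_words).
Qed.
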